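(* Let $\alpha(x)$ be a positive sub-polynomial such that, for every $\kappa>0$, the sequence $(\kappa\alpha(n))_{n\in\mathbb{N}}$ is uniformly distributed mod $1$. Then there is a sequence $w\colon\mathbb{N}\to(0,+\infty)$ with $w(N)\searrow0$ such that, for every $N\in\mathbb{N}$, every measure-preserving system $(X,\mathcal{B},\mu,T)$, and all $A,B\in\mathcal{B}$, we have $$\left|\frac{1}{\alpha(N)}\sum_{n=1}^N\alpha'(n)\,\mu\bigl(A\cap T^{-\lfloor\alpha(n)\rfloor}B\bigr)-\frac{1}{\alpha(N)}\sum_{1\leq m\leq\alpha(N)}\mu\bigl(A\cap T^{-m}B\bigr)\right|\leq w(N)\sqrt{\mu(A)\mu(B)}.$$
   Context: $\mathbb{N}=\{1,2,\dots\}$. A measure-preserving system is a quadruple $(X,\mathcal{B},\mu,T)$ where $(X,\mathcal{B},\mu)$ is a probability space and $T:X\to X$ is measurable and invertible with measurable inverse, and $\mu(T(A))=\mu(A)$ for all $A\in\mathcal{B}$. $w(N)\searrow 0$ means that $w$ decreases to $0$. Let $\mathcal{G}$ be the ring (under pointwise addition and multiplication) of germs at $+\infty$ of continuous real-valued functions defined on half-lines $(a,+\infty)$; two functions have the same germ if they agree for all sufficiently large $x$. A Hardy field is a subfield of $\mathcal{G}$ closed under differentiation (each element is eventually differentiable and its derivative's germ lies in the field). A sub-polynomial is a function $\alpha$ whose germ belongs to some Hardy field and which satisfies $\lim_{x\to+\infty}\alpha(x)/x^l=0$ for some $l>0$. Functions and germs are not distinguished; when values $\alpha(n)$, $\alpha'(n)$,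 $n\in\mathbb{N}$, appear, $\alpha$ denotes a fixed real-valued representative defined, positive and differentiable on $[1,+\infty)$. *)

(* Defs.v *)
From HB Require Import structures.
From mathcomp Require Import all_boot all_order all_algebra.
From mathcomp Require Import all_classical all_reals all_analysis.
Import Order.TTheory GRing.Theory Num.Theory.
Import numFieldNormedType.Exports.

Set Implicit Arguments.
Unset Strict Implicit.
Unset Printing Implicit Defensive.

Local Open Scope classical_set_scope.
Local Open Scope ring_scope.

(* A set of germs at +oo is encoded by the set of all total functions
   representing its members, i.e. by a set H closed under eventual equality;
   values off a half-line are irrelevant.  Since 1 <> 0 in the ring of germs,
   the field axioms below say exactly that H is a subfield of that ring. *)
Record hardy_field (R : realType) (H : set (R -> R)) : Prop := HardyField {
  hardy_germ : forall f g : R -> R,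
    H f -> (\forall x \near +oo, f x = g x) -> H g;
  hardy_continuous : forall f : R -> R,
    H f -> \forall x \near +oo, {for x, continuous f};
  hardy1 : H (fun=> 1);
  hardyB : forall f g : R -> R, H f -> H g -> H (fun x => f x - g x);
  hardyM : forall f g : R -> R, H f -> H g -> H (fun x => f x * g x);
  hardyV : forall f : R -> R, H f -> ~ (\forall x \near +oo, f x = 0) ->
    exists2 g : R -> R, H g & \forall x \near +oo, f x * g x = 1;
  hardy_derivable : forall f : R -> R,
    H f -> \forall x \near +oo, derivable f x 1;
  hardy_derive : forall f : R -> R, H f -> H (derive1 f)
}.

Definition sub_polynomial (R : realType) (f : R -> R) : Prop :=
  (exists2 H : set (R -> R), hardy_field H & H f) /\
  (exists2 l : R, 0 < l & f x / x `^ l @[x --> +oo] --> (0 : R)).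

Definition frac_part (R : realType) (x : R) : R := x - (Num.floor x)%:~R.

(* The sequence is u 1, u 2, ...; the value u 0 plays no role. *)
Definition uniformly_distributed_mod1 (R : realType) (u : nat -> R) : Prop :=
  forall a b : R, 0 <= a -> a < b -> b <= 1 ->
    (count (fun n => a <= frac_part (u n) < b) (iota 1 N))%:R / N%:R
      @[N --> \oo] --> b - a.

Definition measure_preserving_system (R : realType) (d : measure_display)
    (X : measurableType d) (mu : probability X R) (T : X -> X) : Prop :=
  [/\ measurable_fun setT T,
      exists S : X -> X, [/\ cancel T S, cancel S T & measurable_fun setT S]
    & forall A : set X, measurable A -> mu (T @` A) = mu A].

(* mu (A `&` T^{-m} B), as a real number. *)
Definition correlation (R : realType) (d : measure_display)
    (X : measurableType d) (mu : probability X R) (T : X -> X)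
    (A B : set X) (m : nat) : R :=
  fine (mu (A `&` iter m T @^-1` B)).

(* Main.v *)
Require Import Defs.
From HB Require Import structures.
From mathcomp Require Import all_boot all_order all_algebra.
From mathcomp Require Import all_classical all_reals all_analysis.
From mathcomp Require Import complex.
From mathcomp Require Import ring lra zify.
Import Order.TTheory GRing.Theory Num.Theory.
Import numFieldNormedType.Exports.
Local Open Scope classical_set_scope.
Local Open Scope ring_scope.

Set Implicit Arguments.
Unset Strict Implicit.
Unset Printing Implicit Defensive.

(* By the spectral form of the von Neumann inequality, correlations along integer times may be
   compared through the exponential sums of the corresponding measures on the integers, so it is
   enough to bound, uniformly in [th], the difference of
   [\sum_(n <= N) alpha' n * e (th * floor (alpha n))] and [\sum_(m <= alpha N) e (th * m)] by
   [o (alpha N)].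

   The weights [alpha' n] may be replaced by the increments of [alpha], and then
   [\sum_n (alpha (n+1) - alpha n) e (ka * alpha n)] is a Riemann-Stieltjes sum for the integral of
   [e (ka * t)] over [[0, alpha N]]: the two agree up to [o (alpha N)] for bounded [ka * alpha N] by
   telescoping, while for [ka] bounded and [ka * alpha N] large both are [o (alpha N)].  If [alpha']
   tends to [0] the latter also follows by telescoping.  Otherwise it needs [\sum_(n <= N) e (ka * alpha n)]
   to be [o (N)] uniformly for [B / alpha N <= ka <= K].  Let [k] be least such that the derivative
   [D (k+1)] of order [k+1] of [alpha] tends to [0].  If [x^(k+1) * D (k+1) x] is unbounded, van der
   Corput differencing on short blocks down to the Kusmin-Landau inequality, applied to the derivative of
   order [k] or [k+1], covers the whole range of [ka].  Otherwise [D k - c] is [O (x^-k)] for some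
   [c > 0]: differencing at order [k] covers small [ka], and on a compact range Weyl differencing treats
   irrational [ka * c], the uniform distribution hypothesis treats rational [ka * c], and differencing
   along residue classes treats neighbourhoods of the latter.

   Finally, the comparison for all [|ka| < Q] passes from [alpha n] to its integer part by
   expanding [e (- th * frac (alpha n))] over the Fejer kernels at the points [r / Q]. *)

(** The hypothesis controls each ka separately and without a rate, whereas [w] must serve all
    systems, hence all frequencies at once, including ka that tend to 0 with N. Derivative tests are
    uniform in ka but see only the size of one derivative. They fail when alpha is close to a
    polynomial with order k derivative c and ka * c is close to a rational: along a residue class
    the k-th differences of ka * alpha are then nearly integers. There the lower order terms of
    alpha decide, and only uniform distribution controls them. Partial summation extends it from ks
    to |ka - ks| = O(N^-k); farther away the drift of the k-th difference is large enough for a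
    derivative test. The Hardy field enters through signs: that of x f' + n f makes f x^n monotone,
    so size conditions hold on whole blocks. The integer part is delicate because e(- th * frac y)
    jumps at integers; the comparison at frequency 0 bounds the mass near them. Lebesgue measure is
    discretised with step 1/Q, so that no integral over the line occurs. *)

(** * Mean value inequalities *)

Section MeanValue.
Context {R : realType}.
Implicit Types f df : R -> R.

Lemma mean_value f df (a b : R) : a <= b ->
  (forall x, a <= x <= b -> is_derive x 1 f (df x)) ->
  exists2 c, a <= c <= b & f b - f a = df c * (b - a).
Proof.
move=> ab H.
have [||c cab ->] := @MVT_segment R f df a b ab.
- by move=> x; rewrite in_itv /= => /andP[x1 x2]; apply: H; rewrite !ltW.
- apply: derivable_within_continuous => x; rewrite in_itv /= => xab.
  by have [] := H x xab.
- by exists c => //; move: cab; rewrite in_itv.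
Qed.

Lemma dist_le_of_derive f df (C a b : R) :
  (forall x : R, is_derive x 1 f (df x)) -> 0 <= C ->
  (forall x, Num.min a b <= x <= Num.max a b -> `|df x| <= C) ->
  `|f b - f a| <= C * `|b - a|.
Proof.
move=> Hd C0 HC.
wlog ab : a b HC / a <= b.
  move=> H; have [ab|/ltW ba] := leP a b; first exact: H.
  rewrite distrC (distrC b); apply: H => // x; rewrite minC maxC; exact: HC.
have [c cab ->] := mean_value ab (fun x _ => Hd x).
rewrite normrM ler_wpM2r //; apply: HC.
by rewrite (min_l ab) (max_r ab).
Qed.
End MeanValue.

(** * Elementary inequalities for sine and cosine *)

Section TrigBounds.
Context {R : realType}.
Implicit Types x y u : R.

Lemma norm_sin_le u : `|sin u| <= `|u|.
Proof.
have := @dist_le_of_derive R sin cos 1 0 u _ ler01.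
rewrite sin0 !subr0 mul1r; apply => x _; exact: cos_max.
Qed.

Lemma norm_cosB1_le u : `|cos u - 1| <= `|u|.
Proof.
have := @dist_le_of_derive R cos (fun x => - sin x) 1 0 u _ ler01.
rewrite cos0 subr0 mul1r; apply => x _; rewrite normrN; exact: sin_max.
Qed.

Lemma norm_between0 u x : Num.min 0 u <= x <= Num.max 0 u -> `|x| <= `|u|.
Proof.
case: (leP 0 u) => u0; rewrite ?(min_l u0) ?(max_r u0) ?(min_r (ltW u0)) ?(max_l (ltW u0)).
  by move=> /andP[x0 xu]; rewrite !ger0_norm.
by move=> /andP[x0 xu]; rewrite !ler0_norm // ?lerN2 // ltW.
Qed.

Lemma norm_cosB1_le_sqr u : `|cos u - 1| <= u ^+ 2.
Proof.
have := @dist_le_of_derive R cos (fun x => - sin x) `|u| 0 u _ (normr_ge0 u).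
rewrite cos0 subr0 -expr2 real_normK ?num_real //; apply => x /norm_between0 xu; rewrite normrN; exact: le_trans (norm_sin_le x) xu.
Qed.

Lemma norm_sinB_le_sqr u : `|sin u - u| <= u ^+ 2.
Proof.
have := @dist_le_of_derive R (fun x => sin x - x) (fun x => cos x - 1) `|u| 0 u _ (normr_ge0 u).
rewrite /= sin0 !subr0 -expr2 real_normK ?num_real //; apply => x.
move=> /norm_between0 xu; exact: le_trans (norm_cosB1_le x) xu.
Qed.

(** By the mean value theorem sin (u / 2) is at least cos (u / 2) times u / 2, so the double angle
    formula leaves u times the square of cos (u / 2), and cos u >= 0 makes this square at least
    1/2. *)
Lemma sin_ge_half u : 0 <= u <= pi / 2 -> u / 2 <= sin u.
Proof.
move=> /andP[u0 upi].
have [|c /andP[c0 cu]] := @mean_value R sin cos 0 (u / 2) _ (fun x _ => is_derive_sin x).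
  by rewrite divr_ge0.
rewrite sin0 !subr0 => E.
have pi0 := pi_gt0 R.
have cosc : cos (u / 2) <= cos c.
  move: cu; rewrite le_eqVlt => /orP[/eqP->//|cu].
  rewrite ltW // ltr_cos // in_itv /=; apply/andP; split; lra.
have cos0' : 0 <= cos (u / 2) by apply: cos_ge0_pihalf; lra.
have half : 1 / 2 <= cos (u / 2) ^+ 2.
  have := cos_mulr2n (u / 2); rewrite -(mulr_natr (u / 2)) divfK // mulr2n.
  have : 0 <= cos u by apply: cos_ge0_pihalf; lra.
  by move=> ? ?; lra.
have -> : sin u = 2 * (cos (u / 2) * sin (u / 2)).
  by rewrite -[in LHS](@divfK _ 2 _ u) // mulr_natr sin_mulr2n mulr_natl.
rewrite E.
have h : cos (u / 2) ^+ 2 <= cos (u / 2) * cos c by rewrite expr2 ler_wpM2l.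
have u20 : 0 <= u / 2 by rewrite divr_ge0.
have := ler_wpM2r u20 (le_trans half h); lra.
Qed.

End TrigBounds.

(** * The modulus of a complex number *)

Section Cabs.
Context {R : realType}.
Implicit Types z w : R[i].

(** The modulus is valued in [R], not in [R[i]], so that all estimates are inequalities in a real
    field. *)
Definition cabs z : R := Normc.normc z.

Lemma cabsM z w : cabs (z * w) = cabs z * cabs w.
Proof. exact: Normc.normcM. Qed.
Lemma cabsD z w : cabs (z + w) <= cabs z + cabs w.
Proof. exact: le_normcD. Qed.
Lemma cabsN z : cabs (- z) = cabs z.
Proof. exact: normcN. Qed.
Lemma cabs0 : cabs 0 = 0.
Proof. exact: Normc.normc0. Qed.
Lemma cabs1 : cabs 1 = 1.
Proof. exact: Normc.normc1. Qed.
Lemma cabs_ge0 z : 0 <= cabs z.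
Proof. by case: z => a b; exact: sqrtr_ge0. Qed.
Lemma cabs_real (x : R) : cabs x%:C%C = `|x|.
Proof. by rewrite /cabs /= expr0n /= addr0 sqrtr_sqr. Qed.
Lemma cabs_sqr z : cabs z ^+ 2 = complex.Re z ^+ 2 + complex.Im z ^+ 2.
Proof. by case: z => a b; rewrite /cabs /= sqr_sqrtr // addr_ge0 ?sqr_ge0. Qed.
Lemma cabs_conj z : cabs (conjc z) = cabs z.
Proof. by case: z => a b; rewrite /cabs /= sqrrN. Qed.
Lemma cabs_sqrC z : (cabs z ^+ 2)%:C%C = z * conjc z.
Proof. by rewrite cabs_sqr; case: z => a b; simpc; congr (_ +i* _)%C; rewrite ?expr2 //; ring. Qed.
Lemma cabs_le z : cabs z <= `|complex.Re z| + `|complex.Im z|.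
Proof.
rewrite -(@ler_pXn2r _ 2) ?nnegrE ?cabs_ge0 ?addr_ge0 // cabs_sqr sqrrD !real_normK ?num_real //.
by rewrite -addrA addrCA lerDr mulrn_wge0 // mulr_ge0.
Qed.
Lemma cabsB z w : cabs (z - w) <= cabs z + cabs w.
Proof. by rewrite -(cabsN w) cabsD. Qed.
Lemma cabs_sum I (r : seq I) (P : pred I) (F : I -> R[i]) :
  cabs (\sum_(i <- r | P i) F i) <= \sum_(i <- r | P i) cabs (F i).
Proof.
elim/big_ind2: _ => [|x1 x2 y1 y2 h1 h2|//]; first by rewrite cabs0.
exact: le_trans (cabsD _ _) (lerD h1 h2).
Qed.
Lemma cabsV z : cabs z^-1 = (cabs z)^-1.
Proof. exact: Normc.normcV. Qed.
Lemma cabs_subDl z w : cabs z <= cabs w + cabs (z - w).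
Proof. by rewrite -{1}(subrK w z) addrC cabsD. Qed.

Lemma sqr_sum_le (I : Type) (r : seq I) (x : I -> R) :
  (\sum_(i <- r) x i) ^+ 2 <= (size r)%:R * \sum_(i <- r) x i ^+ 2.
Proof.
rewrite expr2 mulr_suml.
apply: (@le_trans _ _ (\sum_(i <- r) \sum_(j <- r) (x i ^+ 2 + x j ^+ 2) / 2)).
  apply: ler_sum => i _; rewrite mulr_sumr; apply: ler_sum => j _.
  rewrite ler_pdivlMr //; have := sqr_ge0 (x i - x j); rewrite sqrrB; lra.
have -> : \sum_(i <- r) \sum_(j <- r) (x i ^+ 2 + x j ^+ 2) / 2 =
   \sum_(i <- r) ((size r)%:R * x i ^+ 2 + \sum_(j <- r) x j ^+ 2) / 2.
  apply: eq_bigr => i _; rewrite -mulr_suml big_split /=; congr (( _ + _) / 2).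
  by rewrite big_const_seq count_predT iter_addr_0 mulr_natl.
rewrite -mulr_suml big_split /= -mulr_sumr big_const_seq count_predT iter_addr_0 -mulr_natl.
lra.
Qed.

Lemma cabs_sum_sqr_le (I : Type) (r : seq I) (F : I -> R[i]) :
  cabs (\sum_(i <- r) F i) ^+ 2 <= (size r)%:R * \sum_(i <- r) cabs (F i) ^+ 2.
Proof.
apply: le_trans (sqr_sum_le _ _).
by rewrite ler_pXn2r ?nnegrE ?cabs_ge0 ?sumr_ge0 // ?cabs_sum // => i _; exact: cabs_ge0.
Qed.
End Cabs.

(** * The character e(x) and its distance from 1 *)

Section Cis.
Context {R : realType}.
Implicit Types x y : R.

(** This is e(x) = exp (2 pi i x). *)
Definition cis x : R[i] := (cos (2 * pi * x) +i* sin (2 * pi * x))%C.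

Lemma cisD x y : cis (x + y) = cis x * cis y.
Proof. by rewrite /cis mulrDr cosD sinD; simpc; congr (_ +i* _)%C; ring. Qed.
Lemma cis0 : cis 0 = 1.
Proof. by rewrite /cis mulr0 cos0 sin0. Qed.
Lemma cisN x : cis (- x) = conjc (cis x).
Proof. by rewrite /cis mulrN cosN sinN. Qed.
Lemma cisB x y : cis (x - y) = cis x * conjc (cis y).
Proof. by rewrite cisD cisN. Qed.
Lemma cabs_cis x : cabs (cis x) = 1.
Proof. by rewrite /cabs /cis /= cos2Dsin2 sqrtr1. Qed.
Lemma cis1 : cis 1 = 1.
Proof. by rewrite /cis mulr1 mulr_natl cos2pi sin2pi. Qed.
Lemma cisMn x (n : nat) : cis (n%:R * x) = cis x ^+ n.
Proof.
elim: n => [|n IH]; first by rewrite mul0r cis0.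
by rewrite -natr1 mulrDl mul1r cisD IH exprSr.
Qed.
Lemma cis_nat (n : nat) : cis n%:R = 1.
Proof. by rewrite -(mulr1 n%:R) cisMn cis1 expr1n. Qed.
Lemma cis_int (n : int) : cis n%:~R = 1.
Proof. case: n => n; first by rewrite -pmulrn cis_nat.
by rewrite NegzE mulrNz -pmulrn cisN cis_nat conjc1. Qed.
Lemma cisBint x (n : int) : cis (x - n%:~R) = cis x.
Proof. by rewrite cisB cis_int conjc1 mulr1. Qed.

Lemma pi_lt4 : pi < 4 :> R.
Proof. by have := @pihalf_lt2 R; lra. Qed.

(** Each component costs |2 pi x| <= 8 |x| by the crude bound pi < 4. This 16 and the 128 of
    [cis_taylor] recur below as absolute constants. *)
Lemma cis_subr1_le x : cabs (cis x - 1) <= 16 * `|x|.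
Proof.
apply: le_trans (cabs_le _) _; rewrite /cis /= subr0.
have h1 := norm_cosB1_le (2 * pi * x); have h2 := norm_sin_le (2 * pi * x).
have : `|2 * pi * x| <= 8 * `|x|.
  by rewrite normrM ger0_norm ?mulr_ge0 ?pi_ge0 // ler_wpM2r //; have := pi_lt4; lra.
by lra.
Qed.

Lemma cis_lip x y : cabs (cis x - cis y) <= 16 * `|x - y|.
Proof.
have -> : cis x - cis y = (cis (x - y) - 1) * cis y.
  by rewrite mulrBl mul1r -cisD subrK.
by rewrite cabsM cabs_cis mulr1 cis_subr1_le.
Qed.

Lemma cis_taylor x : cabs (cis x - 1 - (0 +i* (2 * pi * x))%C) <= 128 * x ^+ 2.
Proof.
apply: le_trans (cabs_le _) _; rewrite /cis /= !subr0.
have h1 := norm_cosB1_le_sqr (2 * pi * x); have h2 := norm_sinB_le_sqr (2 * pi * x).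
have : (2 * pi * x) ^+ 2 <= 64 * x ^+ 2.
  rewrite exprMn ler_wpM2r ?sqr_ge0 //; have := pi_lt4; have := pi_ge0 R => *; nra.
by lra.
Qed.

Lemma cabs_cis_subr1 x : cabs (cis x - 1) = 2 * `|sin (pi * x)|.
Proof.
apply/eqP; rewrite -(@eqrXn2 _ 2) ?cabs_ge0 ?mulr_ge0 //; apply/eqP.
rewrite cabs_sqr exprMn real_normK ?num_real // /cis /= subr0.
have -> : 2 * pi * x = (pi * x) *+ 2 by rewrite mulr2n; ring.
rewrite cos_mulr2n sin_mulr2n.
set c := cos _; set s := sin _.
have E : c ^+ 2 = 1 - s ^+ 2 by rewrite /c /s cos2sin2.
rewrite !mulr2n (_ : _ + _ = (2 * c ^+ 2 - 2) ^+ 2 + 4 * c ^+ 2 * s ^+ 2); last by ring.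
by rewrite E; ring.
Qed.

Lemma cis_subr1_ge x : `|x| <= 1 / 2 -> 2 * `|x| <= cabs (cis x - 1).
Proof.
rewrite cabs_cis_subr1 => hx; rewrite ler_pM2l //.
wlog x0 : x hx / 0 <= x.
  move=> H; have [|/ltW x0] := leP 0 x; first exact: H.
  by have := H (- x); rewrite normrN oppr_ge0 mulrN sinN normrN => ->.
move: hx; rewrite !(ger0_norm x0) => hx.
have pi2 := pi_ge2 R.
have h : 0 <= pi * x <= pi / 2.
  by rewrite mulr_ge0 ?(le_trans _ pi2) //= ler_pM2l ?(lt_le_trans _ pi2) // -[leRHS]div1r.
have := sin_ge_half h; have := ler_norm (sin (pi * x)) => *.
have : 2 * x <= pi * x by rewrite ler_wpM2r.
lra.
Qed.

(** The hypotheses place [x] at distance at least [d] from every integer. When |x| > 1/2 the nearest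
    one is 1 or -1, and translation by it reduces to [cis_subr1_ge]. *)
Lemma cis_subr1_ge' (d x : R) : 0 <= d -> d <= `|x| -> `|x| <= 1 - d -> 2 * d <= cabs (cis x - 1).
Proof.
move=> d0 dx xd; have [h|h] := leP `|x| (1 / 2).
  by apply: le_trans (cis_subr1_ge h); rewrite ler_pM2l.
wlog x0 : x dx xd h / 0 <= x.
  move=> H; have [|/ltW x0] := leP 0 x; first exact: H.
  have := H (- x); rewrite normrN oppr_ge0 => H'.
  have -> : cis x - 1 = cis x * - (cis (- x) - 1).
    by rewrite mulrN mulrBr mulr1 -cisD subrr cis0 opprB.
  by rewrite cabsM cabs_cis mul1r cabsN; apply: H'.
move: dx xd h; rewrite (ger0_norm x0) => dx xd h.
have -> : cis x = cis (x - 1) by rewrite cisB cis1 conjc1 mulr1.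
have E : `|x - 1| = 1 - x by rewrite ler0_norm ?opprB //; lra.
by apply: le_trans (cis_subr1_ge _); rewrite E; lra.
Qed.

Lemma cis_geo x n : (cis x - 1) * (\sum_(0 <= j < n) cis (j%:R * x)) = cis (n%:R * x) - 1.
Proof.
elim: n => [|n IH]; first by rewrite big_geq // mulr0 mul0r cis0 subrr.
have -> : n.+1%:R * x = n%:R * x + x by rewrite -natr1 mulrDl mul1r.
rewrite big_nat_recr //= mulrDr IH cisD; ring.
Qed.
End Cis.

(** * Van der Corput differencing *)

Ltac positivity := repeat first [ done | assumption | apply: ltW; assumption
  | apply: mulr_gt0 | apply: mulr_ge0 | apply: exprn_gt0 | apply: exprn_ge0
  | rewrite invr_gt0 | rewrite invr_ge0 | apply: sqrtr_ge0 | apply: cabs_ge0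
  | apply: normr_ge0 | apply: ler0n | apply: addr_gt0 | apply: addr_ge0 | apply: ltW ].

Section VanDerCorput.
Context {R : realType}.
Implicit Types (f : nat -> R) (L H D k n : nat).

Definition expsum f L : R[i] := \sum_(0 <= n < L) cis (f n).

Lemma cabs_expsum_le f L : cabs (expsum f L) <= L%:R.
Proof.
apply: le_trans (cabs_sum _ _ _) _.
under eq_bigr do rewrite cabs_cis.
by rewrite big_const_nat iter_addr_0 subn0.
Qed.

Lemma cabs_sum_cis_le f a b :
  cabs (\sum_(a <= n < b) cis (f n)) <= (b - a)%:R.
Proof.
apply: le_trans (cabs_sum _ _ _) _.
under eq_bigr do rewrite cabs_cis.
by rewrite big_const_nat iter_addr_0.
Qed.

Lemma cabs_expsumN f L : cabs (expsum (fun n => - f n) L) = cabs (expsum f L).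
Proof.
rewrite -cabs_conj /expsum rmorph_sum; congr cabs.
by apply: eq_bigr => n _; rewrite cisN; exact: conjcK.
Qed.

Lemma sum_sqr_expand (L H : nat) (F : nat -> nat -> R[i]) :
  \sum_(0 <= n < L) cabs (\sum_(0 <= h < H) F n h) ^+ 2 <=
  \sum_(0 <= h < H) \sum_(0 <= h' < H)
     cabs (\sum_(0 <= n < L) F n h * conjc (F n h')).
Proof.
set lhs := (X in X <= _).
have lhs0 : 0 <= lhs by apply: sumr_ge0 => n _; exact: sqr_ge0.
rewrite -(ger0_norm lhs0) -cabs_real.
have -> : lhs%:C%C = \sum_(0 <= h < H) \sum_(0 <= h' < H)
    \sum_(0 <= n < L) F n h * conjc (F n h').
  rewrite /lhs raddf_sum /=.
  transitivity (\sum_(0 <= n < L) \sum_(0 <= h < H) \sum_(0 <= h' < H) F n h * conjc (F n h')).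
    apply: eq_bigr => n _; rewrite cabs_sqrC rmorph_sum /= mulr_suml.
    by apply: eq_bigr => h _; rewrite mulr_sumr.
  rewrite exchange_big /=; apply: eq_bigr => h _.
  by rewrite exchange_big.
apply: le_trans (cabs_sum _ _ _) _; apply: ler_sum => h _.
exact: cabs_sum.
Qed.

Lemma count_near (H D h : nat) :
  (\sum_(0 <= h' < H) ((h < h' + D) && (h' < h + D))%N <= 2 * D)%N.
Proof.
have -> : (\sum_(0 <= h' < H) ((h < h' + D) && (h' < h + D))%N =
  count (fun h' => (h < h' + D) && (h' < h + D))%N (iota 0 H))%N.
  by rewrite -sum1_count [RHS]big_mkcond /= /index_iota subn0; apply: eq_bigr => i _; case: ifP.
rewrite -size_filter.
have -> : (2 * D)%N = size (iota (h - D) (2 * D)) by rewrite size_iota.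
apply: uniq_leq_size; first by rewrite filter_uniq // iota_uniq.
by move=> x; rewrite mem_filter !mem_iota; lia.
Qed.

(** The sum is averaged over [H] translates, and Cauchy-Schwarz reduces it to correlations of pairs
    of translates. At most 2 D shifts h' lie within [D] of a given h; they get the trivial bound and
    cause the term 2 D / H. Discarding this band lets the hypothesis be asked only for shifts that
    are far apart. *)
Lemma van_der_corput f L H D (eps : R) : (0 < H <= L)%N -> 0 <= eps ->
  (forall h h' : nat, (h' < h < H)%N -> (D <= h - h')%N ->
     cabs (expsum (fun n => f (n + h)%N - f (n + h')%N) (L - H)) <= eps * L%:R) ->
  (0 < D)%N ->
  cabs (expsum f L) <= H%:R + L%:R * Num.sqrt ((2 * D)%:R / H%:R + eps).
Proof.
move=> /andP[H0 HL] e0 Hyp D0.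
set S := expsum f L.
set X := \sum_(0 <= n < L - H) \sum_(0 <= h < H) cis (f (n + h)%N).
have HR : (0 : R) < H%:R by rewrite ltr0n.
(* Translation by h loses the first h terms, and the truncation to [L - H] loses the last [H - h]:
   [H] terms for each shift. *)
have close : cabs (H%:R * S - X) <= H%:R * H%:R.
  rewrite /X exchange_big /= .
  have -> : H%:R * S = \sum_(0 <= h < H) S.
    by rewrite big_const_nat iter_addr_0 subn0 mulr_natl.
  rewrite -sumrB.
  apply: le_trans (cabs_sum _ _ _) _.
  apply: (@le_trans _ _ (\sum_(0 <= h < H) H%:R)); last first.
    by rewrite big_const_nat iter_addr_0 subn0 mulr_natl.
  rewrite !big_nat; apply: ler_sum => h /andP[_ hH].
  rewrite /S /expsum (@big_cat_nat _ _ _ h) //=; last by lia.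
  rewrite (@big_cat_nat _ _ _ (L - H + h) h) /=; [|by lia|by lia].
  rewrite -{2}(add0n h) big_addn addnK.
  have -> (a b c : R[i]) : a + (b + c) - b = a + c by ring.
  apply: le_trans (cabsD _ _) _.
  apply: le_trans (lerD (cabs_sum_cis_le _ _ _) (cabs_sum_cis_le _ _ _)) _.
  by rewrite -natrD ler_nat; lia.
have Xle : cabs X ^+ 2 <= L%:R * (H%:R ^+ 2 * L%:R * ((2 * D)%:R / H%:R + eps)).
  apply: le_trans (cabs_sum_sqr_le _ _) _.
  have -> : size (index_iota 0 (L - H)) = (L - H)%N by rewrite size_iota subn0.
  apply: (@le_trans _ _ (L%:R * \sum_(0 <= n < L - H) cabs (\sum_(0 <= h < H) cis (f (n + h)%N)) ^+ 2)).
    rewrite ler_wpM2r ?ler_nat ?leq_subr //.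
    by apply: sumr_ge0 => n _; exact: sqr_ge0.
  rewrite ler_wpM2l //; apply: le_trans (sum_sqr_expand _ _ _) _.
  apply: (@le_trans _ _ (\sum_(0 <= h < H) (L%:R * ((2 * D)%:R + H%:R * eps)))); last first.
    rewrite big_const_nat iter_addr_0 subn0 -mulr_natl.
    rewrite le_eqVlt; apply/orP; left; apply/eqP; field; by rewrite gt_eqF.
  rewrite !big_nat; apply: ler_sum => h /andP[_ hH].
  apply: (@le_trans _ _ (\sum_(0 <= h' < H) (L%:R * (((h < h' + D) && (h' < h + D))%N)%:R + L%:R * eps))).
    rewrite !big_nat; apply: ler_sum => h' /andP[_ hH'].
    have -> : \sum_(0 <= n < L - H) cis (f (n + h)%N) * conjc (cis (f (n + h')%N)) =
       expsum (fun n => f (n + h)%N - f (n + h')%N) (L - H).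
      by apply: eq_bigr => n _; rewrite cisB.
    have Le0 : 0 <= L%:R * eps by rewrite mulr_ge0.
    have [_|] := boolP ((h < h' + D)%N && (h' < h + D)%N).
      rewrite mulr1; apply: le_trans (cabs_expsum_le _ _) _.
      by apply: (@le_trans _ _ L%:R); [rewrite ler_nat leq_subr | rewrite lerDl].
    rewrite negb_and -!leqNgt mulr0 add0r mulrC => /orP[far|far].
      by apply: Hyp; lia.
    rewrite -cabs_expsumN.
    have -> : expsum (fun n => - (f (n + h)%N - f (n + h')%N)) (L - H) =
              expsum (fun n => f (n + h')%N - f (n + h)%N) (L - H).
      by apply: eq_bigr => n _; rewrite opprB.
    by apply: Hyp; lia.
  rewrite big_split /= -mulr_sumr big_const_nat iter_addr_0 subn0 -[X in _ + X]mulr_natl.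
  rewrite [X in _ + X]mulrCA -mulrDr ler_wpM2l // lerD2r -natr_sum ler_nat.
  exact: count_near.
set q := _ + eps in Xle *.
have q0 : 0 <= q by rewrite addr_ge0 // divr_ge0.
have Xle' : cabs X <= H%:R * L%:R * Num.sqrt q.
  rewrite -(@ler_pXn2r _ 2) ?nnegrE ?cabs_ge0 ?mulr_ge0 ?sqrtr_ge0 //.
  by apply: le_trans Xle _; rewrite !exprMn sqr_sqrtr //; lra.
rewrite -(ler_pM2l HR).
have -> : H%:R * cabs S = cabs (H%:R * S).
  rewrite cabsM; congr (_ * _).
  by rewrite -(@ger0_norm _ H%:R) ?ler0n // -cabs_real rmorph_nat.
apply: le_trans (cabs_subDl _ X) _; rewrite mulrDr addrC lerD //.
by rewrite mulrA.
Qed.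

(** * Finite differences and derivative tests *)

Fixpoint dif k f n : R := if k is k'.+1 then dif k' f n.+1 - dif k' f n else f n.

Lemma dif_shift k f h n : dif k (fun m => f (m + h)%N) n = dif k f (n + h)%N.
Proof. by elim: k n => [//|k IH] n /=; rewrite !IH addSn. Qed.

Lemma dif_sub k f g n : dif k (fun m => f m - g m) n = dif k f n - dif k g n.
Proof. by elim: k n => [//|k IH] n /=; rewrite !IH; ring. Qed.

Lemma dif_scale k (c : R) f n : dif k (fun m => c * f m) n = c * dif k f n.
Proof. by elim: k n => [//|k IH] n /=; rewrite !IH; ring. Qed.

Lemma dif_opp k f n : dif k (fun m => - f m) n = - dif k f n.
Proof. by elim: k n => [//|k IH] n /=; rewrite !IH; ring. Qed.

(** Differencing with shifts h' and h trades one order for a factor h - h' in size, and sums of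
    monotone sequences stay monotone; the inductions on the order rest on this. *)
Lemma dif_shift_sub k f h h' n : (h' <= h)%N ->
  dif k (fun m => f (m + h)%N - f (m + h')%N) n = \sum_(h' <= i < h) dif k.+1 f (n + i)%N.
Proof.
move=> hh; rewrite dif_sub !dif_shift /=.
rewrite -(@telescope_sumr _ h' h (fun i => dif k f (n + i)%N)) //.
by apply: eq_bigr => i _; rewrite addnS.
Qed.

Definition mono_upto (g : nat -> R) L :=
  (forall m n, (m <= n < L)%N -> g m <= g n) \/ (forall m n, (m <= n < L)%N -> g n <= g m).

Lemma mono_uptoN (g : nat -> R) L : mono_upto g L -> mono_upto (fun n => - g n) L.
Proof. by case=> H; [right|left] => m n mn; rewrite lerN2 H. Qed.

Lemma mono_upto_shift_sub k f h h' L H : (h' <= h <= H)%N -> (H <= L)%N ->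
  mono_upto (dif k.+1 f) L ->
  mono_upto (dif k (fun m => f (m + h)%N - f (m + h')%N)) (L - H).
Proof.
move=> /andP[h1 h2] HL [] mf; [left|right] => m n mn; rewrite !dif_shift_sub // !big_nat;
  by apply: ler_sum => i /andP[i1 i2]; apply: mf; lia.
Qed.

Lemma sum_by_parts (a b : nat -> R[i]) L :
  \sum_(0 <= n < L.+1) a n * (b n.+1 - b n) =
  a L * b L.+1 - a 0%N * b 0%N - \sum_(0 <= n < L) (a n.+1 - a n) * b n.+1.
Proof.
elim: L => [|L IH]; first by rewrite big_nat1 big_geq // subr0 mulrBr.
by rewrite big_nat_recr //= IH [in RHS]big_nat_recr //=; ring.
Qed.

Lemma sum_norm_mono (g : nat -> R) L : mono_upto g L.+1 ->
  \sum_(0 <= n < L) `|g n.+1 - g n| = `|g L - g 0%N|.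
Proof.
case=> mg.
- transitivity (\sum_(0 <= n < L) (g n.+1 - g n)).
    rewrite !big_nat; apply: eq_bigr => i /andP[_ iL]; rewrite ger0_norm // subr_ge0 mg //; lia.
  by rewrite telescope_sumr // ger0_norm // subr_ge0 mg //; lia.
- transitivity (\sum_(0 <= n < L) ((- g n.+1) - (- g n))).
    rewrite !big_nat; apply: eq_bigr => i /andP[_ iL].
    have gle : g i.+1 <= g i by apply: mg; lia.
    by rewrite ler0_norm ?subr_le0 // opprB opprK addrC.
  rewrite (@telescope_sumr _ 0 L (fun n => - g n)) // ler0_norm ?subr_le0 ?mg //; last by lia.
  by rewrite opprB opprK addrC.
Qed.

(* Kusmin--Landau: 1 / (e(theta) - 1) has bounded variation along monotone increments theta. *)
Lemma kusmin_landau f L (lam : R) : 0 < lam -> mono_upto (dif 1 f) L ->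
  (forall n, (n < L)%N -> lam <= dif 1 f n <= 1 / 2) ->
  cabs (expsum f L) <= 5 / lam.
Proof.
move=> lam0; case: L => [|L] mf hf.
  by rewrite /expsum big_geq // cabs0 divr_ge0 // ltW.
pose th n := dif 1 f n.
have th0 n : (n < L.+1)%N -> 0 < th n.
  by move=> /hf /andP[h _]; exact: lt_le_trans lam0 h.
pose z n := (cis (th n) - 1)^-1.
have lowz n : (n < L.+1)%N -> 2 * th n <= cabs (cis (th n) - 1).
  move=> nL; rewrite -{1}(ger0_norm (ltW (th0 n nL))); apply: cis_subr1_ge.
  by rewrite ger0_norm ?(ltW (th0 n nL)) //; case/andP: (hf n nL).
have nz n : (n < L.+1)%N -> cis (th n) - 1 != 0.
  move=> nL; apply/eqP => E; have := lowz n nL; rewrite E cabs0; have := th0 n nL; lra.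
have -> : expsum f L.+1 = \sum_(0 <= n < L.+1) z n * (cis (f n.+1) - cis (f n)).
  rewrite /expsum !big_nat; apply: eq_bigr => n /andP[_ nL].
  have -> : cis (f n.+1) - cis (f n) = (cis (th n) - 1) * cis (f n).
    by rewrite mulrBl mul1r -cisD /th /= subrK.
  by rewrite mulrA mulVf ?mul1r // nz.
rewrite (sum_by_parts z (fun n => cis (f n))).
have zb n : (n < L.+1)%N -> cabs (z n) <= (1 / 2) / lam.
  move=> nL; rewrite /z cabsV div1r -invfM lef_pV2 ?posrE.
  - apply: le_trans (lowz n nL); rewrite ler_pM2l //; by case/andP: (hf n nL).
  - by apply: lt_le_trans (lowz n nL); rewrite mulr_gt0 ?th0.
  - by rewrite mulr_gt0.
(* Neighbouring values of [z] differ by at most 16 |th' - th| / (4 th th'), which is 4 |1 / th' - 1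
   / th|, and the reciprocals of a monotone sequence telescope. With two boundary terms of at most 1
   / (2 lam) each, the total is 5 / lam. *)
have tv : cabs (\sum_(0 <= n < L) (z n.+1 - z n) * cis (f n.+1)) <= 4 / lam.
  apply: le_trans (cabs_sum _ _ _) _.
  apply: (@le_trans _ _ (4 * \sum_(0 <= n < L) `|(th n.+1)^-1 - (th n)^-1|)).
    rewrite mulr_sumr !big_nat; apply: ler_sum => n /andP[_ nL].
    have n1 : (n < L.+1)%N by lia.
    have n2 : (n.+1 < L.+1)%N by lia.
    rewrite cabsM cabs_cis mulr1.
    have -> : z n.+1 - z n = (cis (th n) - cis (th n.+1)) * (z n.+1 * z n).
      by rewrite /z; field; rewrite !nz.
    rewrite !cabsM.
    have -> : (th n.+1)^-1 - (th n)^-1 = (th n - th n.+1) / (th n.+1 * th n).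
      by field; rewrite !gt_eqF ?th0.
    rewrite normrM normfV (gtr0_norm (mulr_gt0 (th0 _ n2) (th0 _ n1))).
    have h1 := cis_lip (th n) (th n.+1).
    have h2 : cabs (z n.+1) * cabs (z n) <= (2 * th n.+1)^-1 * (2 * th n)^-1.
      apply: ler_pM; rewrite ?cabs_ge0 // cabsV lef_pV2 ?posrE ?lowz ?mulr_gt0 ?th0 //.
        by apply: lt_le_trans (lowz _ n2); rewrite mulr_gt0 ?th0.
      by apply: lt_le_trans (lowz _ n1); rewrite mulr_gt0 ?th0.
    apply: le_trans (ler_pM (cabs_ge0 _) _ h1 h2) _; first by rewrite mulr_ge0 ?cabs_ge0.
    rewrite -invfM le_eqVlt; apply/orP; left; apply/eqP; field.
    by rewrite !gt_eqF ?th0.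
  rewrite ler_pM2l // (@sum_norm_mono (fun n => (th n)^-1)).
    have := th0 0%N isT; have := th0 L (ltnSn L).
    have /andP[a0 _] := hf 0%N isT; have /andP[aL _] := hf L (ltnSn L) => p q.
    have i0 : (th 0%N)^-1 <= lam^-1 by rewrite lef_pV2.
    have iL : (th L)^-1 <= lam^-1 by rewrite lef_pV2.
    have j0 : 0 <= (th 0%N)^-1 by rewrite invr_ge0 ltW.
    have jL : 0 <= (th L)^-1 by rewrite invr_ge0 ltW.
    by rewrite ler_norml; apply/andP; split; lra.
  by case: mf => mf; [right|left] => m n mn; rewrite lef_pV2 ?posrE ?th0 ?mf //; lia.
apply: le_trans (cabsB _ _) _; apply: le_trans (lerD (cabsB _ _) tv) _.
rewrite !cabsM !cabs_cis !mulr1.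
have := zb 0%N isT; have := zb L (ltnSn L); lra.
Qed.

(** A qualitative van der Corput test of order [k], uniform in the sequence: [del] depends only on
    [eps] and [C]. The order k differences must be small, yet not so small that lam * L ^ k fails to
    be large. *)
Definition derivative_test k := forall eps C : R, 0 < eps -> 1 <= C ->
  exists2 del : R, 0 < del & forall f L (lam : R),
    0 < lam -> lam <= del -> del^-1 <= lam * L%:R ^+ k ->
    mono_upto (dif k f) L -> (forall n, (n < L)%N -> lam <= dif k f n <= C * lam) ->
    cabs (expsum f L) <= eps * L%:R.

Lemma derivative_test1 : derivative_test 1.
Proof.
move=> eps C e0 C1; have C0 : 0 < C by exact: lt_le_trans C1.
exists (Num.min (1 / (2 * C)) (eps / 5)).
  by rewrite lt_min !divr_gt0 ?mulr_gt0.
set del := Num.min _ _ => f L lam lam0 lamd; rewrite expr1 => lamL mf hf.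
have d1 : del <= 1 / (2 * C) by rewrite ge_min lexx.
have d2 : del <= eps / 5 by rewrite ge_min lexx orbT.
have d0 : 0 < del by rewrite lt_min !divr_gt0 ?mulr_gt0.
apply: (@le_trans _ _ (5 / lam)).
  apply: kusmin_landau => // n nL; have /andP[-> h] /= := hf n nL.
  apply: (le_trans h); apply: (@le_trans _ _ (C * (1 / (2 * C)))).
    by rewrite ler_pM2l // (le_trans lamd).
  by rewrite le_eqVlt; apply/orP; left; apply/eqP; field; rewrite gt_eqF.
rewrite ler_pdivrMr // -mulrA.
have : (eps / 5)^-1 <= lam * L%:R.
  by apply: le_trans lamL; rewrite lef_pV2 // posrE divr_gt0.
rewrite invf_div => h.
have -> : 5 = eps * (5 / eps) by field; rewrite gt_eqF.
by rewrite ler_pM2l // [leRHS]mulrC.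
Qed.

Lemma truncn_ge_half (x : R) : 1 <= x -> x / 2 <= (Num.truncn x)%:R.
Proof.
move=> x1; have x0 : 0 <= x by apply: le_trans x1.
have := truncnS_gt x; rewrite -natr1.
have : (1 : R) <= (Num.truncn x)%:R by rewrite ler1n truncn_gt0.
lra.
Qed.

(** The differenced sequences have order k differences of size (h - h') * lam. The choice of [H]
    keeps this below the threshold [d'] of order [k], and the excluded band of width [D] keeps h -
    h' comparable with [H]. *)
Lemma derivative_testS k : (0 < k)%N -> derivative_test k -> derivative_test k.+1.
Proof.
move=> k0 IH eps C eps0 C1.
pose e := Num.min eps 1.
have e0 : 0 < e by rewrite lt_min eps0 ltr01.
have e1 : e <= 1 by rewrite ge_min lexx orbT.
have ee : e <= eps by rewrite ge_min lexx.
have e20 : 0 < e ^+ 2 by rewrite exprn_gt0.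
have e21 : e ^+ 2 <= 1 by rewrite exprn_ile1 // ltW.
have [|d' d'0 Hd'] := IH (e ^+ 2 / 12) C _ C1; first by rewrite divr_gt0.
pose eta := e ^+ 2 / 24.
have eta0 : 0 < eta by rewrite divr_gt0.
(* [Z] will bound the length from below. Its first term serves [big], its second makes [M] at least
   48 / e ^ 2 when [M] is a fraction of the length, and the last gives L >= 2. *)
pose Z := 4 / (eta * d' ^+ 2) + 96 / (e * e ^+ 2) + 2.
have Z1 : 0 < 4 / (eta * d' ^+ 2) by rewrite divr_gt0 // mulr_gt0 // exprn_gt0.
have Z2 : 0 < 96 / (e * e ^+ 2) by rewrite divr_gt0 // mulr_gt0 // exprn_gt0.
have Z0 : 0 < Z by rewrite /Z; lra.
pose del := Num.min (Num.min 1 (Z ^+ k.+1)^-1) (Num.min (eta * e * d' / 2 ^+ k.+2) (d' * e ^+ 2 / 48)).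
have del0 : 0 < del.
  by rewrite /del !lt_min ltr01 invr_gt0 exprn_gt0 //= !divr_gt0 // ?mulr_gt0 // ?exprn_gt0.
have dA : del <= 1 by rewrite !ge_min lexx.
have dB : del <= (Z ^+ k.+1)^-1 by rewrite !ge_min lexx !orbT.
have dC : del <= eta * e * d' / 2 ^+ k.+2 by rewrite !ge_min lexx !orbT.
have dD : del <= d' * e ^+ 2 / 48 by rewrite !ge_min lexx !orbT.
exists del => // f L lam lam0 lamd lamL mf hf.
(* Since lam <= 1, a large lam * L ^ (k + 1) forces a large length. *)
have LZ : Z <= L%:R.
  rewrite leNgt; apply/negP => LZ.
  have : (L%:R : R) ^+ k.+1 < Z ^+ k.+1 by rewrite ltr_pXn2r ?nnegrE ?ler0n ?(ltW Z0).
  have : Z ^+ k.+1 <= del^-1 by rewrite -[leLHS]invrK lef_pV2 ?posrE ?invr_gt0 ?exprn_gt0.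
  have : lam * L%:R ^+ k.+1 <= L%:R ^+ k.+1 by rewrite ler_piMl ?exprn_ge0 // (le_trans lamd).
  lra.
have L2 : 2 <= L%:R :> R by rewrite /Z in LZ; lra.
have L0 : 0 < L%:R :> R by lra.
pose M := Num.min (d' / lam) (e / 2 * L%:R).
have MH : 48 / e ^+ 2 <= M.
  rewrite le_min; apply/andP; split.
    rewrite ler_pdivlMr // mulrC mulrA ler_pdivrMr //.
    by have := le_trans lamd dD; lra.
  have : 96 / (e * e ^+ 2) <= L%:R by rewrite /Z in LZ; lra.
  rewrite !ler_pdivrMr ?mulr_gt0 //; lra.
have M1 : 1 <= M.
  by apply: le_trans MH; rewrite ler_pdivlMr //; lra.
pose H := Num.truncn M.
have Mge0 : 0 <= M by lra.
have HM : H%:R <= M by rewrite truncn_le.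
have MH2 : M / 2 <= H%:R by exact: truncn_ge_half.
have H0 : (0 < H)%N by rewrite truncn_gt0.
have HR0 : 0 < H%:R :> R by rewrite ltr0n.
have HL2 : H%:R <= e / 2 * L%:R by apply: (le_trans HM); rewrite ge_min lexx orbT.
have Hlam : H%:R * lam <= d'.
  by rewrite -ler_pdivlMr //; apply: (le_trans HM); rewrite ge_min lexx.
have HLh : H%:R <= L%:R / 2 :> R.
  apply: (le_trans HL2); rewrite mulrAC ler_pM2r // ler_piMl // ltW //.
have HL : (H <= L)%N by rewrite -(ler_nat R); lra.
have LH : L%:R / 2 <= (L - H)%:R :> R by rewrite natrB //; lra.
pose D := (Num.truncn (eta * H%:R)).+1.
have DH : eta * H%:R <= D%:R by apply/ltW/truncnS_gt.
have DH' : D%:R <= eta * H%:R + 1.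
  by rewrite /D -natr1 lerD2r truncn_le // mulr_ge0 // ltW.
have pw : (L%:R / 2) ^+ k <= (L - H)%:R ^+ k :> R.
  by rewrite lerXn2r // nnegrE; lra.
(* If [M] is d' / lam, then eta * H * lam is at least a constant and the length does the work; if
   [M] is e L / 2, the product is at least a constant multiple of lam * L ^ (k + 1). *)
have big : d'^-1 <= eta * H%:R * lam * (L - H)%:R ^+ k.
  apply: (@le_trans _ _ (eta * (M / 2) * lam * (L%:R / 2) ^+ k)); last first.
    apply: ler_pM; [ | | | exact: pw].
    + by apply: mulr_ge0 (ltW lam0); apply: mulr_ge0 (ltW eta0) _; rewrite divr_ge0.
    + by rewrite exprn_ge0 // divr_ge0.
    + by rewrite (ler_pM2r lam0) (ler_pM2l eta0).
  rewrite /M; case: (leP (d' / lam) (e / 2 * L%:R)) => hM.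
    have -> : eta * (d' / lam / 2) * lam = eta * d' / 2 by field; rewrite gt_eqF.
    have : L%:R / 2 <= (L%:R / 2) ^+ k :> R.
      by rewrite -(prednK k0) exprS ler_peMr ?divr_ge0 ?exprn_ege1 // ler_pdivlMr // mul1r.
    have : d'^-1 <= eta * d' / 2 * (L%:R / 2).
      rewrite -[leLHS]mul1r ler_pdivrMr //.
      have : 4 / (eta * d' ^+ 2) <= L%:R by rewrite /Z in LZ; lra.
      by rewrite ler_pdivrMr ?mulr_gt0 ?exprn_gt0 //; lra.
    move=> h1 h2; apply: (le_trans h1); rewrite ler_pM2l // divr_gt0 // mulr_gt0 //.
  have -> : eta * (e / 2 * L%:R / 2) * lam * (L%:R / 2) ^+ k =
     (eta * e / 2 ^+ k.+2) * (lam * L%:R ^+ k.+1).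
    rewrite expr_div_n !exprS; field; by rewrite expf_neq0.
  apply: (@le_trans _ _ (eta * e / 2 ^+ k.+2 * del^-1)); last first.
    by apply: ler_wpM2l lamL; positivity.
  rewrite ler_pdivlMr // mulrC ler_pdivrMr //.
  by rewrite (mulrAC (eta * e)).
have D0 : (0 < D)%N by [].
clearbody D H M del Z.
have HHL : (0 < H <= L)%N by rewrite H0 HL.
apply: le_trans (@van_der_corput f L H D (e ^+ 2 / 12) HHL _ _ D0) _.
- by rewrite divr_ge0 // ltW.
- move=> h h' /andP[hh hH] Dh.
  have dl : D%:R <= (h - h')%:R :> R by rewrite ler_nat.
  have dh : (h - h')%:R <= H%:R :> R by rewrite ler_nat (leq_trans (leq_subr _ _) (ltnW hH)).
  have d0 : 0 < (h - h')%:R :> R by rewrite ltr0n subn_gt0.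
  have sumC (c : R) : \sum_(h' <= i < h) c = (h - h')%:R * c.
    by rewrite big_const_nat iter_addr_0 mulr_natl.
  apply: (@le_trans _ _ (e ^+ 2 / 12 * (L - H)%:R)); last first.
    by apply: ler_wpM2l; [positivity | rewrite ler_nat leq_subr].
  apply: (Hd' _ _ ((h - h')%:R * lam)).
  + by rewrite mulr_gt0.
  + by apply: le_trans Hlam; rewrite ler_pM2r.
  + apply: (le_trans big); rewrite ler_wpM2r ?exprn_ge0 // ler_pM2r //.
    exact: le_trans DH dl.
  + by apply: mono_upto_shift_sub => //; rewrite (ltnW hh) ltnW.
  + move=> n nL; rewrite dif_shift_sub ?(ltnW hh) //.
    have inL i : (i < h)%N -> (n + i < L)%N by clear -hH nL; lia.
    rewrite mulrCA -!sumC; apply/andP; split; rewrite !big_nat; apply: ler_sum => i /andP[i1 i2].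
      by have /andP[] := hf (n + i)%N (inL i i2).
    by have /andP[] := hf (n + i)%N (inL i i2).
apply: (@le_trans _ _ (e / 2 * L%:R + L%:R * (e / 2))); last first.
  have : e * L%:R <= eps * L%:R by rewrite ler_pM2r.
  lra.
have e20' : 0 <= e / 2 by positivity.
rewrite lerD // ler_pM2l // -[leRHS](ger0_norm e20') -sqrtr_sqr ler_wsqrtr //.
have : (2 * D)%:R / H%:R <= e ^+ 2 / 6.
  rewrite ler_pdivrMr // natrM.
  have : 24 / e ^+ 2 <= H%:R by lra.
  by rewrite ler_pdivrMr // => ?; rewrite /eta in DH'; lra.
rewrite expr_div_n; lra.
Qed.

Lemma derivative_testP k : (0 < k)%N -> derivative_test k.
Proof.
elim: k => // -[_ _|k IH _]; [exact: derivative_test1 | exact: derivative_testS (IH _)].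
Qed.

(** * Weyl differencing for irrational leading coefficients *)

Definition irrational_num (b : R) := forall (q : nat) (p : int), (0 < q)%N -> q%:R * b != p%:~R.

Lemma cis_irrational_neq1 b : irrational_num b -> 0 < cabs (cis b - 1).
Proof.
move=> irr; pose x := b - (Num.floor b)%:~R.
have x0 : 0 < x.
  rewrite lt_def subr_ge0 floor_le_tmp andbT subr_eq0.
  by have := irr 1%N (Num.floor b) isT; rewrite mul1r.
have x1 : x < 1 by rewrite /x; have := floorD1_gt b; rewrite rmorphD /=; lra.
rewrite -(cisBint b (Num.floor b)) -/x.
pose d := Num.min x (1 - x).
have d0 : 0 < d by rewrite lt_min x0 subr_gt0.
have xE : `|x| = x by rewrite gtr0_norm.
apply: lt_le_trans (@cis_subr1_ge' _ d x (ltW d0) _ _); first by rewrite mulr_gt0.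
  by rewrite xE ge_min lexx.
have : d <= 1 - x by rewrite ge_min lexx orbT.
rewrite xE; lra.
Qed.

(** The tolerance [eta] makes Weyl's theorem stable: one bound serves all coefficients near an
    irrational one and all sequences that are only approximately polynomial. *)
Definition weyl_test k := forall (b eps : R), irrational_num b -> 0 < eps ->
  exists (L0 : nat) (eta : R), 0 < eta /\ forall f L, (L0 <= L)%N ->
    (forall n, (n < L)%N -> `|dif k f n - b| <= eta) ->
    cabs (expsum f L) <= eps * L%:R.

(** Multiplication by e(b) - 1, nonzero because [b] is irrational, makes the sum telescope up to 16
    * eta per term. *)
Lemma weyl_test1 : weyl_test 1.
Proof.
move=> b eps irr eps0.
have := cis_irrational_neq1 irr; set c := cabs _ => c0.
exists (Num.truncn (4 / (c * eps))).+1, (c * eps / 32); split; first by positivity.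
move=> f L L0L hf.
have E : (cis b - 1) * expsum f L = \sum_(0 <= n < L) (cis b - cis (dif 1 f n)) * cis (f n)
    + (cis (f L) - cis (f 0%N)).
  rewrite -(@telescope_sumr _ 0 L (fun n => cis (f n))) // -big_split /= mulr_sumr.
  apply: eq_bigr => n _.
  have -> : cis (f n.+1) = cis (dif 1 f n) * cis (f n) by rewrite -cisD /= subrK.
  by rewrite /=; ring.
have H : c * cabs (expsum f L) <= 16 * (c * eps / 32) * L%:R + 2.
  rewrite -cabsM E; apply: le_trans (cabsD _ _) _; apply: lerD; last first.
    by apply: le_trans (cabsB _ _) _; rewrite !cabs_cis.
  apply: le_trans (cabs_sum _ _ _) _.
  apply: (@le_trans _ _ (\sum_(0 <= n < L) 16 * (c * eps / 32))); last first.
    by rewrite big_const_nat iter_addr_0 subn0 mulr_natr.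
  rewrite !big_nat; apply: ler_sum => n /andP[_ nL].
  rewrite cabsM cabs_cis mulr1; apply: le_trans (cis_lip _ _) _.
  by rewrite ler_pM2l // distrC hf.
have LL : 4 / (c * eps) <= L%:R.
  by apply: (le_trans (ltW (truncnS_gt _))); rewrite ler_nat.
rewrite -(ler_pM2l c0); apply: (le_trans H).
have : 4 <= c * eps * L%:R by rewrite mulrC -ler_pdivrMr // mulr_gt0.
lra.
Qed.

Lemma irrational_numM b d : (0 < d)%N -> irrational_num b -> irrational_num (d%:R * b).
Proof. by move=> d0 irr q p q0; rewrite mulrA -natrM; apply: irr; rewrite muln_gt0 q0. Qed.

(** Here [H] depends on [eps] alone, so only finitely many differences d < H of shifts occur. Each d
    * b is irrational, and the thresholds of order [k] can be taken in common. *)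
Lemma weyl_testS k : weyl_test k -> weyl_test k.+1.
Proof.
move=> IH b eps irr eps0.
pose e := Num.min eps 1.
have e0 : 0 < e by rewrite lt_min eps0 ltr01.
have ee : e <= eps by rewrite ge_min lexx.
have e20 : 0 < e ^+ 2 by positivity.
pose H := (Num.truncn (16 / e ^+ 2)).+1.
have HH : 16 / e ^+ 2 <= H%:R by apply/ltW/truncnS_gt.
have H0 : (0 < H)%N by [].
clearbody H.
have HR0 : 0 < H%:R :> R by rewrite ltr0n.
have [L1 [eta [eta0 hW]]] : exists (L0 : nat) (eta : R), 0 < eta /\ forall d, (0 < d < H)%N ->
    forall f L, (L0 <= L)%N ->
    (forall n, (n < L)%N -> `|dif k f n - d%:R * b| <= eta) ->
    cabs (expsum f L) <= e ^+ 2 / 8 * L%:R.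
  elim: (H) => [|M [L0 [eta [eta0 IM]]]]; first by exists 0%N, 1; split => // d; rewrite ltn0 andbF.
  have [M0|M0] := posnP M.
    by exists 0%N, 1; split => // d; rewrite M0; case: d.
  have [||L2 [eta2 [eta20 hM]]] := IH (M%:R * b) (e ^+ 2 / 8); [exact: irrational_numM | by positivity|].
  exists (maxn L0 L2), (Num.min eta eta2); split; first by rewrite lt_min eta0.
  move=> d /andP[d0]; rewrite ltnS leq_eqVlt => dM f L; rewrite geq_max => /andP[l1 l2] hf.
  case/orP: dM => [/eqP dM|dM].
    apply: hM => // n nL; apply: (@le_trans _ _ (Num.min eta eta2)); last by rewrite ge_min lexx orbT.
    by rewrite -dM; apply: hf.
  apply: (IM d) => //; first by rewrite d0.
  by move=> n nL; apply: (le_trans (hf n nL)); rewrite ge_min lexx.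
exists ((Num.truncn (2 * H%:R / e)).+1 + (H + L1))%N, (eta / H%:R); split; first by positivity.
move=> f L LL hf.
have LH : 2 * H%:R / e <= L%:R.
  by apply: (le_trans (ltW (truncnS_gt _))); rewrite ler_nat (leq_trans (leq_addr _ _) LL).
have L1L : (L1 <= L - H)%N by clear -LL; lia.
have HL : (H <= L)%N by clear -LL; lia.
have HHL : (0 < H <= L)%N by rewrite H0.
have e8 : 0 <= e ^+ 2 / 8 by positivity.
apply: le_trans (@van_der_corput f L H 1 (e ^+ 2 / 8) HHL e8 _ isT) _.
  move=> h h' /andP[hh hH] _.
  apply: (@le_trans _ _ (e ^+ 2 / 8 * (L - H)%:R)).
    apply: (hW (h - h')%N) => //; first by clear -hh hH; lia.
    move=> n nL; rewrite dif_shift_sub ?(ltnW hh) //.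
    have inL i : (i < h)%N -> (n + i < L)%N by clear -hH nL; lia.
    have -> : (h - h')%:R * b = \sum_(h' <= i < h) b by rewrite big_const_nat iter_addr_0 mulr_natl.
    rewrite -sumrB; apply: le_trans (ler_norm_sum _ _ _) _.
    apply: (@le_trans _ _ (\sum_(h' <= i < h) eta / H%:R)).
      by rewrite !big_nat; apply: ler_sum => i /andP[_ ih]; apply/hf/inL.
    rewrite big_const_nat iter_addr_0 -[leLHS]mulr_natr mulrAC ler_pdivrMr // ler_pM2l //.
    by rewrite ler_nat (leq_trans (leq_subr _ _) (ltnW hH)).
  by apply: ler_wpM2l => //; rewrite ler_nat leq_subr.
have e20' : 0 <= e / 2 by positivity.
have sq : Num.sqrt ((2 * 1)%:R / H%:R + e ^+ 2 / 8) <= e / 2.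
  rewrite -[leRHS](ger0_norm e20') -sqrtr_sqr ler_wsqrtr //.
  have : 2 / H%:R <= e ^+ 2 / 8.
    rewrite ler_pdivrMr //; move: HH; rewrite ler_pdivrMr // => HH; lra.
  rewrite muln1 expr_div_n; lra.
have L0 : 0 <= L%:R :> R by [].
apply: le_trans (lerD (lexx _) (ler_wpM2l L0 sq)) _.
have : 2 * H%:R <= e * L%:R by rewrite mulrC [leRHS]mulrC -ler_pdivrMr // mulrC.
have := ler_wpM2r L0 ee; lra.
Qed.

Lemma weyl_testP k : (0 < k)%N -> weyl_test k.
Proof.
by elim: k => // -[_ _|k IH _]; [exact: weyl_test1 | apply: weyl_testS; apply: IH].
Qed.
End VanDerCorput.

(** * Hardy fields *)

Section Eventually.
Context {R : realType}.
Implicit Types (P Q : R -> Prop) (f g : R -> R).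

(** Eventual truth with an explicit closed half-line, on which the mean value arguments can
    start. *)
Definition ev P := exists x0 : R, forall x, x0 <= x -> P x.

Lemma evP P : (\forall x \near +oo, P x) <-> ev P.
Proof.
split=> [[M [Mr h]]|[M h]].
  by exists (M + 1) => x hx; apply: h; lra.
by exists M; split; [exact: num_real | move=> x /ltW; exact: h].
Qed.

Lemma evI P Q : ev P -> ev Q -> ev (fun x => P x /\ Q x).
Proof.
move=> [x h] [y h']; exists (Num.max x y) => z; rewrite ge_max => /andP[xz yz].
by split; [exact: h | exact: h'].
Qed.

Lemma evS P Q : (forall x, P x -> Q x) -> ev P -> ev Q.
Proof. by move=> PQ [x h]; exists x => y /h /PQ. Qed.

Lemma ev_from (a : R) P : ev P -> exists2 x0, a <= x0 & forall x, x0 <= x -> P x.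
Proof.
move=> [x h]; exists (Num.max a x); first by rewrite le_max lexx.
by move=> y; rewrite ge_max => /andP[_ /h].
Qed.

Lemma ev_ge (a : R) : ev (fun x => a <= x).
Proof. by exists a. Qed.

Lemma evT P : (forall x, P x) -> ev P.
Proof. by move=> h; exists 0. Qed.

Lemma ev_contra P Q : ev P -> ev Q -> (forall x, P x -> Q x -> False) -> False.
Proof. by move=> p q h; have [x hx] := evI p q; have [a b] := hx x (lexx x); apply: (h x). Qed.

Definition to0 f := forall e : R, 0 < e -> ev (fun x => `|f x| < e).

Lemma nondecreasing_of_derive f df (a : R) :
  (forall x, a <= x -> is_derive x 1 f (df x)) -> (forall x, a <= x -> 0 <= df x) ->
  forall x y, a <= x -> x <= y -> f x <= f y.
Proof.
move=> hd hp x y ax xy.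
have [|c /andP[xc cy] E] := @mean_value R f df x y xy.
  by move=> z /andP[xz _]; apply: hd; exact: le_trans xz.
by rewrite -subr_ge0 E mulr_ge0 ?subr_ge0 // hp // (le_trans ax).
Qed.

Lemma nonincreasing_of_derive f df (a : R) :
  (forall x, a <= x -> is_derive x 1 f (df x)) -> (forall x, a <= x -> df x <= 0) ->
  forall x y, a <= x -> x <= y -> f y <= f x.
Proof.
move=> hd hp x y ax xy.
have [|c /andP[xc cy] E] := @mean_value R f df x y xy.
  by move=> z /andP[xz _]; apply: hd; exact: le_trans xz.
by rewrite -subr_le0 E mulr_le0_ge0 ?subr_ge0 // hp // (le_trans ax).
Qed.

Lemma ev_sign_of_mono f (a : R) :
  (forall x y, a <= x -> x <= y -> f x <= f y) \/ (forall x y, a <= x -> x <= y -> f y <= f x) ->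
  ev (fun x => 0 <= f x) \/ ev (fun x => f x <= 0).
Proof.
case=> mf.
  have [[x ax fx]|h] := pselect (exists2 x, a <= x & 0 <= f x).
    by left; exists x => y xy; apply: le_trans fx _; exact: mf.
  right; exists a => x ax; rewrite leNgt; apply/negP => fx.
  by apply: h; exists x => //; exact: ltW.
have [[x ax fx]|h] := pselect (exists2 x, a <= x & f x <= 0).
  by right; exists x => y xy; apply: le_trans fx; exact: mf.
left; exists a => x ax; rewrite leNgt; apply/negP => fx.
by apply: h; exists x => //; exact: ltW.
Qed.

Lemma is_derive_Xn p (x : R) : is_derive x 1 (fun y : R => y ^+ p.+1) (p.+1%:R * x ^+ p).
Proof.
have := @is_deriveX R R id p.+1 x 1 1 (is_derive_id x 1).
rewrite (_ : id ^+ p.+1 = (fun y : R => y ^+ p.+1)); last by apply/funext => y; rewrite exprfctE.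
by move=> h; apply: is_derive_eq; rewrite /GRing.scale /= mulr1.
Qed.

(** The Euler expressions x f' + n f and x f' - n f carry the signs of the derivatives of f x ^ n
    and f / x ^ n. This lemma and the next turn such signs into polynomial growth bounds. *)
Lemma is_derive_mulXn f df p (x : R) : is_derive x 1 f df -> 
  is_derive x 1 (fun y => f y * y ^+ p.+1) (x ^+ p * (x * df + p.+1%:R * f x)).
Proof.
move=> hf; have hp := is_derive_Xn p x.
apply: is_derive_eq; rewrite /GRing.scale /= exprS; ring.
Qed.

Lemma is_derive_divXn f df p (x : R) : 0 < x -> is_derive x 1 f df -> 
  is_derive x 1 (fun y => f y / y ^+ p.+1) ((x * df - p.+1%:R * f x) / x ^+ p.+2).
Proof.
move=> x0 hf; have hp := is_derive_Xn p x.
have nz : x ^+ p.+1 != 0 by rewrite expf_neq0 // gt_eqF.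
have hV := @is_deriveV R (fun y => y ^+ p.+1) x _ 1 nz hp.
apply: is_derive_eq; rewrite /GRing.scale /= !exprS; field; rewrite expf_neq0 ?gt_eqF //.
Qed.
End Eventually.

(** * Signs, monotonicity and growth in a Hardy field *)

Section HardyField.
Context {R : realType}.
Variables (H : set (R -> R)).
Hypothesis hH : hardy_field H.
Implicit Types (f g a b : R -> R).

Lemma hardy0 : H (fun=> 0).
Proof. 
have := hardyB hH (hardy1 hH) (hardy1 hH).
by rewrite (_ : (fun x => 1 - 1) = fun=> 0) //; apply/funext => x; rewrite subrr.
Qed.
Lemma hardyN f : H f -> H (fun x => - f x).
Proof.
move=> hf; have := hardyB hH hardy0 hf.
by rewrite (_ : (fun x => 0 - f x) = fun x => - f x) //; apply/funext => x; rewrite sub0r.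
Qed.
Lemma hardyD f g : H f -> H g -> H (fun x => f x + g x).
Proof.
move=> hf /hardyN hg; have := hardyB hH hf hg.
by rewrite (_ : (fun x => f x - - g x) = fun x => f x + g x) //; apply/funext => x; rewrite opprK.
Qed.
Lemma hardy_nat n : H (fun=> n%:R).
Proof.
elim: n => [|n IH]; first exact: hardy0.
have := hardyD IH (hardy1 hH).
by rewrite (_ : (fun x => n%:R + 1) = fun=> n.+1%:R) //; apply/funext => x; rewrite natr1.
Qed.

Lemma hardy_is_derive f : H f -> ev (fun x => is_derive x 1 f (derive1 f x)).
Proof.
move=> /(hardy_derivable hH)/evP; apply: evS => x hx; rewrite derive1E; exact: DeriveDef.
Qed.

(** An element that is not eventually zero is invertible, so it has no zeros far out, and the
    intermediate value theorem fixes its sign. *)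
Lemma hardy_sign f : H f -> [\/ ev (fun x => f x = 0), ev (fun x => 0 < f x) | ev (fun x => f x < 0)].
Proof.
move=> hf; have [f0|nf0] := pselect (\forall x \near +oo, f x = 0).
  by constructor 1; apply/evP.
have [g hg /evP fg] := hardyV hH hf nf0.
have /evP fc := hardy_continuous hH hf.
have [x0 h0] := evI fg fc.
have nz x : x0 <= x -> f x != 0.
  move=> /h0[E _]; apply/eqP => fx0; move: E; rewrite fx0 mul0r => /eqP.
  by rewrite eq_sym oner_eq0.
have cont x y : x0 <= x -> {within `[x, y], continuous f}.
  move=> x0x; apply: continuous_in_subspaceT => z; rewrite inE /= in_itv /= => /andP[xz _].
  by have [_] := h0 z (le_trans x0x xz).
have [fx0|fx0] := ltP 0 (f x0).
  constructor 2; exists x0 => x x0x; rewrite ltNge; apply/negP => fx.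
  have := @IVT R f x0 x 0 x0x (cont x0 x (lexx _)).
  rewrite (min_r (le_trans fx (ltW fx0))) (max_l (le_trans fx (ltW fx0))) fx (ltW fx0).
  by move=> /(_ isT)[c]; rewrite in_itv /= => /andP[c1 _] /eqP; apply/negP/nz.
have fx0' : f x0 < 0 by rewrite lt_def eq_sym nz // fx0.
constructor 3; exists x0 => x x0x; rewrite ltNge; apply/negP => fx.
have := @IVT R f x0 x 0 x0x (cont x0 x (lexx _)).
rewrite (min_l (le_trans fx0 fx)) (max_r (le_trans fx0 fx)) fx fx0.
by move=> /(_ isT)[c]; rewrite in_itv /= => /andP[c1 _] /eqP; apply/negP/nz.
Qed.

Lemma hardy_wsign f : H f -> ev (fun x => 0 <= f x) \/ ev (fun x => f x <= 0).
Proof.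
by case/hardy_sign => h; [left|left|right]; apply: evS h => x; [move=> ->|exact: ltW|exact: ltW].
Qed.

Lemma hardy_mono f : H f -> exists x0,
  (forall x y, x0 <= x -> x <= y -> f x <= f y) \/ (forall x y, x0 <= x -> x <= y -> f y <= f x).
Proof.
move=> hf; have hd := hardy_is_derive hf.
have [h|h] := hardy_wsign (hardy_derive hH hf); have [x0 hx] := evI hd h; exists x0.
  left; apply: (@nondecreasing_of_derive _ _ (derive1 f)) => x /hx[] //.
right; apply: (@nonincreasing_of_derive _ _ (derive1 f)) => x /hx[] //.
Qed.

(* [a + x b] has a constant sign although the identity function need not belong to [H]:
   after division by [b] its derivative lies in [H]. *)
Lemma hardy_affine_sign a b : H a -> H b ->
  ev (fun x => 0 <= a x + x * b x) \/ ev (fun x => a x + x * b x <= 0).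
Proof.
move=> ha hb; have [b0|nb0] := pselect (\forall x \near +oo, b x = 0).
  move/evP: b0 => b0.
  by have [h|h] := hardy_wsign ha; [left|right]; apply: evS (evI b0 h) => x [-> ?]; rewrite mulr0 addr0.
have [g hg /evP bg] := hardyV hH hb nb0.
have hc := hardyM hH ha hg; pose c x := a x * g x.
have hd := hardy_is_derive hc.
have hu : ev (fun x => 0 <= c x + x) \/ ev (fun x => c x + x <= 0).
  have hdu : ev (fun x => is_derive x 1 (fun y => c y + y) (derive1 c x + 1)).
    by apply: evS hd => x hx; exact: is_deriveD.
  have hs := hardy_wsign (hardyD (hardy_derive hH hc) (hardy1 hH)).
  case: hs => hs; have [x0 hx] := evI hdu hs; apply: (@ev_sign_of_mono _ _ x0); [left|right].
    by apply: (@nondecreasing_of_derive _ _ (fun x => derive1 c x + 1)) => x /hx[].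
  by apply: (@nonincreasing_of_derive _ _ (fun x => derive1 c x + 1)) => x /hx[].
have E : ev (fun x => a x + x * b x = b x * (c x + x)).
  by apply: evS bg => x hx; rewrite /c mulrDr mulrCA hx mulr1 mulrC [b x * x]mulrC.
have [b0|b0] := hardy_wsign hb; case: hu => hu; [left|right|right|left];
  apply: evS (evI E (evI b0 hu)) => x [-> [h1 h2]].
- exact: mulr_ge0.
- exact: mulr_ge0_le0.
- exact: mulr_le0_ge0.
- exact: mulr_le0.
Qed.

Lemma hardy_euler_sign f n : H f ->
  ev (fun x => 0 <= x * derive1 f x + n%:R * f x) \/ ev (fun x => x * derive1 f x + n%:R * f x <= 0).
Proof.
move=> hf; have := hardy_affine_sign (hardyM hH (hardy_nat n) hf) (hardy_derive hH hf).
by case=> h; [left|right]; apply: evS h => x; rewrite addrC.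
Qed.

(** Otherwise f x ^ (n + 1) would be eventually nonincreasing, hence bounded, although it is at
    least x. *)
Lemma hardy_euler_ge f n : H f -> ev (fun x => 0 < f x) -> ev (fun x => 1 <= f x * x ^+ n) ->
  ev (fun x => 0 <= x * derive1 f x + n.+1%:R * f x).
Proof.
move=> hf f0 fn; have [//|h] := hardy_euler_sign n.+1 hf; exfalso.
have [x0 x01 hx] := ev_from 1 (evI (hardy_is_derive hf) (evI h (evI f0 fn))).
have mono : forall x y, x0 <= x -> x <= y -> f y * y ^+ n.+1 <= f x * x ^+ n.+1.
  apply: (@nonincreasing_of_derive _ _ (fun x => x ^+ n * (x * derive1 f x + n.+1%:R * f x))) => x x0x.
    by apply: is_derive_mulXn; have [] := hx x x0x.
  have [_ [h1 _]] := hx x x0x; apply: mulr_ge0_le0 h1; rewrite exprn_ge0 //.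
  by apply: le_trans x0x; apply: le_trans x01.
set C := f x0 * x0 ^+ n.+1.
have C0 : x0 <= Num.max x0 (C + 1) by rewrite le_max lexx.
have := mono _ _ (lexx x0) C0; have [_ [_ [_]]] := hx _ C0.
set y := Num.max x0 (C + 1); have yC : C + 1 <= y by rewrite le_max lexx orbT.
have y0 : 0 <= y by apply: le_trans C0; apply: le_trans x01.
move=> h1 h2; have := ler_wpM2r y0 h1; rewrite exprSr mulrA in h2; rewrite -/C in h2; lra.
Qed.

(** Otherwise f / x ^ (n + 1) would be eventually nondecreasing and stay above some C > 0, although
    it is at most 1 / x; any point from 1 / C + 1 on gives the contradiction. *)
Lemma hardy_euler_le f n : H f -> ev (fun x => 0 < f x) -> ev (fun x => f x <= x ^+ n) ->
  ev (fun x => x * derive1 f x <= n.+1%:R * f x).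
Proof.
move=> hf f0 fn.
have [h|h] := hardy_affine_sign (hardyN (hardyM hH (hardy_nat n.+1) hf)) (hardy_derive hH hf);
  last by apply: evS h => x; rewrite addrC subr_le0.
exfalso.
have [x0 x01 hx] := ev_from 1 (evI (hardy_is_derive hf) (evI h (evI f0 fn))).
have pos x : x0 <= x -> 0 < x by move=> x0x; apply: lt_le_trans ltr01 (le_trans x01 x0x).
have mono : forall x y, x0 <= x -> x <= y -> f x / x ^+ n.+1 <= f y / y ^+ n.+1.
  apply: (@nondecreasing_of_derive _ _ (fun x => (x * derive1 f x - n.+1%:R * f x) / x ^+ n.+2)) => x x0x.
    by apply: is_derive_divXn; [exact: pos|have [] := hx x x0x].
  have [_ [h1 _]] := hx x x0x; rewrite divr_ge0 ?exprn_ge0 // ?(ltW (pos _ x0x)) //.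
  by rewrite addrC.
set C := f x0 / x0 ^+ n.+1.
have C0 : 0 < C.
  apply: divr_gt0; last by rewrite exprn_gt0 // pos.
  by have [_ [_ []]] := hx _ (lexx x0).
set y := Num.max x0 (C^-1 + 1).
have y0 : x0 <= y by rewrite le_max lexx.
have yC : C^-1 + 1 <= y by rewrite le_max lexx orbT.
have := mono _ _ (lexx x0) y0; have [_ [_ [_ h1]]] := hx _ y0; rewrite -/C => h2.
have yp := pos _ y0.
have : C * y ^+ n.+1 <= y ^+ n by apply: le_trans h1; rewrite -ler_pdivlMr // exprn_gt0.
rewrite exprS mulrA ger_pMl ?exprn_gt0 // => h3.
have : C * (C^-1 + 1) <= 1 by apply: le_trans h3; rewrite ler_pM2l.
rewrite mulrDr mulfV ?gt_eqF //; lra.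
Qed.

(** This says without division that f / x ^ p decreases and f x ^ p increases, in the weak sense.
    Over a range such as [eta N, 2 N] the values of [f] then agree up to a factor that depends only
    on [eta] and [p]. *)
Definition poly_regular f p (x0 : R) := 1 <= x0 /\
  forall x y, x0 <= y -> y <= x ->
    [/\ 0 < f y, f x * y ^+ p <= f y * x ^+ p & f y * y ^+ p <= f x * x ^+ p].

Lemma hardy_poly_regular f n : H f -> ev (fun x => 0 < f x) ->
  ev (fun x => f x <= x ^+ n) -> ev (fun x => 1 <= f x * x ^+ n) ->
  exists x0, poly_regular f n.+1 x0.
Proof.
move=> hf f0 fl fu.
have h1 := hardy_euler_le hf f0 fl; have h2 := hardy_euler_ge hf f0 fu.
have [x0 x01 hx] := ev_from 1 (evI (hardy_is_derive hf) (evI f0 (evI h1 h2))).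
have pos x : x0 <= x -> 0 < x by move=> x0x; apply: lt_le_trans ltr01 (le_trans x01 x0x).
exists x0; split => // x y x0y yx; have x0x := le_trans x0y yx; split.
- by have [_ []] := hx y x0y.
- rewrite -ler_pdivrMr ?exprn_gt0 ?pos // mulrAC -ler_pdivlMr ?exprn_gt0 ?pos //.
  apply: (@nonincreasing_of_derive _ (fun x => f x / x ^+ n.+1)
      (fun x => (x * derive1 f x - n.+1%:R * f x) / x ^+ n.+2) x0) => // z x0z.
    by apply: is_derive_divXn; [exact: pos|have [] := hx z x0z].
  have [_ [_ [h3 _]]] := hx z x0z.
  by rewrite mulr_le0_ge0 ?subr_le0 // invr_ge0 exprn_ge0 // ltW // pos.
- apply: (@nondecreasing_of_derive _ (fun x => f x * x ^+ n.+1)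
     (fun x => x ^+ n * (x * derive1 f x + n.+1%:R * f x)) x0) => // z x0z.
    by apply: is_derive_mulXn; have [] := hx z x0z.
  have [_ [_ [_ h3]]] := hx z x0z; apply: mulr_ge0 h3; rewrite exprn_ge0 // ltW // pos //.
Qed.

Lemma hardy_not_to0 f : H f -> ~ to0 f ->
  exists2 c : R, 0 < c & ev (fun x => c <= f x) \/ ev (fun x => f x <= - c).
Proof.
have pos_case g : H g -> ev (fun x => 0 < g x) -> ~ to0 g -> exists2 c : R, 0 < c & ev (fun x => c <= g x).
  move=> hg g0 ng; have [x1 mg] := hardy_mono hg.
  have [x2 x12 h2] := ev_from x1 g0; case: mg => mg.
    by exists (g x2); [exact: h2 | exists x2 => x xx; exact: mg].
  have [e e0 ne] : exists2 e, 0 < e & ~ ev (fun x => `|g x| < e).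
    apply: contrapT => h; apply: ng => e e0; apply: contrapT => h'; apply: h; by exists e.
  exists e => //; exists x2 => x xx; rewrite leNgt; apply/negP => gx; apply: ne.
  exists x => y xy; rewrite gtr0_norm; last by apply/h2/le_trans/xy.
  by apply: le_lt_trans gx; apply: mg => //; exact: le_trans x12 xx.
move=> hf nf; case: (hardy_sign hf) => h.
- by exfalso; apply: nf => e e0; apply: evS h => x ->; rewrite normr0.
- by have [c c0 hc] := pos_case f hf h nf; exists c => //; left.
- have [||c c0 hc] := pos_case (fun x => - f x) (hardyN hf).
  + by apply: evS h => x; rewrite oppr_gt0.
  + move=> t0; apply: nf => e e0; apply: evS (t0 e e0) => x; by rewrite normrN.
  + by exists c => //; right; apply: evS hc => x; rewrite lerNr.
Qed.

(** The function f - q x ^ (j + 1) is nondecreasing, and half of [q] pays for its value at the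
    starting point. *)
Lemma ev_growth_step f df (c : R) j : 0 < c -> ev (fun x => is_derive x 1 f (df x)) ->
  ev (fun x => c * x ^+ j <= df x) -> exists2 c' : R, 0 < c' & ev (fun x => c' * x ^+ j.+1 <= f x).
Proof.
move=> c0 hd hc; have [x0 x01 hx] := ev_from 1 (evI hd hc).
pose q := c / j.+1%:R; have q0 : 0 < q by rewrite divr_gt0.
have mono : forall x y, x0 <= x -> x <= y -> f x - q * x ^+ j.+1 <= f y - q * y ^+ j.+1.
  apply: (@nondecreasing_of_derive _ (fun x => f x - q * x ^+ j.+1) (fun x => df x - c * x ^+ j)) => x x0x.
    have [d1 _] := hx x x0x.
    have d2 := @is_derive_mulXn R (fun=> q) 0 j x (is_derive_cst q x 1).
    apply: is_derive_eq; rewrite /q; field; by rewrite gt_eqF.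
  by rewrite subr_ge0; have [] := hx x x0x.
exists (q / 2); first by rewrite divr_gt0.
pose B := f x0 - q * x0 ^+ j.+1.
exists (Num.max x0 (2 * `|B| / q)) => x; rewrite ge_max => /andP[x0x Bx].
have := mono _ _ (lexx x0) x0x; rewrite -/B => h1.
have x1 : 1 <= x by exact: le_trans x01 x0x.
have xj : x <= x ^+ j.+1 by rewrite exprS ler_peMr ?exprn_ege1 //; lra.
have : 2 * `|B| <= q * x ^+ j.+1.
  move: Bx; rewrite ler_pdivrMr // => Bx; apply: (le_trans Bx).
  by rewrite [leLHS]mulrC ler_pM2l.
have := ler_norm (- B); rewrite normrN; lra.
Qed.

Lemma ev_growth (F : nat -> R -> R) i j (c : R) :
  (forall i, ev (fun x => is_derive x 1 (F i) (F i.+1 x))) ->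
  0 < c -> ev (fun x => c * x ^+ j <= F i x) ->
  exists2 c' : R, 0 < c' & ev (fun x => c' * x ^+ (i + j) <= F 0%N x).
Proof.
move=> hF; elim: i j c => [|i IH] j c c0 hc; first by exists c.
have [c' c'0 hc'] := ev_growth_step c0 (hF i) hc.
by have [c2 c20 h2] := IH _ _ c'0 hc'; exists c2 => //; rewrite addSnnS.
Qed.

End HardyField.

(** * Derivative tests for values of a smooth function *)

Section FiniteDifferences.
Context {R : realType}.
Implicit Types (F : nat -> R -> R).

(** Successive derivatives as a bare family: the differences F i (x + q) - F i x form such a family
    again, one step shorter, which drives the inductions on the order. *)
Definition derivative_family F m (x0 : R) :=
  forall i x, (i < m)%N -> x0 <= x -> is_derive x 1 (F i) (F i.+1 x).

Lemma derivative_familyW F m m' x0 : (m' <= m)%N -> derivative_family F m x0 -> derivative_family F m' x0.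
Proof. by move=> mm hF i x im; apply: hF; exact: leq_trans im mm. Qed.

Lemma derivative_family_opp F m x0 : derivative_family F m x0 ->
  derivative_family (fun i x => - F i x) m x0.
Proof. by move=> hF i x im h; have := hF i x im h => ?; exact: is_deriveN. Qed.

Lemma is_derive_shift (f : R -> R) (df x q : R) : is_derive (x + q) 1 f df ->
  is_derive x 1 (fun y => f (y + q)) df.
Proof.
move=> hf; have hs : is_derive x 1 (fun y : R => y + q) 1.
  by apply: is_derive_eq; rewrite addr0.
have := @is_derive1_comp R f (fun y => y + q) x df 1 hf hs.
by rewrite mulr1.
Qed.

Lemma derivative_family_diff F m (x0 q : R) : 0 <= q -> derivative_family F m.+1 x0 ->
  derivative_family (fun i x => F i (x + q) - F i x) m x0.
Proof.
move=> q0 hF i x im h.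
have h1 := hF i x (ltnW im) h.
have h2 : is_derive x 1 (fun y => F i (y + q)) (F i.+1 (x + q)).
  by apply/is_derive_shift/hF; [exact: ltnW | lra].
exact: is_deriveB.
Qed.

Lemma dif_diff m (f : nat -> R) n : dif m (fun j => f j.+1 - f j) n = dif m.+1 f n.
Proof.
rewrite dif_sub /=; congr (_ - _).
have -> : dif m (fun j => f j.+1) n = dif m (fun j => f (j + 1)%N) n.
  by congr dif; apply/funext => j; rewrite addn1.
by rewrite dif_shift addn1.
Qed.

(** One difference is absorbed into the family, and the mean value theorem at top order turns it
    into a factor [q]. The step [q] is general for the sake of progressions modulo [q]. *)
Lemma dif_mvt F m (x0 a q lo hi : R) n : 0 <= q -> derivative_family F m x0 -> x0 <= a + q * n%:R ->
  (forall y, a + q * n%:R <= y -> y <= a + q * (n + m)%:R -> lo <= F m y <= hi) ->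
  q ^+ m * lo <= dif m (fun j => F 0%N (a + q * j%:R)) n <= q ^+ m * hi.
Proof.
move=> q0; elim: m F lo hi => [|m IH] F lo hi hF hx hy.
  by rewrite !expr0 !mul1r; apply: hy; rewrite ?addn0.
rewrite -dif_diff.
have -> : (fun j => F 0%N (a + q * j.+1%:R) - F 0%N (a + q * j%:R)) =
   (fun j => (fun x => F 0%N (x + q) - F 0%N x) (a + q * j%:R)).
  by apply/funext => j; rewrite -natr1 mulrDr mulr1 addrA.
rewrite !exprSr -!mulrA.
apply: (IH (fun i x => F i (x + q) - F i x)) => //; first exact: derivative_family_diff.
move=> y y1 y2.
have yq : y <= y + q by lra.
have [||c /andP[c1 c2] ->] := @mean_value _ (F m) (F m.+1) y (y + q).
- exact: yq.
- by move=> x /andP[yx _]; apply: hF => //; exact: le_trans (le_trans hx y1) yx.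
have -> : y + q - y = q by ring.
have /andP[l1 l2] : lo <= F m.+1 c <= hi.
  apply: hy; first exact: le_trans c1.
  by rewrite addnS -natr1 mulrDr mulr1; lra.
by rewrite !(mulrC q) !ler_wpM2r.
Qed.

Lemma dif_nondecreasing F m (x0 a q : R) : 0 <= q -> derivative_family F m x0 -> x0 <= a ->
  (forall x y, x0 <= x -> x <= y -> F m x <= F m y) ->
  forall i j, (i <= j)%N ->
  dif m (fun j => F 0%N (a + q * j%:R)) i <= dif m (fun j => F 0%N (a + q * j%:R)) j.
Proof.
move=> q0; elim: m F => [|m IH] F hF hx hm i j ij /=.
  apply: hm; first by rewrite ler_wpDr // mulr_ge0.
  by rewrite lerD2l ler_wpM2l // ler_nat.
have E n : dif m (fun j => F 0%N (a + q * j%:R)) n.+1 - dif m (fun j => F 0%N (a + q * j%:R)) n =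
  dif m (fun j => (fun x => F 0%N (x + q) - F 0%N x) (a + q * j%:R)) n.
  rewrite -[LHS]/(dif m.+1 _ n) -dif_diff; congr dif; apply/funext => k.
  by rewrite -natr1 mulrDr mulr1 addrA.
rewrite !E.
apply: (IH (fun i x => F i (x + q) - F i x)) => //; first exact: derivative_family_diff.
apply: (@nondecreasing_of_derive _ _ (fun x => F m.+1 (x + q) - F m.+1 x)).
  move=> x xx0; have h1 := hF m x (ltnSn m) xx0.
  have h2 : is_derive x 1 (fun y => F m (y + q)) (F m.+1 (x + q)).
    by apply/is_derive_shift/hF => //; lra.
  exact: is_deriveB.
by move=> x xx0; rewrite subr_ge0; apply: hm => //; lra.
Qed.

Lemma dif_mono F m (x0 a q : R) L : 0 <= q -> derivative_family F m x0 -> x0 <= a ->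
  (forall x y, x0 <= x -> x <= y -> F m x <= F m y) \/
  (forall x y, x0 <= x -> x <= y -> F m y <= F m x) ->
  mono_upto (dif m (fun j => F 0%N (a + q * j%:R))) L.
Proof.
move=> q0 hF hx [] hm.
  by left => i j /andP[ij _]; apply: (dif_nondecreasing q0 hF hx hm).
right => i j /andP[ij _].
have hm' : forall x y, x0 <= x -> x <= y -> - F m x <= - F m y by move=> x y h1 h2; rewrite lerN2 hm.
have := dif_nondecreasing q0 (derivative_family_opp hF) hx hm' ij.
by rewrite !dif_opp lerN2.
Qed.

Lemma mono_upto_affine (g : nat -> R) (c d : R) L : 0 <= c -> mono_upto g L ->
  mono_upto (fun n => c * g n - d) L.
Proof.
by move=> c0 [] mg; [left|right] => m n mn; rewrite lerD2r; apply: ler_wpM2l => //; apply: mg.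
Qed.

Lemma eq_mono_upto (g g' : nat -> R) L : g =1 g' -> mono_upto g L -> mono_upto g' L.
Proof. by move=> e [] mg; [left|right] => m n mn; rewrite -!e; apply: mg. Qed.

End FiniteDifferences.

(** * The derivative test on the block from eta N to N *)

Section BlockTest.
Context {R : realType}.
Implicit Types (F : nat -> R -> R).

Definition weyl_sum (alpha : R -> R) (k : R) N := expsum (fun n => k * alpha n%:R) N.

Lemma cabs_weyl_sum_le alpha (k : R) N : cabs (weyl_sum alpha k N) <= N%:R.
Proof. exact: cabs_expsum_le. Qed.

Lemma weyl_sum_split alpha (k : R) n N : (n <= N)%N ->
  cabs (weyl_sum alpha k N) <=
  n%:R + cabs (expsum (fun j => k * alpha (n%:R + 1 * j%:R)) (N - n)).
Proof.
move=> nN; rewrite /weyl_sum /expsum (@big_cat_nat _ _ _ n) //=.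
apply: le_trans (cabsD _ _) _; apply: lerD; first by have := cabs_expsum_le (fun i => k * alpha i%:R) n.
rewrite -{1}(add0n n) big_addn le_eqVlt; apply/orP; left; apply/eqP; congr cabs.
by apply: eq_bigr => i _; rewrite natrD mul1r addrC.
Qed.

Lemma nat_ge_exists (x : R) : exists N0 : nat, forall N : nat, (N0 <= N)%N -> x <= N%:R.
Proof.
exists (Num.truncn x).+1 => N NN; apply: (le_trans (ltW (truncnS_gt x))).
by rewrite ler_nat.
Qed.

(** About eta N initial terms are bounded trivially; on the rest, regularity confines the derivative
    of order [m] to a fixed ratio, so the test of order [m] applies to a single block. *)
Lemma block_test F m p (x0 eps : R) : (0 < m)%N -> 0 < eps ->
  derivative_family F m x0 -> poly_regular (F m) p x0 ->
  (forall x y, x0 <= x -> x <= y -> F m x <= F m y) \/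
  (forall x y, x0 <= x -> x <= y -> F m y <= F m x) ->
  exists2 del : R, 0 < del & exists N0 : nat, forall (N : nat) (k : R), (N0 <= N)%N -> 0 < k ->
    k * F m N%:R <= del -> del^-1 <= k * F m N%:R * N%:R ^+ m ->
    cabs (weyl_sum (F 0%N) k N) <= eps * N%:R.
Proof.
move=> m0 eps0 hF [x01 hreg] hm.
pose e := Num.min eps 1.
have e0 : 0 < e by rewrite lt_min eps0 ltr01.
have e1 : e <= 1 by rewrite ge_min lexx orbT.
have ee : e <= eps by rewrite ge_min lexx.
pose eta := e / 4.
have eta0 : 0 < eta by rewrite divr_gt0.
have eta1 : eta <= 1 / 4 by rewrite /eta; lra.
clearbody e.
have etap0 : 0 < eta ^+ p by rewrite exprn_gt0.
have etap1 : eta ^+ p <= 1 by rewrite exprn_ile1 //; [exact: ltW | lra].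
(* One factor for each end of the range eta ^ p * U <= F m y <= U / eta ^ p. *)
pose C := (eta ^+ p)^-1 * (eta ^+ p)^-1.
have C1 : 1 <= C by rewrite /C -invfM invf_ge1 ?mulr_gt0 // mulr_ile1 // ltW.
have [|dT dT0 hT] := @derivative_testP R m m0 (e / 2) C _ C1; first by rewrite divr_gt0.
pose del := Num.min dT (eta ^+ p / 2 ^+ m * dT).
have del0 : 0 < del by rewrite lt_min dT0 !mulr_gt0 // invr_gt0 exprn_gt0.
exists del => //.
have [N1 hN1] := nat_ge_exists (x0 / eta + 4 / e + m%:R).
exists N1 => N k NN k0 kd kN.
have {NN} := hN1 N NN => {N1 hN1} hN.
have x00 : 0 < x0 by apply: lt_le_trans x01.
have hx0 : 0 < x0 / eta by rewrite divr_gt0.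
have he4 : 0 < 4 / e by rewrite divr_gt0.
have mR : 0 <= m%:R :> R by [].
have Nx : x0 <= eta * N%:R by rewrite mulrC -ler_pdivrMr //; lra.
have N4 : 4 <= e * N%:R by rewrite mulrC -ler_pdivrMr //; lra.
have Nm : m%:R <= N%:R :> R by lra.
have N0 : 0 < N%:R :> R by lra.
have x0N : x0 <= N%:R by apply: le_trans Nx _; rewrite ler_piMl //; lra.
set U := F m N%:R in kd kN *.
have U0 : 0 < U by have [] := hreg _ _ x0N (lexx _).
pose n1 := (Num.truncn (eta * N%:R)).+1.
have n1l : eta * N%:R <= n1%:R by apply/ltW/truncnS_gt.
have n1u : n1%:R <= eta * N%:R + 1.
  by rewrite /n1 -natr1 lerD2r truncn_le // mulr_ge0 // ltW.
clearbody n1.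
have n1N2 : n1%:R <= N%:R / 2 :> R.
  apply: (le_trans n1u).
  have : eta * N%:R <= 1 / 4 * N%:R by rewrite ler_pM2r.
  have : e * N%:R <= N%:R by rewrite ler_piMl.
  lra.
have n1N : (n1 <= N)%N by rewrite -(ler_nat R); lra.
have LN : N%:R / 2 <= (N - n1)%:R :> R by rewrite natrB //; lra.
have LN' : (N - n1)%:R <= N%:R :> R by rewrite ler_nat leq_subr.
apply: le_trans (weyl_sum_split _ _ n1N) _.
pose lam := k * (eta ^+ p * U).
have bound y : eta * N%:R <= y -> y <= 2 * N%:R -> eta ^+ p * U <= F m y <= (eta ^+ p)^-1 * U.
  move=> y1 y2; have x0y := le_trans Nx y1.
  have y0 : 0 < y by apply: lt_le_trans x0y.
  have yp : 0 < y ^+ p by rewrite exprn_gt0.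
  have Np : 0 < N%:R ^+ p :> R by rewrite exprn_gt0.
  have etaN : eta ^+ p * N%:R ^+ p <= y ^+ p.
    by rewrite -exprMn lerXn2r // nnegrE ?mulr_ge0 // ltW.
  have [yN|Ny] := leP y N%:R.
    have [Fy h1 h2] := hreg _ _ x0y yN; apply/andP; split.
      rewrite -(ler_pM2r Np); apply: le_trans h1.
      by rewrite mulrAC [leRHS]mulrC ler_pM2r.
    rewrite mulrC ler_pdivlMr // -(ler_pM2r Np); apply: le_trans h2.
    by rewrite -mulrA ler_pM2l.
  have [Fy h1 h2] := hreg _ _ x0N (ltW Ny).
  have yh : eta * y <= N%:R.
    have : eta * y <= 1 / 4 * y by rewrite ler_pM2r.
    lra.
  have yhp : eta ^+ p * y ^+ p <= N%:R ^+ p.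
    rewrite -exprMn lerXn2r // nnegrE ?mulr_ge0 //; exact: ltW.
  have Fy0 : 0 < F m y by have [] := hreg _ _ x0y (lexx y).
  apply/andP; split.
    rewrite -(ler_pM2r yp); apply: le_trans h2.
    by rewrite mulrAC [leRHS]mulrC ler_pM2r.
  rewrite mulrC ler_pdivlMr // -(ler_pM2r Np); apply: le_trans (_ : U * y ^+ p * eta ^+ p <= _).
    by rewrite mulrAC ler_pM2r.
  by rewrite -mulrA ler_pM2l // mulrC.
have lam0 : 0 < lam by rewrite /lam !mulr_gt0.
have main : cabs (expsum (fun j => k * F 0%N (n1%:R + 1 * j%:R)) (N - n1)) <= e / 2 * (N - n1)%:R.
  apply: (hT _ _ lam) => //.
  - apply: (@le_trans _ _ (k * U)).
      by rewrite /lam mulrCA ler_piMl // mulr_ge0 // ltW.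
    by apply: (le_trans kd); rewrite ge_min lexx.
  - have dl : del <= eta ^+ p / 2 ^+ m * dT by rewrite ge_min lexx orbT.
    have m20 : 0 < 2 ^+ m :> R by rewrite exprn_gt0.
    have h1 : dT^-1 <= eta ^+ p / 2 ^+ m * del^-1.
      by rewrite ler_pdivlMr // mulrC ler_pdivrMr.
    apply: (le_trans h1).
    apply: (@le_trans _ _ (eta ^+ p / 2 ^+ m * (k * U * N%:R ^+ m))).
      by rewrite ler_pM2l // divr_gt0.
    have -> : eta ^+ p / 2 ^+ m * (k * U * N%:R ^+ m) = lam * (N%:R / 2) ^+ m.
      rewrite /lam (expr_div_n N%:R 2 m); field; by rewrite gt_eqF.
    by rewrite ler_pM2l // lerXn2r // nnegrE ?divr_ge0.
  - apply: eq_mono_upto (fun n => esym (dif_scale m k _ n)) _.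
    have := @dif_mono R F m x0 n1%:R 1 (N - n1) ler01 hF (le_trans Nx n1l) hm.
    by case=> mg; [left|right] => i j ij; rewrite ler_pM2l //; apply: mg.
  - move=> n nL; rewrite dif_scale.
    have := @dif_mvt R F m x0 n1%:R 1 (eta ^+ p * U) ((eta ^+ p)^-1 * U) n ler01 hF.
    have nn : n1%:R + 1 * n%:R <= N%:R :> R.
      by rewrite mul1r -natrD ler_nat; clear -nL; lia.
    have n0 : 0 <= n%:R :> R by [].
    rewrite expr1n !mul1r => H.
    have /andP[h1 h2] : eta ^+ p * U <= dif m (fun j => F 0%N (n1%:R + 1 * j%:R)) n <= (eta ^+ p)^-1 * U.
      apply: H; first by lra.
      move=> y y1 y2; apply: bound; first by lra.
      by move: y2; rewrite natrD; lra.
    rewrite /lam ler_pM2l // h1 /=.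
    have -> : C * (k * (eta ^+ p * U)) = k * ((eta ^+ p)^-1 * U).
      by rewrite /C; field; rewrite gt_eqF.
    by rewrite ler_pM2l.
have : e / 2 * (N - n1)%:R <= e / 2 * N%:R by rewrite ler_pM2l // divr_gt0.
have : e * N%:R <= eps * N%:R by rewrite ler_pM2r.
rewrite /eta in n1u; lra.
Qed.
End BlockTest.

(** * Finite Fourier analysis and the von Neumann inequality *)

Section FiniteFourier.
Context {R : realType}.
Implicit Types (Q L M n : nat).

Lemma conjcM (x y : R[i]) : conjc (x * y) = conjc x * conjc y.
Proof. exact: rmorphM. Qed.

Lemma cis_orthogonal Q j j' : (j < Q)%N -> (j' < Q)%N ->
  \sum_(0 <= r < Q) cis (r%:R * ((j%:R - j'%:R) / Q%:R) : R) = if j == j' then Q%:R else 0.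
Proof.
move=> jQ j'Q.
have Q0 : 0 < Q%:R :> R by rewrite ltr0n (leq_ltn_trans _ jQ).
case: eqP => [->|/eqP ne].
  under eq_bigr do rewrite subrr mul0r mulr0 cis0.
  by rewrite big_const_nat iter_addr_0 subn0.
set x := (_ - _) / _.
have : (cis x - 1) * (\sum_(0 <= r < Q) cis (r%:R * x)) = 0.
  rewrite cis_geo /x mulrC divfK ?gt_eqF // cisB !cis_nat conjc1 mulr1 subrr //.
move/eqP; rewrite mulf_eq0 => /orP[/eqP E|/eqP //]; exfalso.
have Nx : `|x| = `|j%:R - j'%:R| / Q%:R by rewrite normrM normfV (gtr0_norm Q0).
have d0 : 0 <= (Q%:R)^-1 :> R by rewrite invr_ge0 ltW.
have dist : 1 <= `|(j%:R : R) - j'%:R| <= Q%:R - 1.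
  move: ne; rewrite neq_ltn => /orP[lt|lt]; [rewrite distrC|];
    rewrite ger0_norm ?subr_ge0 ?ler_nat ?(ltnW lt) // -natrB ?(ltnW lt) //;
    (have -> : Q%:R - 1 = (Q - 1)%:R :> R by rewrite natrB //; exact: leq_ltn_trans jQ);
    by rewrite ler1n ler_nat; clear -lt jQ j'Q; lia.
have := @cis_subr1_ge' _ (Q%:R)^-1 x d0.
rewrite Nx E cabs0 -[X in X <= _ / _]mul1r ler_pM2r ?invr_gt0 // => H.
case/andP: dist => d1 d2.
have : (2 * (Q%:R)^-1 : R) <= 0.
  by apply: H => //; rewrite ler_pdivrMr // mulrBl mul1r mulVf ?gt_eqF.
by rewrite leNgt mulr_gt0 ?invr_gt0.
Qed.

(** The number [n] of terms is separate from the period [Q]: a shorter sequence is padded by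
    zeros. *)
Definition dft Q n (a : nat -> R[i]) (r : nat) : R[i] :=
  \sum_(0 <= j < n) a j * cis (r%:R * (j%:R / Q%:R)).

Lemma parseval Q n a : (n <= Q)%N ->
  \sum_(0 <= r < Q) cabs (dft Q n a r) ^+ 2 = Q%:R * \sum_(0 <= j < n) cabs (a j) ^+ 2.
Proof.
move=> nQ; apply: (@complexI R); rewrite raddf_sum /= rmorphM raddf_sum /= rmorph_nat.
transitivity (\sum_(0 <= r < Q) \sum_(0 <= j < n) \sum_(0 <= j' < n)
   (a j * conjc (a j')) * cis (r%:R * ((j%:R - j'%:R) / Q%:R) : R)).
  apply: eq_bigr => r _; rewrite cabs_sqrC /dft rmorph_sum /= mulr_suml.
  apply: eq_bigr => j _; rewrite mulr_sumr; apply: eq_bigr => j' _.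
  rewrite conjcM mulrBl mulrBr cisB; ring.
rewrite exchange_big /= mulr_sumr !big_nat; apply: eq_bigr => j /andP[_ jn].
rewrite exchange_big /=.
transitivity (\sum_(0 <= j' < n) if j == j' then (a j * conjc (a j')) * Q%:R else 0).
  rewrite !big_nat; apply: eq_bigr => j' /andP[_ j'n].
  rewrite -mulr_sumr cis_orthogonal ?(leq_trans _ nQ) //.
  by case: eqP => // _; rewrite mulr0.
rewrite -big_mkcond /= (eq_bigl (fun i => i == j)); last by move=> i; rewrite eq_sym.
by rewrite big_nat1_eq jn cabs_sqrC mulrC.
Qed.

(** Every l + m is below the period L + M, so the cyclic convolution does not wrap around. *)
Lemma dft_bilinear L M (a c b : nat -> R[i]) (Q := (L + M)%N) :
  \sum_(0 <= r < Q) dft Q L a r * dft Q M c r * conjc (dft Q Q b r) =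
  Q%:R * \sum_(0 <= l < L) \sum_(0 <= m < M) a l * c m * conjc (b (l + m)%N).
Proof.
transitivity (\sum_(0 <= r < Q) \sum_(0 <= l < L) \sum_(0 <= m < M) \sum_(0 <= j < Q)
   (a l * c m * conjc (b j)) * cis (r%:R * (((l + m)%N%:R - j%:R) / Q%:R) : R)).
  apply: eq_bigr => r _; rewrite /dft rmorph_sum /= mulr_suml mulr_suml.
  apply: eq_bigr => l _; rewrite -[LHS]mulrA [X in _ * X]mulr_suml mulr_sumr; apply: eq_bigr => m _.
  rewrite !mulr_sumr; apply: eq_bigr => j _.
  rewrite conjcM natrD mulrBl mulrDl mulrBr mulrDr cisB cisD; ring.
rewrite exchange_big /= mulr_sumr; apply: eq_big_nat => l /andP[_ lL].
rewrite exchange_big /= mulr_sumr; apply: eq_big_nat => m /andP[_ mM].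
rewrite exchange_big /=.
have lmQ : (l + m < Q)%N by rewrite /Q -addnS leq_add // ltnW.
transitivity (\sum_(0 <= j < Q) if (l + m)%N == j then (a l * c m * conjc (b j)) * Q%:R else 0).
  apply: eq_big_nat => j /andP[_ jQ].
  rewrite -mulr_sumr cis_orthogonal //.
  by case: eqP => // _; rewrite mulr0.
rewrite -big_mkcond /= (eq_bigl (fun i => i == (l + m)%N)); last by move=> i; rewrite eq_sym.
by rewrite big_nat1_eq lmQ mulrC.
Qed.

(* The form is a truncated Toeplitz form with symbol [\sum_m c m e(m theta)]; embedding it
   in the cyclic group of order [L + M] diagonalises it. *)
Lemma toeplitz_bound L M (a c b : nat -> R) (bd t : R) :
  (0 < L)%N -> 0 < t -> 0 <= bd ->
  (forall th : R, cabs (\sum_(0 <= m < M) (c m)%:C%C * cis (m%:R * th)) <= bd) ->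
  `|\sum_(0 <= l < L) \sum_(0 <= m < M) a l * c m * b (l + m)%N| <=
  bd / 2 * (t * (\sum_(0 <= l < L) a l ^+ 2) + t^-1 * \sum_(0 <= j < L + M) b j ^+ 2).
Proof.
move=> L0 t0 bd0 hc; set Q := (L + M)%N.
have Q0 : 0 < Q%:R :> R by rewrite ltr0n addn_gt0 L0.
pose ac j := (a j)%:C%C; pose cc j := (c j)%:C%C; pose bc j := (b j)%:C%C.
have sqC (x : R) : cabs x%:C%C ^+ 2 = x ^+ 2 by rewrite cabs_real real_normK ?num_real.
rewrite -(ler_pM2l Q0).
have -> : Q%:R * `|\sum_(0 <= l < L) \sum_(0 <= m < M) a l * c m * b (l + m)%N| =
  cabs (\sum_(0 <= r < Q) dft Q L ac r * dft Q M cc r * conjc (dft Q Q bc r)).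
  rewrite dft_bilinear cabsM -[Q%:R in RHS](rmorph_nat (real_complex R)) cabs_real (gtr0_norm Q0).
  congr (_ * _); rewrite -cabs_real raddf_sum; congr cabs; apply: eq_bigr => l _.
  rewrite raddf_sum; apply: eq_bigr => m _.
  by rewrite /ac /cc /bc conjc_real -!rmorphM.
apply: le_trans (cabs_sum _ _ _) _.
apply: (@le_trans _ _ (\sum_(0 <= r < Q) bd / 2 *
    (t * cabs (dft Q L ac r) ^+ 2 + t^-1 * cabs (dft Q Q bc r) ^+ 2))).
  apply: ler_sum => r _; rewrite !cabsM cabs_conj.
  set x := cabs (dft Q L _ _); set y := cabs (dft Q Q _ _).
  have hP : cabs (dft Q M cc r) <= bd.
    apply: le_trans (hc (r%:R / Q%:R)); rewrite le_eqVlt; apply/orP; left; apply/eqP.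
    congr cabs; apply: eq_bigr => j _; congr (_ * cis _); ring.
  have x0 : 0 <= x by exact: cabs_ge0.
  have y0 : 0 <= y by exact: cabs_ge0.
  (* The weight [t] stays free; it is chosen at the end to balance the measures of the two sets. *)
  have xy : 2 * (x * y) <= t * x ^+ 2 + t^-1 * y ^+ 2.
    have : 0 <= t^-1 * (t * x - y) ^+ 2 by rewrite mulr_ge0 ?sqr_ge0 // invr_ge0 ltW.
    have -> : t^-1 * (t * x - y) ^+ 2 = t * x ^+ 2 + t^-1 * y ^+ 2 - 2 * (x * y).
      by field; rewrite gt_eqF.
    by rewrite subr_ge0.
  have -> : x * cabs (dft Q M cc r) * y = cabs (dft Q M cc r) * (x * y) by ring.
  have -> (w : R) : bd / 2 * w = bd * (w / 2) by ring.
  apply: ler_pM => //; rewrite ?cabs_ge0 ?mulr_ge0 //; lra.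
rewrite -mulr_sumr big_split /= -!mulr_sumr parseval ?leq_addr // parseval //.
under [X in t * (Q%:R * X)]eq_bigr do rewrite sqC.
under [X in t^-1 * (Q%:R * X)]eq_bigr do rewrite sqC.
by rewrite le_eqVlt; apply/orP; left; apply/eqP; ring.
Qed.
End FiniteFourier.

(** * Von Neumann's inequality for correlations *)

Section VonNeumann.
Context {R : realType} {d : measure_display} {X : measurableType d}.
Variables (mu : probability X R) (T : X -> X).
Hypothesis mpT : measure_preserving_system mu T.

Lemma measurable_iter_preimage n (B : set X) : measurable B -> measurable (iter n T @^-1` B).
Proof.
case: mpT => mT _ _; elim: n => [//|n IH] mB.
have -> : iter n.+1 T @^-1` B = T @^-1` (iter n T @^-1` B).
  by apply/seteqP; split => x /=; rewrite -iterSr.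
by rewrite -[X in measurable X]setTI; exact: mT (IH mB).
Qed.

Lemma measure_iter_preimage n (B : set X) : measurable B -> mu (iter n T @^-1` B) = mu B.
Proof.
case: (mpT) => mT [S [TS ST mS]] pT; elim: n => [//|n IH] mB.
have -> : iter n.+1 T @^-1` B = T @^-1` (iter n T @^-1` B).
  by apply/seteqP; split => x /=; rewrite -iterSr.
have mE := measurable_iter_preimage n mB.
have mE' : measurable (T @^-1` (iter n T @^-1` B)).
  by rewrite -[X in measurable X]setTI; exact: mT.
rewrite -[RHS](IH mB) -(pT _ mE'); congr (mu _).
apply/seteqP; split => [x [y Ey <-] //|x Ex]; exists (S x); rewrite ?ST //=.
by rewrite ST.
Qed.

(** Integration of a pointwise inequality. In this form the Toeplitz bound, applied on each orbit,
    passes to measures of sets without any function space. *)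
Lemma indic_combination_ge0 (s : seq (R * set X)) :
  (forall p, p \in s -> measurable p.2) ->
  (forall x, 0 <= \sum_(p <- s) p.1 * \1_p.2 x) ->
  0 <= \sum_(p <- s) p.1 * fine (mu p.2).
Proof.
move=> ms hs.
rewrite -lee_fin -sumEFin.
have -> : (\sum_(p <- s) (p.1 * fine (mu p.2))%:E =
   \sum_(p <- s) \int[mu]_x (p.1%:E * (\1_p.2 x)%:E))%E.
  rewrite big_seq [in RHS]big_seq; apply: eq_bigr => p ps.
  have mp := ms p ps.
  rewrite integralZl //; last exact: integrable_indic.
  by rewrite integral_indic // setIT EFinM fineK // fin_num_measure.
have := @integral_sum _ _ _ mu setT.
move=> /(_ _ _ (fun k : 'I_(size s) => fun x => ((nth (0, set0) s k).1%:E * (\1_(nth (0, set0) s k).2 x)%:E)%E)).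
move=> IS.
rewrite (big_nth (0, set0)) big_mkord -IS //.
  apply: integral_ge0 => x _; rewrite sumEFin lee_fin.
  by have := hs x; rewrite (big_nth (0, set0)) big_mkord.
move=> k; apply: integrableZl => //; apply/integrable_indic/ms.
by rewrite mem_nth.
Qed.

(** Transference replaces the spectral theorem: the Toeplitz bound is applied to the indicators of
    the two sets along the orbit of a point, and then integrated. *)
Lemma von_neumann_inequality (c : nat -> R) M (bd : R) (A B : set X) :
  measurable A -> measurable B -> 0 <= bd ->
  (forall th : R, cabs (\sum_(0 <= m < M) (c m)%:C%C * cis (m%:R * th)) <= bd) ->
  `|\sum_(0 <= m < M) c m * correlation mu T A B m| <=
  bd * Num.sqrt (fine (mu A) * fine (mu B)).
Proof.
move=> mA mB bd0 hc.
set a := fine (mu A); set b := fine (mu B); set S := \sum_(0 <= m < M) _.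
have a0 : 0 <= a by rewrite fine_ge0.
have b0 : 0 <= b by rewrite fine_ge0.
(* The sign [sg] provides both halves of the absolute value. By invariance each of the [L] base
   points contributes the same sum [S]. *)
have key1 L t (sg : bool) : (0 < L)%N -> 0 < t ->
    (-1) ^+ sg * (L%:R * S) <= bd / 2 * (t * (L%:R * a) + t^-1 * ((L + M)%N%:R * b)).
  move=> L0 t0.
  pose EA l := iter l T @^-1` A.
  pose EB l := iter l T @^-1` B.
  pose s := [seq (bd / 2 * t, EA l) | l <- index_iota 0 L] ++
    [seq (bd / 2 * t^-1, EB l) | l <- index_iota 0 (L + M)] ++
    [seq (- ((-1) ^+ sg * c m), EA l `&` EB (l + m)%N) | l <- index_iota 0 L, m <- index_iota 0 M].
  have := @indic_combination_ge0 s.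
  rewrite !big_cat /= !big_map !big_allpairs_dep /= => H.
  have {H} : 0 <= \sum_(0 <= j < L) bd / 2 * t * fine (mu (EA j)) +
     (\sum_(0 <= j < L + M) bd / 2 / t * fine (mu (EB j)) +
      \sum_(0 <= l < L) \sum_(0 <= m < M)
        - ((-1) ^+ sg * c m) * fine (mu (EA l `&` EB (l + m)%N))).
    apply: H.
      move=> p; rewrite !mem_cat => /or3P[/mapP[l _ ->]|/mapP[l _ ->]|/allpairsP[[l m] [_ _ ->]]] /=.
      - exact: measurable_iter_preimage.
      - exact: measurable_iter_preimage.
      - by apply: measurableI; exact: measurable_iter_preimage.
    move=> x; rewrite !big_cat /= !big_map !big_allpairs_dep /=.
    have := @toeplitz_bound R L M (fun l => \1_(EA l) x) c (fun l => \1_(EB l) x) bd t L0 t0 bd0 hc.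
    have sq (E : nat -> set X) n : \sum_(0 <= l < n) (\1_(E l) x : R) ^+ 2 = \sum_(0 <= l < n) \1_(E l) x.
      by apply: eq_bigr => l _; rewrite indicE; case: (x \in E l); rewrite ?expr1n ?expr0n.
    rewrite !sq -!mulr_sumr => H.
    have -> : \sum_(0 <= l < L) \sum_(0 <= m < M) - ((-1) ^+ sg * c m) * \1_(EA l `&` EB (l + m)%N) x =
      - ((-1) ^+ sg * \sum_(0 <= l < L) \sum_(0 <= m < M) \1_(EA l) x * c m * \1_(EB (l + m)%N) x) :> R.
      rewrite mulr_sumr -sumrN; apply: eq_bigr => l _.
      rewrite mulr_sumr -sumrN; apply: eq_bigr => m _.
      by rewrite indicI /=; ring.
    set Y := \sum_(0 <= l < L) \sum_(0 <= m < M) _ in H *.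
    have : (-1) ^+ sg * Y <= `|Y|.
      by apply: le_trans (ler_norm _) _; rewrite normrM normrX normrN1 expr1n mul1r.
    move=> h; have := le_trans h H; rewrite -subr_ge0 => H'; apply: le_trans H' _.
    by rewrite le_eqVlt; apply/orP; left; apply/eqP; ring.
  under eq_bigr => j _ do rewrite measure_iter_preimage //.
  under [X in _ + (X + _)]eq_bigr => j _ do rewrite measure_iter_preimage //.
  have -> : \sum_(0 <= l < L) \sum_(0 <= m < M)
     - ((-1) ^+ sg * c m) * fine (mu (EA l `&` EB (l + m)%N)) = - ((-1) ^+ sg * (L%:R * S)).
    transitivity (\sum_(0 <= l < L) - ((-1) ^+ sg * S)); last first.
      by rewrite big_const_nat iter_addr_0 subn0 mulNrn -mulr_natr; congr (- _); ring.
    apply: eq_bigr => l _; rewrite mulr_sumr -sumrN; apply: eq_bigr => m _.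
    rewrite mulNr -mulrA; congr (- (_ * (_ * fine _))).
    rewrite -[RHS](measure_iter_preimage l); last first.
      by apply: measurableI => //; exact: measurable_iter_preimage.
    have -> // : EB (l + m)%N = iter l T @^-1` (iter m T @^-1` B).
    by apply/seteqP; split => x; rewrite /EB /= addnC iterD.
  have sc n (x : R) : \sum_(0 <= j < n) x = n%:R * x.
    by rewrite big_const_nat iter_addr_0 subn0 mulr_natl.
  rewrite !sc -/a -/b => H.
  rewrite -subr_ge0; apply: le_trans H _; rewrite le_eqVlt; apply/orP; left; apply/eqP; ring.
(* Division by [L], taken large, removes the [M] extra orbit points on the side of [B]. *)
have key2 t (sg : bool) : 0 < t -> (-1) ^+ sg * S <= bd / 2 * (t * a + t^-1 * b).
  move=> t0; apply/ler_addgt0Pr => e e0.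
  pose L := (Num.truncn (bd / 2 * t^-1 * M%:R * b / e)).+1.
  have L0 : (0 < L)%N by [].
  have LR : 0 < L%:R :> R by rewrite ltr0n.
  have hL : bd / 2 * t^-1 * M%:R * b <= e * L%:R.
    by rewrite [leRHS]mulrC -ler_pdivrMr //; apply/ltW/truncnS_gt.
  have := key1 L t sg L0 t0; rewrite natrD => H.
  rewrite -(ler_pM2l LR) mulrCA; apply: (le_trans H).
  have -> : bd / 2 * (t * (L%:R * a) + t^-1 * ((L%:R + M%:R) * b)) =
     L%:R * (bd / 2 * (t * a + t^-1 * b)) + bd / 2 * t^-1 * M%:R * b by ring.
  by rewrite [leRHS]mulrDr lerD2l [leRHS]mulrC.
(* The optimal weight is the square root of b / a; if one of the measures vanishes, a very large or
   very small [t] is taken instead. *)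
have key3 (sg : bool) : (-1) ^+ sg * S <= bd * Num.sqrt (a * b).
  have [a00|a00] := eqVneq a 0.
    rewrite a00 mul0r sqrtr0 mulr0; apply/ler_addgt0Pr => e e0; rewrite add0r.
    pose t := (bd * b / 2 + 1) / e.
    have bb : 0 <= bd * b by rewrite mulr_ge0.
    have t0 : 0 < t by rewrite divr_gt0 //; lra.
    have := key2 t sg t0; rewrite a00 mulr0 add0r => H; apply: (le_trans H).
    have -> : bd / 2 * (t^-1 * b) = bd * b / 2 / t by ring.
    by rewrite ler_pdivrMr // /t [leRHS]mulrC divfK ?gt_eqF //; lra.
  have [b00|b00] := eqVneq b 0.
    rewrite b00 mulr0 sqrtr0 mulr0; apply/ler_addgt0Pr => e e0; rewrite add0r.
    pose t := e / (bd * a / 2 + 1).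
    have bb : 0 <= bd * a by rewrite mulr_ge0.
    have t0 : 0 < t by rewrite divr_gt0 //; lra.
    have := key2 t sg t0; rewrite b00 mulr0 addr0 => H; apply: (le_trans H).
    have -> : bd / 2 * (t * a) = t * (bd * a / 2) by ring.
    rewrite /t mulrAC ler_pdivrMr; last by lra.
    by rewrite ler_pM2l //; lra.
  have ap : 0 < Num.sqrt a by rewrite sqrtr_gt0 lt_def a00.
  have bp : 0 < Num.sqrt b by rewrite sqrtr_gt0 lt_def b00.
  have H := key2 (Num.sqrt b / Num.sqrt a) sg (divr_gt0 bp ap); apply: (le_trans H).
  rewrite sqrtrM //; have Ea := sqr_sqrtr a0; have Eb := sqr_sqrtr b0.
  move: ap bp Ea Eb; move: (Num.sqrt a) (Num.sqrt b) => u v u0 v0 <- <-.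
  rewrite le_eqVlt; apply/orP; left; apply/eqP; field; by rewrite !gt_eqF.
rewrite ler_norml; apply/andP; split.
  by have := key3 true; rewrite expr1; lra.
by have := key3 false; rewrite expr0 mul1r.
Qed.
End VonNeumann.

(** * Weyl sums near a limiting derivative *)

Section WeylCriterion.
Context {R : realType}.
Implicit Types (u : nat -> R).

Lemma eventually_forall (Q : nat -> nat -> Prop) P :
  (forall i, (i < P)%N -> exists N0 : nat, forall N : nat, (N0 <= N)%N -> Q i N) ->
  exists N0 : nat, forall N i : nat, (N0 <= N)%N -> (i < P)%N -> Q i N.
Proof.
elim: P => [|P IH] h; first by exists 0%N.
have [i iP|N1 h1] := IH; first by apply: h; exact: ltnW.
have [N2 h2] := h P (ltnSn P).
exists (maxn N1 N2) => N i; rewrite geq_max => /andP[n1 n2].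
rewrite ltnS leq_eqVlt => /orP[/eqP ->|iP].
  exact: h2.
exact: h1.
Qed.

Lemma expsum_roots P : (1 < P)%N -> \sum_(0 <= i < P) cis (i%:R / P%:R : R) = 0.
Proof.
move=> P1; have P0 : (0 < P)%N by exact: ltnW.
transitivity (\sum_(0 <= r < P) cis (r%:R * ((1%:R - 0%:R) / P%:R) : R)).
  by apply: eq_bigr => i _; rewrite subr0 mul1r.
by rewrite cis_orthogonal.
Qed.

Lemma frac_partP (x : R) : 0 <= frac_part x < 1.
Proof.
rewrite /frac_part subr_ge0 ge_floor /= ltrBlDl.
by have := floorD1_gt x; rewrite rmorphD /=.
Qed.

Lemma cis_frac (x : R) : cis (frac_part x) = cis x.
Proof. exact: cisBint. Qed.

(** The unit interval is cut into [P] cells. In each the exponential is replaced by its value at the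
    left end, and the cells are visited almost equally often, so what remains is a multiple of the
    sum of all [P]-th roots of unity, which vanishes. *)
Lemma ud_weyl u : uniformly_distributed_mod1 u -> forall eps : R, 0 < eps ->
  exists N0 : nat, forall N : nat, (N0 <= N)%N -> cabs (expsum u N) <= eps * N%:R.
Proof.
move=> hu eps eps0.
pose P := (Num.truncn (64 / eps)).+2.
have P1 : (1 < P)%N by [].
have PR : 64 / eps <= P%:R.
  by apply: (le_trans (ltW (truncnS_gt _))); rewrite ler_nat.
clearbody P.
have P0 : 0 < P%:R :> R by rewrite ltr0n ltnW.
pose cell i n := i%:R / P%:R <= frac_part (u n) < i.+1%:R / P%:R.
pose cnt i N := count (cell i) (iota 1 N).
have [N1 hN1] : exists N0 : nat, forall N i : nat, (N0 <= N)%N -> (i < P)%N ->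
    `|(cnt i N)%:R / N%:R - P%:R^-1| <= eps / (8 * P%:R).
  apply: eventually_forall => i iP.
  have i1 : (0 : R) <= i%:R / P%:R by rewrite divr_ge0.
  have i2 : i%:R / P%:R < i.+1%:R / P%:R :> R by rewrite ltr_pM2r ?invr_gt0 // ltr_nat.
  have i3 : i.+1%:R / P%:R <= 1 :> R by rewrite ler_pdivrMr // mul1r ler_nat.
  have := hu _ _ i1 i2 i3.
  have -> : i.+1%:R / P%:R - i%:R / P%:R = P%:R^-1 :> R.
    by rewrite -mulrBl -natr1 addrAC subrr add0r mul1r.
  move=> /cvgrPdist_le /(_ (eps / (8 * P%:R))).
  have e8 : 0 < eps / (8 * P%:R) by rewrite divr_gt0 // mulr_gt0.
  move=> /(_ e8)[N0 _ h]; exists N0 => N NN.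
  by have := h N NN; rewrite distrC.
have [N2 hN2] := nat_ge_exists (8 / eps : R).
exists (maxn (maxn N1 N2) 1) => N; rewrite !geq_max => /andP[/andP[n1 n2] n3].
have NR : 0 < N%:R :> R by rewrite ltr0n.
have N8 : 2 <= eps / 4 * N%:R by have := hN2 N n2; rewrite ler_pdivrMr //; lra.
(* Uniform distribution counts the indices 1 to N, the exponential sum those from 0 to N - 1. *)
have shift : cabs (expsum u N - \sum_(n <- iota 1 N) cis (u n)) <= 2.
  have -> : \sum_(n <- iota 1 N) cis (u n) = expsum u N + cis (u N) - cis (u 0%N).
    have -> : iota 1 N = index_iota 1 N.+1 by rewrite /index_iota subSS subn0.
    have : \sum_(0 <= n < N.+1) cis (u n) = expsum u N + cis (u N) by rewrite big_nat_recr.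
    by rewrite big_nat_recl // => <-; rewrite [X in _ = X]addrC addKr big_add1.
  have -> (a b c : R[i]) : a - (a + b - c) = c - b by ring.
  by apply: le_trans (cabsB _ _) _; rewrite !cabs_cis.
have cellE n i : (i < P)%N -> cell i n = (i == Num.truncn (P%:R * frac_part (u n))).
  move=> iP; have /andP[f0 f1] := frac_partP (u n).
  rewrite /cell ler_pdivrMr // ltr_pdivlMr // [_ * P%:R]mulrC.
  have h0 : 0 <= P%:R * frac_part (u n) by rewrite mulr_ge0.
  apply/idP/eqP => [/truncn_def -> //|->].
  exact: truncn_itv.
have inP n : (Num.truncn (P%:R * frac_part (u n)) < P)%N.
  have /andP[f0 f1] := frac_partP (u n).
  have h0 : 0 <= P%:R * frac_part (u n) by rewrite mulr_ge0.
  rewrite -(ltr_nat R); apply: le_lt_trans (_ : P%:R * frac_part (u n) < _).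
    by have /andP[] := truncn_itv h0.
  by rewrite gtr_pMr.
have step : cabs (\sum_(n <- iota 1 N) cis (u n) -
    \sum_(0 <= i < P) (cnt i N)%:R * cis (i%:R / P%:R : R)) <= 16 / P%:R * N%:R.
  have -> : \sum_(0 <= i < P) (cnt i N)%:R * cis (i%:R / P%:R : R) =
    \sum_(n <- iota 1 N) cis ((Num.truncn (P%:R * frac_part (u n)))%:R / P%:R : R).
    transitivity (\sum_(0 <= i < P) \sum_(n <- iota 1 N) if cell i n then cis (i%:R / P%:R : R) else 0).
      apply: eq_bigr => i _; rewrite -big_mkcond /= big_const_seq iter_addr_0 mulr_natl.
      by rewrite /cnt.
    rewrite exchange_big /=; apply: eq_bigr => n _.
    transitivity (\sum_(0 <= i < P) if i == Num.truncn (P%:R * frac_part (u n)) then cis (i%:R / P%:R : R) else 0).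
      by apply: eq_big_nat => i /andP[_ iP]; rewrite cellE.
    by rewrite -big_mkcond /= big_nat1_eq inP.
  rewrite -sumrB; apply: le_trans (cabs_sum _ _ _) _.
  apply: (@le_trans _ _ (\sum_(n <- iota 1 N) 16 / P%:R)); last first.
    by rewrite big_const_seq count_predT size_iota iter_addr_0 mulr_natr.
  apply: ler_sum => n _; rewrite -cis_frac; apply: le_trans (cis_lip _ _) _.
  rewrite ler_pM2l //.
  have /andP[f0 f1] := frac_partP (u n).
  have h0 : 0 <= P%:R * frac_part (u n) by rewrite mulr_ge0.
  have /andP[t1 t2] := truncn_itv h0.
  set t := (Num.truncn _)%:R in t1 *; rewrite -natr1 -/t in t2.
  have -> : frac_part (u n) - t / P%:R = (P%:R * frac_part (u n) - t) / P%:R.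
    by field; rewrite gt_eqF.
  rewrite normrM normfV (gtr0_norm P0) ler_piMl ?invr_ge0 //.
  by rewrite ger0_norm; lra.
have tail : cabs (\sum_(0 <= i < P) (cnt i N)%:R * cis (i%:R / P%:R : R)) <= eps / 8 * N%:R.
  have -> : \sum_(0 <= i < P) (cnt i N)%:R * cis (i%:R / P%:R : R) =
    \sum_(0 <= i < P) ((cnt i N)%:R - N%:R / P%:R)%:C%C * cis (i%:R / P%:R : R).
    transitivity (\sum_(0 <= i < P) (cnt i N)%:R * cis (i%:R / P%:R : R) -
       (N%:R / P%:R)%:C%C * \sum_(0 <= i < P) cis (i%:R / P%:R : R)).
      by rewrite expsum_roots // mulr0 subr0.
    rewrite mulr_sumr -sumrB; apply: eq_bigr => i _.
    by rewrite rmorphB /= rmorph_nat mulrBl.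
  apply: le_trans (cabs_sum _ _ _) _.
  apply: (@le_trans _ _ (\sum_(0 <= i < P) eps / (8 * P%:R) * N%:R)); last first.
    rewrite big_const_nat iter_addr_0 subn0 -mulr_natr le_eqVlt; apply/orP; left; apply/eqP.
    by field; rewrite gt_eqF.
  rewrite !big_nat; apply: ler_sum => i /andP[_ iP].
  rewrite cabsM cabs_cis mulr1 cabs_real.
  have -> : (cnt i N)%:R - N%:R / P%:R = ((cnt i N)%:R / N%:R - P%:R^-1) * N%:R :> R.
    by field; rewrite !gt_eqF.
  by rewrite normrM (gtr0_norm NR) ler_pM2r // hN1.
have p16 : 16 / P%:R <= eps / 4.
  rewrite ler_pdivrMr //; move: PR; rewrite ler_pdivrMr //; lra.
have p16N : 16 / P%:R * N%:R <= eps / 4 * N%:R by rewrite ler_pM2r.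
apply: le_trans (cabs_subDl _ (\sum_(n <- iota 1 N) cis (u n))) _.
have := cabs_subDl (\sum_(n <- iota 1 N) cis (u n)) (\sum_(0 <= i < P) (cnt i N)%:R * cis (i%:R / P%:R : R)).
lra.
Qed.

Lemma abel_bound (a z : nat -> R[i]) L (M : R) :
  (forall n, (n <= L.+1)%N -> cabs (\sum_(0 <= i < n) z i) <= M) ->
  cabs (\sum_(0 <= n < L.+1) a n * z n) <=
  M * (cabs (a L) + \sum_(0 <= n < L) cabs (a n.+1 - a n)).
Proof.
move=> hM; pose b n := \sum_(0 <= i < n) z i.
have -> : \sum_(0 <= n < L.+1) a n * z n = \sum_(0 <= n < L.+1) a n * (b n.+1 - b n).
  apply: eq_bigr => n _; congr (_ * _); rewrite /b big_nat_recr //=; ring.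
rewrite sum_by_parts {2}/b big_geq // mulr0 subr0.
apply: le_trans (cabsB _ _) _; rewrite mulrDr; apply: lerD.
  by rewrite cabsM mulrC ler_wpM2r ?cabs_ge0 // hM.
apply: le_trans (cabs_sum _ _ _) _; rewrite mulr_sumr !big_nat; apply: ler_sum => n /andP[_ nL].
rewrite cabsM mulrC; apply: ler_wpM2r; first exact: cabs_ge0.
by apply: hM; exact: ltnW.
Qed.

Lemma sum_residues (u : nat -> R[i]) q L :
  \sum_(0 <= n < q * L) u n = \sum_(0 <= r < q) \sum_(0 <= j < L) u (q * j + r)%N.
Proof.
elim: L => [|L IH].
  rewrite muln0 big_geq //; symmetry; apply: big1 => r _; by rewrite big_geq.
rewrite mulnS addnC (@big_cat_nat _ _ _ (q * L)) //=; last exact: leq_addr.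
have -> : \sum_(q * L <= i < q * L + q) u i = \sum_(0 <= r < q) u (q * L + r)%N.
  rewrite -{1}(add0n (q * L)%N) big_addn addKn; apply: eq_bigr => r _; by rewrite addnC.
rewrite IH -big_split /=.
by apply: eq_bigr => r _; rewrite big_nat_recr.
Qed.

(** With l = 0, the integer sequence j choose k has order k difference constantly 1; its integer
    multiples can be subtracted from a phase at no cost. *)
Lemma dif_binomial k l n : dif k (fun j => 'C(j, k + l)%:R : R) n = 'C(n, l)%:R.
Proof.
elim: k l n => [//|k IH] l n; rewrite -dif_diff -IH; congr dif; apply/funext => j.
by rewrite addSn binS natrD addrC addKr.
Qed.
End WeylCriterion.

(** * Weyl sums when the derivative of order k tends to c > 0 *)

Section LimitCase.
Context {R : realType}.
Variables (F : nat -> R -> R) (k : nat) (x0 c A A2 : R).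
Hypotheses (k0 : (0 < k)%N) (x01 : 1 <= x0) (hF : derivative_family F k x0).
Hypothesis hm : (forall x y, x0 <= x -> x <= y -> F k x <= F k y) \/
  (forall x y, x0 <= x -> x <= y -> F k y <= F k x).
Hypotheses (c0 : 0 < c) (A0 : 0 <= A) (hc : forall x, x0 <= x -> `|F k x - c| <= A / x ^+ k).
Hypotheses (hA : forall x, x0 <= x -> `|F 0%N x| <= A2 * x ^+ k)
  (hinc : forall x y, x0 <= x -> x <= y -> F 0%N x <= F 0%N y).

Lemma limit_dif_bound (a q E : R) n : 0 < q -> x0 <= a -> 0 <= E -> (forall y, a <= y -> A / y ^+ k <= E) ->
  `|dif k (fun j => F 0%N (a + q * j%:R)) n - q ^+ k * c| <= q ^+ k * E.
Proof.
move=> q0 xa E0 hE.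
have xan : a <= a + q * n%:R by rewrite lerDl mulr_ge0 // ltW.
have := @dif_mvt R F k x0 a q (c - E) (c + E) n (ltW q0) hF (le_trans xa xan).
move=> H; have /H : forall y : R, a + q * n%:R <= y -> y <= a + q * (n + k)%:R -> c - E <= F k y <= c + E.
  move=> y y1 _; have ay := le_trans xan y1.
  have := le_trans (hc (le_trans xa ay)) (hE y ay).
  by rewrite ler_norml => /andP[h1 h2]; apply/andP; split; lra.
by rewrite !mulrDr mulrN ler_norml => /andP[h1 h2]; apply/andP; split; lra.
Qed.

Lemma decay_le (a y E : R) : 0 < a -> a <= y -> A / a ^+ k <= E -> A / y ^+ k <= E.
Proof.
move=> a0 ay; apply: le_trans.
have y0 : 0 < y by apply: lt_le_trans ay.
rewrite ler_wpM2l // lef_pV2 ?posrE ?exprn_gt0 // lerXn2r // nnegrE; exact: ltW.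
Qed.

(** Past a fixed initial segment the order k differences of K * alpha stay within [eta] of ks * c,
    so the tolerance in Weyl's test covers all [K] near [ks] at once. *)
Lemma weyl_sum_irrational (ks eps : R) : 0 < ks -> irrational_num (ks * c) -> 0 < eps ->
  exists2 rho : R, 0 < rho & exists N0 : nat, forall (K : R) (N : nat), `|K - ks| < rho -> (N0 <= N)%N ->
    cabs (weyl_sum (F 0%N) K N) <= eps * N%:R.
Proof.
move=> ks0 irr eps0.
have e20 : 0 < eps / 2 by rewrite divr_gt0.
have [L0 [eta [eta0 hW]]] := weyl_testP k0 irr e20.
pose rho := eta / (2 * (c + A + 1)).
have c0' := c0; have A0' := A0; have x01' := x01.
have cA : 0 < c + A + 1 by lra.
have rho0 : 0 < rho by rewrite divr_gt0 // mulr_gt0.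
exists rho => //.
have [n1 hn1] := nat_ge_exists (x0 + 2 * ks * A / eta + 1).
have {hn1} n1l := hn1 n1 (leqnn _).
have q1 : 0 <= 2 * ks * A / eta by positivity.
have n1x : x0 <= n1%:R by lra.
have n11 : 1 <= n1%:R :> R by lra.
have n10 : 0 < n1%:R :> R by lra.
have n1k : n1%:R <= n1%:R ^+ k :> R.
  by rewrite -(prednK k0) exprS ler_peMr // exprn_ege1.
(* The bound [A] keeps the differences below c + A, and eta / (2 ks) allots half of the tolerance to
   F k - c; [rho] allots the other half to K - ks. *)
pose E := Num.min A (eta / (2 * ks)).
have E0 : 0 <= E by rewrite le_min A0 divr_ge0 // ltW // mulr_gt0.
have hE : A / n1%:R ^+ k <= E.
  rewrite le_min !ler_pdivrMr ?exprn_gt0 //; apply/andP; split.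
    by rewrite ler_peMr // exprn_ege1.
  rewrite mulrAC ler_pdivlMr ?mulr_gt0 //.
  have : 2 * ks * A / eta <= n1%:R ^+ k by lra.
  rewrite ler_pdivrMr //; lra.
have [N1 hN1] := nat_ge_exists (n1%:R / (eps / 2)).
exists (maxn N1 (n1 + L0)) => K N Kks; rewrite geq_max => /andP[NN1 NL].
have n1N : (n1 <= N)%N by apply: leq_trans NL; exact: leq_addr.
have L0L : (L0 <= N - n1)%N by rewrite leq_subRL.
have n1e : n1%:R <= eps / 2 * N%:R.
  by have := hN1 N NN1; rewrite ler_pdivrMr // mulrC.
apply: le_trans (weyl_sum_split _ _ n1N) _.
apply: (@le_trans _ _ (n1%:R + eps / 2 * (N - n1)%:R)); last first.
  have : (N - n1)%:R <= N%:R :> R by rewrite ler_nat leq_subr.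
  rewrite -(ler_pM2l e20); lra.
rewrite lerD2l; apply: hW => // n nL; rewrite dif_scale.
have := @limit_dif_bound n1%:R 1 E n ltr01 n1x E0 (fun y hy => decay_le n10 hy hE).
set D := dif _ _ _; rewrite expr1n !mul1r => hD.
have EA : E <= A by rewrite ge_min lexx.
have Eks : ks * E <= eta / 2.
  have : E <= eta / (2 * ks) by rewrite ge_min lexx orbT.
  rewrite ler_pdivlMr ?mulr_gt0 //; lra.
have Db : `|D| <= c + A.
  have -> : D = (D - c) + c by ring.
  apply: le_trans (ler_normD _ _) _; rewrite (gtr0_norm c0); lra.
have -> : K * D - ks * c = (K - ks) * D + ks * (D - c) by ring.
apply: le_trans (ler_normD _ _) _; rewrite !normrM (gtr0_norm ks0).
have h1 : `|K - ks| * `|D| <= rho * (c + A + 1).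
  by apply: ler_pM => //; [exact: ltW | lra].
have h2 : ks * `|D - c| <= ks * E by rewrite ler_pM2l.
have h3 : rho * (c + A + 1) = eta / 2 by rewrite /rho; field; rewrite gt_eqF.
lra.
Qed.

(* The integer-valued sequence [p q^(k-1) 'C(j, k)] absorbs the rational part of the [k]-th
   difference along a residue class modulo [q]. *)
Lemma residue_class_sum (K ks a E eps dT : R) (p : int) (q L : nat) :
  (forall f L (lam : R), 0 < lam -> lam <= dT -> dT^-1 <= lam * L%:R ^+ k ->
    mono_upto (dif k f) L -> (forall n, (n < L)%N -> lam <= dif k f n <= 3 * lam) ->
    cabs (expsum f L) <= eps * L%:R) ->
  (0 < q)%N -> q%:R * (ks * c) = p%:~R -> 0 < K -> x0 <= a -> 0 <= E ->
  (forall y, a <= y -> A / y ^+ k <= E) -> K * E <= `|K - ks| * c / 2 -> 0 < `|K - ks| ->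
  `|K - ks| * c * q%:R ^+ k / 2 <= dT -> dT^-1 <= `|K - ks| * c * q%:R ^+ k / 2 * L%:R ^+ k ->
  cabs (\sum_(0 <= j < L) cis (K * F 0%N (a + q%:R * j%:R))) <= eps * L%:R.
Proof.
move=> hT q0 qp K0 xa E0 hE KE tau0 lamd lamL.
set tau := K - ks in KE tau0 lamd lamL *.
set lam := `|tau| * c * q%:R ^+ k / 2 in lamd lamL.
have qR : 0 < q%:R :> R by rewrite ltr0n.
have qk0 : 0 < q%:R ^+ k :> R by rewrite exprn_gt0.
have c0' := c0.
have lam0 : 0 < lam by rewrite /lam; positivity.
pose f j := K * F 0%N (a + q%:R * j%:R) - (p%:~R * q%:R ^+ k.-1) * 'C(j, k)%:R.
have -> : \sum_(0 <= j < L) cis (K * F 0%N (a + q%:R * j%:R)) = expsum f L.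
  apply: eq_bigr => j _; rewrite /f.
  have -> : p%:~R * q%:R ^+ k.-1 * 'C(j, k)%:R = (p * (q ^ k.-1 * 'C(j, k))%N%:Z)%:~R :> R.
    by rewrite intrM -pmulrn natrM natrX mulrA.
  by rewrite cisBint.
pose g := dif k (fun j => F 0%N (a + q%:R * j%:R)).
have difE n : dif k f n = K * g n - q%:R ^+ k * (ks * c).
  rewrite /f dif_sub !dif_scale -/(g n); congr (_ - _).
  have := dif_binomial (R := R) k 0 n; rewrite addn0 bin0 => ->.
  by rewrite mulr1 -qp mulrAC -exprS prednK.
(* [lam] is half of the main term |tau| c q ^ k, so up to sign the differences lie between lam and 3
   lam; hence the ratio 3. *)
have db n : `|dif k f n - tau * c * q%:R ^+ k| <= lam.
  rewrite difE.
  have -> : K * g n - q%:R ^+ k * (ks * c) - tau * c * q%:R ^+ k = K * (g n - q%:R ^+ k * c).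
    by rewrite /tau; ring.
  rewrite normrM (gtr0_norm K0).
  apply: (@le_trans _ _ (K * (q%:R ^+ k * E))).
    by rewrite ler_pM2l //; exact: limit_dif_bound.
  have -> : lam = q%:R ^+ k * (`|tau| * c / 2) by rewrite /lam; ring.
  by rewrite mulrCA ler_pM2l.
have mf : mono_upto (dif k f) L.
  apply: (@eq_mono_upto _ (fun n => K * g n - q%:R ^+ k * (ks * c))); first by move=> n; rewrite difE.
  apply: mono_upto_affine; first exact: ltW.
  exact: (@dif_mono R F k x0 a q%:R L (ltW qR) hF xa hm).
have [tp|tn] := ltP 0 tau.
  apply: (hT _ _ lam) => // n nL; have := db n.
  have -> : tau * c * q%:R ^+ k = 2 * lam by rewrite /lam (gtr0_norm tp); field.
  by rewrite ler_norml => /andP[h1 h2]; apply/andP; split; lra.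
rewrite -cabs_expsumN; apply: (hT _ _ lam) => //.
  by apply: eq_mono_upto (mono_uptoN mf) => n; rewrite dif_opp.
move=> n nL; rewrite dif_opp; have := db n.
have -> : tau * c * q%:R ^+ k = - (2 * lam) by rewrite /lam (ler0_norm tn); field.
by rewrite ler_norml => /andP[h1 h2]; apply/andP; split; lra.
Qed.

(** On a progression modulo [q] the rational part of the order k difference is an integer. What is
    left is (K - ks) * c * q ^ k, which dominates the error of order N ^ -k as soon as |K - ks| * N
    ^ k is large. *)
Lemma weyl_sum_rational_far (ks eps : R) (p : int) (q : nat) : 0 < ks -> (0 < q)%N ->
  q%:R * (ks * c) = p%:~R -> 0 < eps ->
  exists rho B2 : R, [/\ 0 < rho, 0 < B2 & exists N0 : nat, forall (K : R) (N : nat),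
    `|K - ks| < rho -> (N0 <= N)%N -> B2 <= `|K - ks| * N%:R ^+ k -> 0 < K ->
    cabs (weyl_sum (F 0%N) K N) <= eps * N%:R].
Proof.
move=> ks0 q0 qp eps0; have c0' := c0; have A0' := A0; have x01' := x01.
pose e := Num.min eps 1.
have e0 : 0 < e by rewrite lt_min eps0 ltr01.
have e1 : e <= 1 by rewrite ge_min lexx orbT.
have ee : e <= eps by rewrite ge_min lexx.
clearbody e.
have qR : 0 < q%:R :> R by rewrite ltr0n.
have qk0 : 0 < q%:R ^+ k :> R by rewrite exprn_gt0.
have three : 1 <= 3 :> R by rewrite ler1n.
have e20 : 0 < e / 2 by rewrite divr_gt0.
have [dT dT0 hT] := @derivative_testP R k k0 (e / 2) 3 e20 three.
pose rho := Num.min 1 (2 * dT / (c * q%:R ^+ k)).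
have rho0 : 0 < rho by rewrite lt_min ltr01 divr_gt0 // mulr_gt0.
(* [B2a] makes K times the error in F k at most half of the main term; [B2b] brings lam * L ^ k
   above 1 / dT. *)
pose B2a := 2 * (ks + 1) * A / (c * (e / 8) ^+ k).
pose B2b := 2 * 4 ^+ k / (c * dT).
have B2a0 : 0 <= B2a by rewrite /B2a; positivity.
have B2b0 : 0 <= B2b by rewrite /B2b; positivity.
have B20 : 0 < B2a + B2b + 1 by lra.
exists rho, (B2a + B2b + 1); split => //.
have [N1 hN1] := nat_ge_exists (8 * q%:R / e + 8 * x0 / e).
exists N1 => K N hK NN hB K0.
have {NN} := hN1 N NN => {N1 hN1} hN.
have x00 : 0 < x0 by apply: lt_le_trans x01.
have z1 : 0 < 8 * q%:R / e by positivity.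
have z2 : 0 < 8 * x0 / e by positivity.
have N8q : 8 * q%:R <= e * N%:R by rewrite [leRHS]mulrC -ler_pdivrMr //; lra.
have N8x : 8 * x0 <= e * N%:R by rewrite [leRHS]mulrC -ler_pdivrMr //; lra.
have N0 : 0 < N%:R :> R by lra.
have eN : e * N%:R <= N%:R by rewrite ler_piMl // ltW.
set tau := K - ks in hK hB *.
have tau1 : `|tau| < 1 by apply: (lt_le_trans hK); rewrite ge_min lexx.
have tau2 : `|tau| < 2 * dT / (c * q%:R ^+ k) by apply: (lt_le_trans hK); rewrite ge_min lexx orbT.
have Nk0 : 0 < N%:R ^+ k :> R by rewrite exprn_gt0.
have tau0 : 0 < `|tau|.
  rewrite -(pmulr_lgt0 _ Nk0); lra.
(* The first q * m1 terms, about e N / 8, are discarded, so that the decay of F k - c is used only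
   at arguments comparable with N. *)
pose m1 := (Num.truncn (e * N%:R / (8 * q%:R))).+1.
have m1l : e * N%:R / (8 * q%:R) <= m1%:R by apply/ltW/truncnS_gt.
have m1u : m1%:R <= e * N%:R / (8 * q%:R) + 1.
  by rewrite /m1 -natr1 lerD2r truncn_le //; positivity.
clearbody m1.
pose m2 := (N %/ q)%N.
have Nq : (N = q * m2 + N %% q)%N by rewrite mulnC; exact: divn_eq.
have rq : (N %% q < q)%N by rewrite ltn_mod.
set r' := (N %% q)%N in Nq rq.
have NqR : N%:R = q%:R * m2%:R + r'%:R :> R by rewrite {1}Nq natrD natrM.
clearbody m2 r'.
have r'R : r'%:R <= q%:R :> R by rewrite ler_nat ltnW.
have r'0 : 0 <= r'%:R :> R by [].
have qm1l : e * N%:R / 8 <= q%:R * m1%:R.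
  have : e * N%:R / (8 * q%:R) * q%:R <= m1%:R * q%:R by rewrite ler_pM2r.
  have -> : e * N%:R / (8 * q%:R) * q%:R = e * N%:R / 8 by field; rewrite gt_eqF.
  lra.
have qm1u : q%:R * m1%:R <= e * N%:R / 8 + q%:R.
  have : m1%:R * q%:R <= (e * N%:R / (8 * q%:R) + 1) * q%:R by rewrite ler_pM2r.
  have -> : (e * N%:R / (8 * q%:R) + 1) * q%:R = e * N%:R / 8 + q%:R by field; rewrite gt_eqF.
  lra.
have m12 : (m1 <= m2)%N by rewrite -(ler_nat R) -(ler_pM2l qR); lra.
pose L := (m2 - m1)%N.
have LR : L%:R = m2%:R - m1%:R :> R by rewrite natrB.
have qL : N%:R / 4 <= q%:R * L%:R :> R by rewrite LR mulrBr; lra.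
have qLu : q%:R * L%:R <= N%:R :> R.
  have m10 : 0 <= q%:R * m1%:R :> R by rewrite mulr_ge0.
  by rewrite LR mulrBr; lra.
have NE : (N = q * m1 + q * L + r')%N by rewrite Nq -mulnDr subnKC.
have B2lea : B2a <= `|tau| * N%:R ^+ k by apply: le_trans hB; rewrite -addrA lerDl; lra.
have B2leb : B2b <= `|tau| * N%:R ^+ k by apply: le_trans hB; rewrite addrAC lerDr; lra.
have w0 : 0 < 4 ^+ k :> R by rewrite exprn_gt0.
have lamd : `|tau| * c * q%:R ^+ k / 2 <= dT.
  move: (ltW tau2); rewrite ler_pdivlMr ?mulr_gt0 // => h.
  by rewrite ler_pdivrMr // [leRHS]mulrC -mulrA.
have lamL : dT^-1 <= `|tau| * c * q%:R ^+ k / 2 * L%:R ^+ k.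
  have -> : `|tau| * c * q%:R ^+ k / 2 * L%:R ^+ k = `|tau| * c / 2 * (q%:R * L%:R) ^+ k.
    by rewrite exprMn; ring.
  have h2 : (N%:R / 4) ^+ k <= (q%:R * L%:R) ^+ k :> R.
    by rewrite lerXn2r // nnegrE; positivity.
  have tc0 : 0 < `|tau| * c / 2 by positivity.
  apply: (@le_trans _ _ (`|tau| * c / 2 * (N%:R / 4) ^+ k)); last by rewrite ler_pM2l.
  move: B2leb; rewrite /B2b ler_pdivrMr ?mulr_gt0 // => B2leb.
  rewrite (expr_div_n N%:R 4 k) -[leLHS]mul1r ler_pdivrMr // mulrA mulrAC ler_pdivlMr // mul1r.
  rewrite -(@ler_pM2l _ 2) //; apply: (le_trans B2leb).
  by rewrite le_eqVlt; apply/orP; left; apply/eqP; field.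
pose E := A / ((e / 8) ^+ k * N%:R ^+ k).
have ek0 : 0 < (e / 8) ^+ k by rewrite exprn_gt0 // divr_gt0.
have E0 : 0 <= E by apply: divr_ge0 => //; apply: mulr_ge0; exact: ltW.
have KE : K * E <= `|tau| * c / 2.
  have Kks : K <= ks + 1.
    rewrite -(subrK ks K) -/tau [leRHS]addrC lerD2r.
    exact: le_trans (ler_norm tau) (ltW tau1).
  apply: (@le_trans _ _ ((ks + 1) * E)); first by rewrite ler_wpM2r.
  move: B2lea; rewrite /B2a ler_pdivrMr ?mulr_gt0 // => B2lea.
  rewrite /E mulrA ler_pdivrMr ?mulr_gt0 // -(@ler_pM2l _ 2) //.
  rewrite (mulrA 2) (mulrA 2); apply: (le_trans B2lea).
  by rewrite le_eqVlt; apply/orP; left; apply/eqP; field.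
have main r : (r < q)%N ->
    cabs (\sum_(0 <= j < L) cis (K * F 0%N (q * m1 + (q * j + r))%N%:R)) <= e / 2 * L%:R.
  move=> rq'; pose a : R := q%:R * m1%:R + r%:R.
  have ax : q%:R * m1%:R <= a by rewrite /a lerDl.
  have aN : e * N%:R / 8 <= a by apply: le_trans ax.
  have xa : x0 <= a.
    by apply: le_trans aN; rewrite ler_pdivlMr // mulrC.
  have a0 : 0 < a by exact: lt_le_trans x00 xa.
  have hE : A / a ^+ k <= E.
    have h8 : 0 < e / 8 by rewrite divr_gt0.
    apply: ler_wpM2l => //; rewrite lef_pV2 ?posrE ?mulr_gt0 ?exprn_gt0 //.
    rewrite -exprMn; apply: lerXn2r; [by rewrite nnegrE; positivity | by rewrite nnegrE; exact: ltW |].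
    by rewrite mulrAC.
  have -> : \sum_(0 <= j < L) cis (K * F 0%N (q * m1 + (q * j + r))%N%:R) =
     \sum_(0 <= j < L) cis (K * F 0%N (a + q%:R * j%:R)).
    apply: eq_bigr => j _; congr (cis (_ * F _ _)).
    by rewrite /a !natrD !natrM; ring.
  exact: (@residue_class_sum K ks a E (e / 2) dT p q L hT q0 qp K0 xa E0 (fun y hy => decay_le a0 hy hE) KE).
have -> : weyl_sum (F 0%N) K N = \sum_(0 <= n < q * m1) cis (K * F 0%N n%:R) +
   \sum_(0 <= n < q * L) cis (K * F 0%N (q * m1 + n)%N%:R) +
   \sum_(0 <= n < r') cis (K * F 0%N (q * m1 + q * L + n)%N%:R).
  rewrite /weyl_sum /expsum {1}NE (@big_cat_nat _ _ _ (q * m1 + q * L)) //=; last exact: leq_addr.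
  rewrite (@big_cat_nat _ _ _ (q * m1)) //=; last exact: leq_addr.
  congr (_ + _ + _); rewrite -{1}[X in \sum_(X <= _ < _) _]add0n big_addn addKn;
    by apply: eq_bigr => i _; rewrite addnC.
apply: le_trans (cabsD _ _) _; apply: le_trans (lerD (cabsD _ _) (lexx _)) _.
have b1 := cabs_sum_cis_le (fun n => K * F 0%N n%:R) 0 (q * m1).
have b3 := cabs_sum_cis_le (fun n => K * F 0%N (q * m1 + q * L + n)%N%:R) 0 r'.
rewrite !subn0 natrM in b1 b3.
have b2 : cabs (\sum_(0 <= n < q * L) cis (K * F 0%N (q * m1 + n)%N%:R)) <= e / 2 * (q%:R * L%:R).
  rewrite sum_residues; apply: le_trans (cabs_sum _ _ _) _.
  apply: (@le_trans _ _ (\sum_(0 <= r < q) e / 2 * L%:R)); last first.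
    by rewrite big_const_nat iter_addr_0 subn0 -[leLHS]mulr_natl mulrCA.
  by rewrite !big_nat; apply: ler_sum => r /andP[_ rq']; exact: main.
have b2' : e / 2 * (q%:R * L%:R) <= e / 2 * N%:R by rewrite ler_pM2l.
have : e * N%:R <= eps * N%:R by rewrite ler_pM2r.
lra.
Qed.

(** Partial summation against e((K - ks) * alpha), whose variation is at most 16 |K - ks| times that
    of alpha. The latter is O(N ^ k), so the bound at [ks] carries over while |K - ks| * N ^ k stays
    bounded. *)
Lemma weyl_sum_near (ks eps B2 : R) : 0 < ks -> 0 < eps -> 0 <= B2 -> 
  (forall e : R, 0 < e -> exists N0 : nat, forall N : nat, (N0 <= N)%N ->
     cabs (weyl_sum (F 0%N) ks N) <= e * N%:R) ->
  exists N0 : nat, forall (K : R) (N : nat), `|K - ks| <= 1 -> (N0 <= N)%N ->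
    `|K - ks| * N%:R ^+ k <= B2 -> cabs (weyl_sum (F 0%N) K N) <= eps * N%:R.
Proof.
move=> ks0 eps0 B20 hW.
pose al n := F 0%N n%:R.
have [n0 hn0] := nat_ge_exists x0.
pose D0 := \sum_(0 <= n < n0) `|al n.+1 - al n| + `|al n0|.
have D00 : 0 <= D0 by rewrite addr_ge0 // sumr_ge0.
have A20 : 0 <= A2.
  have x01' := x01.
  have := hA (lexx x0); have : 0 < x0 ^+ k by rewrite exprn_gt0 // (lt_le_trans _ x01).
  by move=> xk h; have := le_trans (normr_ge0 _) h; rewrite pmulr_lge0.
(* [V] bounds the last modulus plus the total variation; [D0] accounts for the initial segment,
   where alpha need not be monotone. *)
pose V := 1 + 16 * (D0 + A2 * B2).
have V0 : 0 < V by rewrite /V ltr_pwDl // mulr_ge0 // addr_ge0 // mulr_ge0.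
have eV : 0 < eps / V by rewrite divr_gt0.
have [n3 hn3] := hW _ eV.
have [n4 hn4] := nat_ge_exists (n3%:R / (eps / V)).
exists (maxn (maxn n3 n4) (n0.+1)) => K [_|L].
  by rewrite !geq_max ltn0 andbF.
rewrite !geq_max => K1 /andP[/andP[l3 l4] l0] hB.
set N := L.+1 in l3 l4 hB *.
set tau := K - ks in K1 hB.
have n3e : n3%:R <= eps / V * N%:R by have := hn4 N l4; rewrite ler_pdivrMr // mulrC.
have -> : weyl_sum (F 0%N) K N = \sum_(0 <= n < N) cis (tau * al n) * cis (ks * al n).
  by apply: eq_bigr => n _; rewrite -cisD -mulrDl /tau subrK.
apply: le_trans (@abel_bound _ _ _ L (eps / V * N%:R) _) _.
  move=> n nN; rewrite -/(expsum (fun i => ks * al i) n) -/(weyl_sum (F 0%N) ks n).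
  have [nn3|n3n] := leqP n n3.
    by apply: le_trans (cabs_weyl_sum_le _ _ _) _; apply: le_trans n3e; rewrite ler_nat.
  by apply: le_trans (hn3 n (ltnW n3n)) _; rewrite ler_pM2l // ler_nat.
set X := (_ + _); suff XV : X <= V.
  have eN : 0 <= eps / V * N%:R by positivity.
  apply: le_trans (ler_wpM2l eN XV) _.
  by rewrite le_eqVlt; apply/orP; left; apply/eqP; field; rewrite gt_eqF.
rewrite /X cabs_cis /V lerD2l.
apply: (@le_trans _ _ (\sum_(0 <= n < L) 16 * (`|tau| * `|al n.+1 - al n|))).
  apply: ler_sum => n _; apply: le_trans (cis_lip _ _) _.
  by rewrite -mulrBr normrM.
rewrite -mulr_sumr ler_pM2l // -mulr_sumr.
have tv : \sum_(0 <= n < L) `|al n.+1 - al n| <= D0 + A2 * N%:R ^+ k.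
  have n0L : (n0 <= L)%N by [].
  rewrite (@big_cat_nat _ _ _ n0) //= /D0 -addrA lerD2l.
  have -> : \sum_(n0 <= n < L) `|al n.+1 - al n| = \sum_(n0 <= n < L) (al n.+1 - al n).
    apply: eq_big_nat => n /andP[n0n _]; rewrite ger0_norm // subr_ge0 /al hinc //.
      exact: hn0.
    by rewrite ler_nat.
  rewrite telescope_sumr //.
  have hL : al L <= A2 * N%:R ^+ k.
    apply: (@le_trans _ _ (al N)).
      by apply: hinc; [exact: hn0 | rewrite ler_nat].
    by apply: le_trans (ler_norm _) (hA _); apply: hn0; exact: leq_trans n0L (leqnSn L).
  by have := ler_norm (- al n0); rewrite normrN; lra.
apply: le_trans (ler_wpM2l (normr_ge0 tau) tv) _; rewrite mulrDr.
apply: lerD; first by rewrite ler_piMl.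
by rewrite mulrCA ler_wpM2l.
Qed.

End LimitCase.

(** * Uniform Weyl sums of a sub-polynomial *)

Section UniformLimit.
Context {R : realType}.
Variables (F : nat -> R -> R) (k p : nat) (x0 c A A2 : R).
Hypotheses (k0 : (0 < k)%N) (x01 : 1 <= x0) (hF : derivative_family F k x0).
Hypothesis hm : (forall x y, x0 <= x -> x <= y -> F k x <= F k y) \/
  (forall x y, x0 <= x -> x <= y -> F k y <= F k x).
Hypotheses (c0 : 0 < c) (A0 : 0 <= A) (hc : forall x, x0 <= x -> `|F k x - c| <= A / x ^+ k).
Hypotheses (hA : forall x, x0 <= x -> `|F 0%N x| <= A2 * x ^+ k)
  (hinc : forall x y, x0 <= x -> x <= y -> F 0%N x <= F 0%N y).
Hypothesis hreg : poly_regular (F k) p x0.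
Hypothesis hW : forall ks e : R, 0 < ks -> 0 < e -> exists N0 : nat, forall N : nat, (N0 <= N)%N ->
  cabs (weyl_sum (F 0%N) ks N) <= e * N%:R.

(** For rational ks * c the constant [B2] separates the range of the derivative test from that of
    partial summation, so each pair of [K] and [N] falls under one of the two. *)
Lemma weyl_sum_locally_uniform (ks eps : R) : 0 < ks -> 0 < eps ->
  exists2 rho : R, 0 < rho & exists N0 : nat, forall (K : R) (N : nat), `|K - ks| < rho -> (N0 <= N)%N ->
    0 < K -> cabs (weyl_sum (F 0%N) K N) <= eps * N%:R.
Proof.
move=> ks0 eps0; have [irr|rat] := pselect (irrational_num (ks * c)).
  have [rho rho0 [N0 h]] := weyl_sum_irrational k0 x01 hF c0 A0 hc ks0 irr eps0.
  by exists rho => //; exists N0 => K N h1 h2 _; exact: h.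
have [q [pp [q0 qp]]] : exists (q : nat) (pp : int), (0 < q)%N /\ q%:R * (ks * c) = pp%:~R.
  apply: contrapT => h; apply: rat => q pp q0; apply/negP => /eqP E; apply: h.
  by exists q, pp.
have [rho [B2 [rho0 B20 [N1 h1]]]] := weyl_sum_rational_far k0 x01 hF hm c0 A0 hc ks0 q0 qp eps0.
have [N2 h2] := weyl_sum_near x01 hA hinc ks0 eps0 (ltW B20) (fun e e0 => hW ks0 e0).
exists (Num.min rho 1); first by rewrite lt_min rho0 ltr01.
exists (maxn N1 N2) => K N; rewrite lt_min geq_max => /andP[r1 r2] /andP[n1 n2] K0.
have [hB|hB] := leP B2 (`|K - ks| * N%:R ^+ k); first exact: h1.
by apply: h2 => //; exact: ltW.
Qed.

Lemma weyl_sum_uniform_compact (k1 k2 eps : R) : 0 < k1 -> 0 < eps ->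
  exists N0 : nat, forall (N : nat) (K : R), (N0 <= N)%N -> k1 <= K <= k2 ->
    cabs (weyl_sum (F 0%N) K N) <= eps * N%:R.
Proof.
move=> k10 eps0.
have /compact_near_coveringP cov := @segment_compact R k1 k2.
have := cov nat \oo (fun N K => 0 < K -> cabs (weyl_sum (F 0%N) K N) <= eps * N%:R) _.
case=> [ks /=|N0 _ h].
  rewrite in_itv /= => /andP[k1ks _].
  have ks0 : 0 < ks by exact: lt_le_trans k1ks.
  have [rho rho0 [N0 h]] := weyl_sum_locally_uniform ks0 eps0.
  exists ([set K | `|K - ks| < rho], [set N | (N0 <= N)%N]).
    split => /=; last by exists N0.
    by apply/nbhs_ballP; exists rho => // K /=; rewrite /ball /= distrC.
  by move=> [K N] /= [h1 h2]; apply: h.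
exists N0 => N K NN /andP[h1 h2]; apply: (h N NN K); last exact: lt_le_trans h1.
by rewrite /= in_itv /= h1.
Qed.

Lemma uniform_weyl_limit (eps K : R) : 0 < eps -> 0 < K ->
  exists (B : R) (N0 : nat), forall (N : nat) (ka : R), (N0 <= N)%N -> 0 < ka -> ka <= K ->
    B <= ka * F 0%N N%:R -> cabs (weyl_sum (F 0%N) ka N) <= eps * N%:R.
Proof.
move=> eps0 K0; have [del del0 [N1 h1]] := block_test k0 eps0 hF hreg hm.
have c0' := c0; have A0' := A0; have x01' := x01.
have cA : 0 < c + A by lra.
have kk : 0 < del / (c + A) by rewrite divr_gt0.
have [N2 h2] := weyl_sum_uniform_compact K kk eps0.
have A20 : 0 <= A2.
  have := hA (lexx x0); have : 0 < x0 ^+ k by rewrite exprn_gt0 // (lt_le_trans _ x01).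
  by move=> xk h; have := le_trans (normr_ge0 _) h; rewrite pmulr_lge0.
have [N3 h3] := nat_ge_exists (x0 + 2 * A / c).
(* Since alpha N <= (A2 + 1) N ^ k and F k N >= c / 2, a lower bound on ka * alpha N becomes the
   condition of the derivative test on ka * F k N * N ^ k. *)
exists (2 * (A2 + 1) / (c * del)), (maxn (maxn N1 N2) N3) => N ka.
rewrite !geq_max => /andP[/andP[n1 n2] n3] ka0 kaK hB.
have [kl|kg] := leP ka (del / (c + A)); last by apply: h2; rewrite // (ltW kg).
have {}h3 := h3 N n3.
have Ac : 0 <= 2 * A / c by positivity.
have Nx : x0 <= N%:R by lra.
have N1' : 1 <= N%:R :> R by lra.
have Nk : N%:R <= N%:R ^+ k :> R by rewrite -(prednK k0) exprS ler_peMr // exprn_ege1.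
have Nk0 : 0 < N%:R ^+ k :> R by rewrite exprn_gt0 //; lra.
have := hc Nx; rewrite ler_norml => /andP[l1 l2].
have AN : A / N%:R ^+ k <= A by rewrite ler_pdivrMr // ler_peMr // exprn_ege1.
have Ac2 : A / N%:R ^+ k <= c / 2.
  rewrite ler_pdivrMr //; have : 2 * A / c <= N%:R ^+ k by lra.
  by rewrite ler_pdivrMr //; lra.
apply: h1 => //.
  apply: (@le_trans _ _ (ka * (c + A))); first by rewrite ler_pM2l //; lra.
  by rewrite -ler_pdivlMr.
have hh : c / 2 <= F k N%:R by lra.
apply: (@le_trans _ _ (ka * (c / 2) * N%:R ^+ k)); last first.
  by rewrite ler_pM2r // ler_pM2l.
have a2 : F 0%N N%:R <= (A2 + 1) * N%:R ^+ k.
  apply: le_trans (ler_norm _) (le_trans (hA Nx) _); rewrite ler_pM2r //; lra.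
have A21 : 0 < A2 + 1 by lra.
have B' : 2 * (A2 + 1) / (c * del) <= ka * ((A2 + 1) * N%:R ^+ k).
  by apply: (le_trans hB); rewrite ler_pM2l.
have E1 : ka * (c / 2) * N%:R ^+ k = c / (2 * (A2 + 1)) * (ka * ((A2 + 1) * N%:R ^+ k)).
  by field; rewrite gt_eqF.
have E2 : del^-1 = c / (2 * (A2 + 1)) * (2 * (A2 + 1) / (c * del)).
  by field; rewrite !gt_eqF.
by rewrite E1 E2 ler_pM2l // divr_gt0 // mulr_gt0.
Qed.
End UniformLimit.

(** * Growth of alpha and of its derivatives *)

Section Structure.
Context {R : realType}.
Variables (H : set (R -> R)) (alpha : R -> R).
Hypotheses (hH : hardy_field H) (Ha : H alpha).
Hypothesis alpha_gt0 : forall x : R, 1 <= x -> 0 < alpha x.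
Hypothesis alpha_ud : forall kappa : R, 0 < kappa ->
  uniformly_distributed_mod1 (fun n : nat => kappa * alpha n%:R).
Hypothesis alpha_subpoly : exists2 l : R, 0 < l & alpha x / x `^ l @[x --> +oo] --> (0 : R).

Definition deriv_iter i : R -> R := iter i (fun f : R -> R => derive1 f) alpha.
Local Notation F := deriv_iter.

Lemma deriv_iter_hardy i : H (F i).
Proof. elim: i => [|i IH]; [exact: Ha | exact: (hardy_derive hH IH)]. Qed.

Lemma deriv_iter_is_derive i : ev (fun x => is_derive x 1 (F i) (F i.+1 x)).
Proof. exact: (hardy_is_derive hH (deriv_iter_hardy i)). Qed.

Lemma deriv_iter_family m : ev (fun x => forall i, (i < m)%N -> is_derive x 1 (F i) (F i.+1 x)).
Proof.
elim: m => [|m IH]; first exact: evT.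
apply: evS (evI IH (deriv_iter_is_derive m)) => x [h1 h2] i.
by rewrite ltnS leq_eqVlt => /orP[/eqP ->|/h1].
Qed.

(** If alpha were at most D on the positive integers, alpha / (4 D) would stay in (0, 1/4] there and
    never visit [1/2, 1). *)
Lemma alpha_unbounded (B : R) : exists2 n : nat, (0 < n)%N & B < alpha n%:R.
Proof.
apply: contrapT => h.
have hB n : (0 < n)%N -> alpha n%:R <= B.
  by move=> n0; rewrite leNgt; apply/negP => hn; apply: h; exists n.
pose D := Num.max B 1.
have D0 : 0 < D by rewrite lt_max ltr01 orbT.
have ka : 0 < (4 * D)^-1 by rewrite invr_gt0 mulr_gt0.
have half1 : (0 : R) <= 1 / 2 by [].
have half2 : 1 / 2 < 1 :> R by lra.
have := alpha_ud ka half1 half2 (lexx 1).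
have -> : (fun N => (count (fun n => 1 / 2 <= frac_part ((4 * D)^-1 * alpha n%:R) < 1) (iota 1 N))%:R / N%:R) = (fun=> 0 : R).
  apply/funext => N.
  rewrite (_ : count _ _ = 0%N) ?mul0r //; apply/eqP; rewrite -leqn0 leqNgt -has_count.
  apply/hasPn => n; rewrite mem_iota => /andP[n0 _].
  have a0 : 0 < alpha n%:R by apply: alpha_gt0; rewrite ler1n.
  have aD : alpha n%:R <= D by rewrite le_max hB.
  set y := (4 * D)^-1 * alpha n%:R; have y0 : 0 < y by rewrite mulr_gt0.
  have y1 : y <= 1 / 4 by rewrite /y mulrC ler_pdivrMr ?mulr_gt0 //; lra.
  have fl : Num.floor y = 0.
    by apply: floor_def; rewrite add0r; apply/andP; split; [exact: ltW | lra].
  rewrite /frac_part fl subr0 negb_and -ltNge; apply/orP; left; lra.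
move=> /(cvg_lim (@Rhausdorff R)); rewrite lim_cst //; lra.
Qed.

Lemma alpha_infty (B : R) : ev (fun x => B <= alpha x).
Proof.
have [x1 mono] := hardy_mono hH Ha.
have [n1 hn1] := nat_ge_exists x1.
have bound (D : R) : exists2 n : nat, (n1 <= n)%N & D < alpha n%:R.
  have [n n0 hn] := alpha_unbounded (`|D| + \sum_(0 <= i < n1) `|alpha i%:R|).
  exists n.
    rewrite leqNgt; apply/negP => nn1.
    have : alpha n%:R <= \sum_(0 <= i < n1) `|alpha i%:R|.
      rewrite (@big_cat_nat _ _ _ n) //=; last exact: ltnW.
      rewrite [X in _ + X]big_ltn //=; apply: le_trans (ler_norm _) _.
      rewrite addrCA lerDl addr_ge0 // sumr_ge0 //.
    by have := normr_ge0 D; lra.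
  apply: le_lt_trans hn; apply: le_trans (ler_norm _) _.
  by rewrite lerDl sumr_ge0.
case: mono => mono.
  have [n n1n hn] := bound B; exists n%:R => x nx.
  by apply: le_trans (ltW hn) _; apply: mono => //; exact: hn1.
have [n n1n hn] := bound (alpha n1%:R); exfalso.
have := mono n1%:R n%:R (hn1 n1 (leqnn _)); rewrite ler_nat => /(_ n1n).
by rewrite leNgt hn.
Qed.

Lemma alpha_nondecreasing : exists x1, forall x y, x1 <= x -> x <= y -> alpha x <= alpha y.
Proof.
have [x1 [mono|mono]] := hardy_mono hH Ha; first by exists x1.
exfalso; have [x2 x12 h] := ev_from x1 (alpha_infty (alpha x1 + 1)).
have := h x2 (lexx x2); have := mono x1 x2 (lexx _) x12; lra.
Qed.

Lemma alpha_le_poly : exists n, ev (fun x => alpha x <= x ^+ n).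
Proof.
have [l l0 hl] := alpha_subpoly.
have [n hn] := nat_ge_exists l; exists n.
move/cvgrPdist_le : hl => /(_ 1 ltr01) /evP hl.
apply: evS (evI hl (ev_ge 1)) => x [h1 x1].
have x0 : 0 < x by exact: lt_le_trans x1.
have pl : 0 < x `^ l by rewrite powR_gt0.
move: h1; rewrite sub0r normrN normrM normfV (gtr0_norm pl) ler_pdivrMr // mul1r => h1.
apply: le_trans (ler_norm _) (le_trans h1 _).
rewrite -powR_mulrn; last exact: ltW.
by apply: ler_powR => //; exact: hn.
Qed.

(** A derivative staying below a negative constant would, integrated m times, make alpha
    negative. *)
Lemma deriv_iter_pos m : ~ to0 (F m) -> exists2 c : R, 0 < c & ev (fun x => c <= F m x).
Proof.
move=> nt; have [c c0 [h|h]] := hardy_not_to0 hH (deriv_iter_hardy m) nt; first by exists c.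
exfalso.
have hN i : ev (fun x => is_derive x 1 (fun y => - F i y) (- F i.+1 x)).
  by apply: evS (deriv_iter_is_derive i) => x hx; exact: is_deriveN.
have hc : ev (fun x => c * x ^+ 0 <= - F m x).
  by apply: evS h => x; rewrite expr0 mulr1 lerNr.
have [c' c'0 hc'] := @ev_growth R (fun i x => - F i x) m 0 c hN c0 hc.
apply: (ev_contra hc' (ev_ge 1)) => x hx x1.
have : 0 < c' * x ^+ (m + 0) by rewrite mulr_gt0 // exprn_gt0 // (lt_le_trans _ x1).
have := alpha_gt0 x1; rewrite /= in hx; lra.
Qed.

Lemma deriv_iter_growth m j (c : R) : 0 < c -> ev (fun x => c * x ^+ j <= F m x) ->
  forall i, (i <= m)%N -> exists2 c' : R, 0 < c' & ev (fun x => c' * x ^+ (m - i + j) <= F i x).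
Proof.
move=> c0 hc i im.
have := @ev_growth R (fun n x => F (n + i)%N x) (m - i) j c _ c0.
rewrite subnK //= add0n; apply => // n; exact: deriv_iter_is_derive.
Qed.

(** Some derivative tends to 0: otherwise the one of order n + 1 would force growth x ^ (n + 1)
    against alpha <= x ^ n. The least such order is positive because alpha tends to infinity. *)
Lemma exists_degree : exists k, [/\ to0 (F k.+1), ~ to0 (F k) & exists2 c : R, 0 < c & ev (fun x => c <= F k x)].
Proof.
have [n hn] := alpha_le_poly.
have ex : exists m, `[< to0 (F m) >].
  exists n.+1; apply/asboolP; apply: contrapT => /deriv_iter_pos[c c0 hc].
  have hc' : ev (fun x => c * x ^+ 0 <= F n.+1 x) by apply: evS hc => x; rewrite expr0 mulr1.
  have [c' c'0] := deriv_iter_growth c0 hc' (leq0n _).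
  rewrite subn0 addn0 => hg.
  apply: (ev_contra (evI hg hn) (ev_ge (c'^-1 + 1))) => x [h1 h2] hx.
  have ci : 0 < c'^-1 by rewrite invr_gt0.
  have x0 : 0 < x by lra.
  have := le_trans h1 h2; rewrite exprS mulrA ger_pMl ?exprn_gt0 // => h3.
  have : c' * (c'^-1 + 1) <= 1 by apply: le_trans h3; rewrite ler_pM2l.
  by rewrite mulrDr mulfV ?gt_eqF //; lra.
case: (ex_minnP ex) => m /asboolP hm hmin.
case: m hm hmin => [|k] hm hmin.
  exfalso; apply: (ev_contra (hm 1 ltr01) (alpha_infty 1)) => x /= h1 h2.
  have := le_lt_trans (ler_norm _) h1; lra.
have nk : ~ to0 (F k).
  by move=> /asboolP /hmin; rewrite ltnn.
by exists k; split => //; exact: deriv_iter_pos.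
Qed.

(** Otherwise f ^ 2 / x would be nonincreasing, although it is at least c ^ 2 * x. *)
Lemma le_mul_derive f (c : R) : H f -> 0 < c -> ev (fun x => c * x <= f x) ->
  ev (fun x => f x <= 2 * x * derive1 f x).
Proof.
move=> hf c0 hc.
have [h|h] := hardy_affine_sign hH (hardyN hH hf) (hardyM hH (hardy_nat hH 2) (hardy_derive hH hf)).
  by apply: evS h => x; rewrite addrC subr_ge0 mulrA [x * 2]mulrC.
exfalso.
have [x0 x01 hx] := ev_from 1 (evI (hardy_is_derive hH hf) (evI h hc)).
have pos x : x0 <= x -> 0 < x by move=> x0x; apply: lt_le_trans ltr01 (le_trans x01 x0x).
have mono : forall x y, x0 <= x -> x <= y -> f y * f y / y ^+ 1 <= f x * f x / x ^+ 1.
  apply: (@nonincreasing_of_derive R (fun x => f x * f x / x ^+ 1)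
    (fun x => (x * (2 * f x * derive1 f x) - 1%:R * (f x * f x)) / x ^+ 2)) => x x0x.
    apply: is_derive_divXn; first exact: pos.
    have [h1 _] := hx x x0x.
    apply: is_derive_eq; rewrite /GRing.scale /=; ring.
  have [_ [h1 h2]] := hx x x0x; have xp := pos _ x0x.
  have fp : 0 <= f x by apply: le_trans h2; rewrite mulr_ge0 // ltW.
  rewrite mulr_le0_ge0 ?invr_ge0 ?exprn_ge0 //; last exact: ltW.
  have -> : x * (2 * f x * derive1 f x) - 1%:R * (f x * f x) = f x * (- f x + x * (2%:R * derive1 f x)) by ring.
  exact: mulr_ge0_le0.
set C := f x0 * f x0 / x0 ^+ 1 in mono.
pose y := Num.max x0 (C / (c * c) + 1).
have y0 : x0 <= y by rewrite le_max lexx.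
have yC : C / (c * c) + 1 <= y by rewrite le_max lexx orbT.
have := mono _ _ (lexx x0) y0; rewrite -/C => h1.
have [_ [_ h2]] := hx y y0; have yp := pos _ y0.
have cy : 0 <= c * y by rewrite mulr_ge0 // ltW.
have h3 : c * y * (c * y) <= f y * f y by apply: ler_pM.
move: h1; rewrite expr1 ler_pdivrMr // => h1.
have h4 : c * c * y <= C.
  rewrite -(ler_pM2r yp); lra.
have h5 : c * c * (C / (c * c) + 1) <= C by apply: le_trans h4; rewrite ler_pM2l // mulr_gt0.
have E : c * c * (C / (c * c) + 1) = C + c * c by field; rewrite gt_eqF.
have : 0 < c * c by rewrite mulr_gt0.
lra.
Qed.

(** All derivatives of order below [k] grow at least linearly, so [le_mul_derive] applies [k] times,
    each time at the cost of a factor 2 x. *)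
Lemma le_degree_deriv k : (exists2 c : R, 0 < c & ev (fun x => c <= F k x)) ->
  ev (fun x => alpha x <= 2 ^+ k * x ^+ k * F k x).
Proof.
move=> [c c0 hc].
have hc' : ev (fun x => c * x ^+ 0 <= F k x) by apply: evS hc => x; rewrite expr0 mulr1.
suff main i : (i <= k)%N -> ev (fun x => F (k - i) x <= 2 ^+ i * x ^+ i * F k x).
  by have := main k (leqnn k); rewrite subnn.
elim: i => [|i IH] ik; first by apply: evT => x; rewrite subn0 !expr0 !mul1r.
have ki : (k - i.+1 <= k)%N by exact: leq_subr.
have kE : (k - i = (k - i.+1).+1)%N by rewrite -subSn // subSS.
have [c' c'0] := deriv_iter_growth c0 hc' ki.
rewrite subKn // addn0 => hg.
have h1 : ev (fun x => c' * x <= F (k - i.+1) x).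
  apply: evS (evI hg (ev_ge 1)) => x [h x1]; apply: le_trans h; rewrite ler_pM2l // exprS.
  by rewrite ler_peMr ?exprn_ege1 // (le_trans _ x1).
have h2 := le_mul_derive (deriv_iter_hardy (k - i.+1)) c'0 h1.
apply: evS (evI (IH (ltnW ik)) (evI h2 (ev_ge 1))) => x [h3 [h4 x1]].
apply: (le_trans h4); rewrite -[derive1 _]/(F (k - i.+1).+1) -kE.
have x2 : 0 <= 2 * x by rewrite mulr_ge0 // (le_trans _ x1).
apply: le_trans (ler_wpM2l x2 h3) _; rewrite !exprS le_eqVlt; apply/orP; left; apply/eqP; ring.
Qed.

Lemma hardy_signed f (s : bool) : H f -> H (fun x => (-1) ^+ s * f x).
Proof.
move=> hf; case: s.
  rewrite (_ : (fun x => (-1) ^+ true * f x) = fun x => - f x); first exact: hardyN.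
  by apply/funext => x; rewrite expr1 mulN1r.
rewrite (_ : (fun x => (-1) ^+ false * f x) = f) //.
by apply/funext => x; rewrite expr0 mul1r.
Qed.

(** The Euler sign makes |F (k + 1)| x ^ (k + 1) monotone: it is bounded if nonincreasing, and it
    tends to infinity if nondecreasing and unbounded. *)
Lemma top_deriv_dichotomy k :
  (exists2 A : R, 0 <= A & ev (fun x => `|F k.+1 x| * x ^+ k.+1 <= A)) \/
  (exists s : bool, ev (fun x => 0 < (-1) ^+ s * F k.+1 x) /\
     forall B : R, ev (fun x => B <= (-1) ^+ s * F k.+1 x * x ^+ k.+1)).
Proof.
have [|nb] := pselect (exists2 A : R, 0 <= A & ev (fun x => `|F k.+1 x| * x ^+ k.+1 <= A)).
  by left.
right.
have [h|[s hs]] : ev (fun x => F k.+1 x = 0) \/ exists s : bool, ev (fun x => 0 < (-1) ^+ s * F k.+1 x).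
- case: (hardy_sign hH (deriv_iter_hardy k.+1)) => h; [by left | right; exists false | right; exists true];
    apply: evS h => x; by rewrite ?expr0 ?expr1 ?mul1r // mulN1r oppr_gt0.
- by exfalso; apply: nb; exists 0 => //; apply: evS h => x ->; rewrite normr0 mul0r.
exists s; split=> // B.
pose u x := (-1) ^+ s * F k.+1 x.
have hu : H u by exact: hardy_signed (deriv_iter_hardy k.+1).
have uE : ev (fun x => `|F k.+1 x| = u x).
  apply: evS hs => x hx; by rewrite /u -[RHS](gtr0_norm hx) normrM normrX normrN1 expr1n mul1r.
case: (hardy_euler_sign hH k.+1 hu) => hE.
  have [x0 x01 hx] := ev_from 1 (evI (hardy_is_derive hH hu) (evI hE uE)).
  have mono : forall x y, x0 <= x -> x <= y -> u x * x ^+ k.+1 <= u y * y ^+ k.+1.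
    apply: (@nondecreasing_of_derive R (fun x => u x * x ^+ k.+1)
       (fun x => x ^+ k * (x * derive1 u x + k.+1%:R * u x))) => x x0x; have [h1 [h2 _]] := hx x x0x.
      exact: is_derive_mulXn.
    by apply: mulr_ge0 h2; rewrite exprn_ge0 // (le_trans _ (le_trans x01 x0x)).
  have [x1 x1x0 hB] : exists2 x1, x0 <= x1 & B <= u x1 * x1 ^+ k.+1.
    apply: contrapT => h; apply: nb; exists `|B| => //; exists x0 => x x0x.
    have [_ [_ ->]] := hx x x0x; apply: le_trans (ler_norm B).
    by rewrite leNgt; apply/negP => /ltW hB; apply: h; exists x.
  by exists x1 => x x1x; apply: le_trans hB _; exact: mono.
exfalso; apply: nb.
have [x0 x01 hx] := ev_from 1 (evI (hardy_is_derive hH hu) (evI hE (evI uE hs))).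
have mono : forall x y, x0 <= x -> x <= y -> u y * y ^+ k.+1 <= u x * x ^+ k.+1.
  apply: (@nonincreasing_of_derive R (fun x => u x * x ^+ k.+1)
     (fun x => x ^+ k * (x * derive1 u x + k.+1%:R * u x))) => x x0x; have [h1 [h2 _]] := hx x x0x.
    exact: is_derive_mulXn.
  by apply: mulr_ge0_le0 h2; rewrite exprn_ge0 // (le_trans _ (le_trans x01 x0x)).
exists (u x0 * x0 ^+ k.+1).
  have [_ [_ [_ h]]] := hx x0 (lexx _).
  by apply: mulr_ge0; [exact: ltW | rewrite exprn_ge0 // (le_trans _ x01)].
exists x0 => x x0x; have [_ [_ [-> _]]] := hx x x0x; exact: mono.
Qed.

(* If [h] is unbounded then [x^2 h'] increases, so [h' t <= x^2 h' x / t^2] on [y, x], and integrating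
   gives [h x <= h y + x^2 h' x / y]. *)
Lemma degree_deriv_negligible k (s : bool) (rho : R) : (0 < k)%N -> 0 < rho ->
  (exists2 c : R, 0 < c & ev (fun x => c <= F k x)) ->
  (forall B : R, ev (fun x => B <= (-1) ^+ s * F k.+1 x * x ^+ k.+1)) ->
  ev (fun x => F k x <= rho * ((-1) ^+ s * F k.+1 x * x ^+ k.+1)).
Proof.
move=> k0 rho0 [c c0 hc] hu.
have hk := deriv_iter_hardy k; have hk1 := deriv_iter_hardy k.+1.
have [[D hD]|nb] := pselect (exists D, ev (fun x => F k x <= D)).
  apply: evS (evI hD (hu (D / rho))) => x [h1 h2]; apply: (le_trans h1).
  by rewrite mulrC -ler_pdivrMr.
have inf (B : R) : ev (fun x => B <= F k x).
  have [x1 [mono|mono]] := hardy_mono hH hk.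
    have [x2 x12 h2] : exists2 x2, x1 <= x2 & B <= F k x2.
      apply: contrapT => h; apply: nb; exists B; exists x1 => x x1x.
      by rewrite leNgt; apply/negP => /ltW hB; apply: h; exists x.
    by exists x2 => x x2x; apply: le_trans h2 _; exact: mono.
  exfalso; apply: nb; exists (F k x1); exists x1 => x x1x; exact: mono.
have gpos : ev (fun x => 0 < F k.+1 x).
  case: (hardy_sign hH hk1) => // h; exfalso; apply: nb.
    have [x0 hx] := evI (deriv_iter_is_derive k) h; exists (F k x0); exists x0 => x x0x.
    by apply: (@nonincreasing_of_derive R (F k) (F k.+1) x0) => // y /hx[] // _ ->.
  have [x0 hx] := evI (deriv_iter_is_derive k) h; exists (F k x0); exists x0 => x x0x.
  by apply: (@nonincreasing_of_derive R (F k) (F k.+1) x0) => // y /hx[] // _ /ltW.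
have sE : ev (fun x => (-1) ^+ s * F k.+1 x = F k.+1 x).
  case: (s) hu => hu; last by apply: evT => x; rewrite expr0 mul1r.
  exfalso; apply: (ev_contra (hu 0) (evI gpos (ev_ge 1))) => x; rewrite expr1 mulN1r mulNr oppr_ge0 => h [g0 x1].
  have : 0 < F k.+1 x * x ^+ k.+1 by rewrite mulr_gt0 // exprn_gt0 // (lt_le_trans _ x1).
  lra.
(* If x ^ 2 * F (k + 1) were nonincreasing, F (k + 1) would be at most A / x ^ 2 and F k would be
   bounded. *)
have [hE|hE] := hardy_euler_sign hH 2 hk1; last first.
  exfalso; apply: nb.
  have [x0 x01 hx] := ev_from 1 (evI (hardy_is_derive hH hk1) (evI hE (deriv_iter_is_derive k))).
  have pos x : x0 <= x -> 0 < x by move=> x0x; apply: lt_le_trans ltr01 (le_trans x01 x0x).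
  have mono : forall x y, x0 <= x -> x <= y -> F k.+1 y * y ^+ 2 <= F k.+1 x * x ^+ 2.
    apply: (@nonincreasing_of_derive R (fun x => F k.+1 x * x ^+ 2)
       (fun x => x ^+ 1 * (x * derive1 (F k.+1) x + 2%:R * F k.+1 x))) => x x0x; have [h1 [h2 _]] := hx x x0x.
      exact: is_derive_mulXn.
    by apply: mulr_ge0_le0 h2; rewrite exprn_ge0 // ltW // pos.
  pose A := F k.+1 x0 * x0 ^+ 2.
  have dec : forall x y, x0 <= x -> x <= y -> F k y + A / y ^+ 1 <= F k x + A / x ^+ 1.
    apply: (@nonincreasing_of_derive R (fun x => F k x + A / x ^+ 1)
       (fun x => F k.+1 x + (x * 0 - 1%:R * A) / x ^+ 2)) => x x0x; have [h1 [h2 h3]] := hx x x0x.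
      apply: is_deriveD; apply: (@is_derive_divXn R (fun=> A) 0 0); exact: pos.
    rewrite mulr0 sub0r mul1r mulNr subr_le0 ler_pdivlMr ?exprn_gt0 ?pos //; exact: mono.
  exists (F k x0 + A / x0 ^+ 1 + `|A|); exists x0 => x x0x.
  have := dec _ _ (lexx x0) x0x.
  have : - `|A| <= A / x ^+ 1.
    have x1 : 1 <= x by exact: le_trans x01 x0x.
    have xp := pos _ x0x.
    rewrite expr1 ler_pdivlMr // mulNr lerNl.
    apply: le_trans (ler_norm _) _; rewrite normrN ler_peMr //.
  lra.
have [x0 x01 hx] := ev_from 1 (evI (hardy_is_derive hH hk1) (evI hE (evI (deriv_iter_is_derive k) (evI gpos sE)))).
have pos x : x0 <= x -> 0 < x by move=> x0x; apply: lt_le_trans ltr01 (le_trans x01 x0x).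
have mono : forall x y, x0 <= x -> x <= y -> F k.+1 x * x ^+ 2 <= F k.+1 y * y ^+ 2.
  apply: (@nondecreasing_of_derive R (fun x => F k.+1 x * x ^+ 2)
     (fun x => x ^+ 1 * (x * derive1 (F k.+1) x + 2%:R * F k.+1 x))) => x x0x; have [h1 [h2 _]] := hx x x0x.
    exact: is_derive_mulXn.
  by apply: mulr_ge0 h2; rewrite exprn_ge0 // ltW // pos.
pose y := Num.max x0 (2 / rho).
have x0y : x0 <= y by rewrite le_max lexx.
have yr : 2 / rho <= y by rewrite le_max lexx orbT.
have yp := pos _ x0y.
have key x : y <= x -> F k x <= F k y + F k.+1 x * x ^+ 2 / y.
  move=> yx; have x0x := le_trans x0y yx; have xp := pos _ x0x.
  pose G := F k.+1 x * x ^+ 2.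
  have G0 : 0 < G by rewrite mulr_gt0 ?exprn_gt0 //; have [_ [_ [_ []]]] := hx x x0x.
  have [||z /andP[z1 z2]] := @mean_value R (fun t => F k t + G / t ^+ 1)
     (fun t => F k.+1 t + (t * 0 - 1%:R * G) / t ^+ 2) y x => //.
    move=> z /andP[yz zx]; have x0z := le_trans x0y yz; have [_ [_ [h3 _]]] := hx z x0z.
    apply: is_deriveD; apply: (@is_derive_divXn R (fun=> G) 0 0); exact: pos.
  have zp := pos _ (le_trans x0y z1).
  have : F k.+1 z + (z * 0 - 1%:R * G) / z ^+ 2 <= 0.
    rewrite mulr0 sub0r mul1r mulNr subr_le0 ler_pdivlMr ?exprn_gt0 //.
    by apply: mono => //; exact: le_trans z1.
  move=> zneg E; have xy0 : 0 <= x - y by rewrite subr_ge0.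
  have := mulr_le0_ge0 zneg xy0; rewrite -E !expr1.
  have : 0 <= G / x by rewrite divr_ge0 // ltW.
  rewrite -/G; lra.
apply: evS (evI (inf (2 * F k y)) (evI (ev_ge y) (ev_ge 1))) => x [h1 [h2 x1]].
have x0x := le_trans x0y h2; have [_ [_ [_ [g0 ->]]]] := hx x x0x.
have := key x h2.
have h3 : F k.+1 x * x ^+ 2 / y <= rho / 2 * (F k.+1 x * x ^+ k.+1).
  rewrite ler_pdivrMr // mulrAC [leRHS]mulrC.
  have xx : F k.+1 x * x ^+ 2 <= F k.+1 x * x ^+ k.+1.
    by rewrite ler_pM2l // ler_weXn2l.
  have ry : 1 <= rho / 2 * y.
    by move: yr; rewrite ler_pdivrMr //; lra.
  apply: le_trans xx _; rewrite ler_peMr // ltW // mulr_gt0 // exprn_gt0 //; exact: lt_le_trans x1.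
lra.
Qed.

Lemma poly_regular_le (f : R -> R) p (x0 x1 : R) : x0 <= x1 -> poly_regular f p x0 -> poly_regular f p x1.
Proof.
move=> xx [h1 h2]; split; first exact: le_trans xx.
by move=> x y h; apply: h2; exact: le_trans h.
Qed.

(** As F (k + 1) tends to 0, F k grows at most linearly and stays below x ^ 2; being bounded away
    from 0, it satisfies F k * x ^ 2 >= 1. The exponent 3 is 2 + 1. *)
Lemma degree_deriv_regular k : to0 (F k.+1) -> (exists2 c : R, 0 < c & ev (fun x => c <= F k x)) ->
  exists p x0, poly_regular (F k) p x0.
Proof.
move=> h0 [c c0 hc]; exists 3%N; apply: (hardy_poly_regular hH (deriv_iter_hardy k)).
- by apply: evS hc => x; exact: lt_le_trans.
- have [x0 hx] := evI (deriv_iter_is_derive k) (h0 1 ltr01).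
  have dec : forall x y, x0 <= x -> x <= y -> F k y - y <= F k x - x.
    apply: (@nonincreasing_of_derive R (fun x => F k x - x) (fun x => F k.+1 x - 1)) => x /hx[h1 h2].
      exact: is_deriveB.
    rewrite subr_le0; exact: le_trans (ler_norm _) (ltW h2).
  apply: evS (evI (ev_ge x0) (ev_ge (`|F k x0 - x0| + 2))) => x [h1 h2].
  have := dec _ _ (lexx x0) h1; have := ler_norm (F k x0 - x0); have := normr_ge0 (F k x0 - x0).
  rewrite expr2 => a1 a2 a3.
  have : 2 * x <= x * x by rewrite ler_pM2r //; lra.
  lra.
- apply: evS (evI hc (evI (ev_ge 1) (ev_ge c^-1))) => x [h1 [h2 h3]].
  have x0 : 0 < x by exact: lt_le_trans h2.
  apply: (@le_trans _ _ (c * x)); first by rewrite mulrC -ler_pdivrMr // div1r.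
  apply: (@le_trans _ _ (c * x ^+ 2)); first by rewrite ler_pM2l // expr2 ler_peMr // ltW.
  by rewrite ler_pM2r // exprn_gt0.
Qed.

(** The decay makes F k - A / x ^ k nondecreasing and F k + A / x ^ k nonincreasing. Values of the
    former lie below all values of the latter, and [c] is the supremum of the former. *)
Lemma limit_of_decay k (A : R) : (0 < k)%N -> 0 <= A -> ev (fun x => `|F k.+1 x| * x ^+ k.+1 <= A) ->
  (exists2 c : R, 0 < c & ev (fun x => c <= F k x)) ->
  exists2 c : R, 0 < c & ev (fun x => `|F k x - c| <= A / x ^+ k).
Proof.
move=> k0 A0 hA [c0 c00 hc].
have [x0 x01 hx] := ev_from 1 (evI (deriv_iter_is_derive k) (evI hA hc)).
have pos x : x0 <= x -> 0 < x by move=> x0x; apply: lt_le_trans ltr01 (le_trans x01 x0x).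
have k1 : (k = k.-1.+1)%N by rewrite prednK.
have dA x : x0 <= x -> is_derive x 1 (fun y => A / y ^+ k) ((x * 0 - k%:R * A) / x ^+ k.+1).
  by move=> x0x; rewrite k1; apply: (@is_derive_divXn R (fun=> A) 0); exact: pos.
have bd x : x0 <= x -> `|F k.+1 x| <= k%:R * A / x ^+ k.+1.
  move=> x0x; have [_ [h _]] := hx x x0x.
  rewrite ler_pdivlMr ?exprn_gt0 ?pos //; apply: (le_trans h); rewrite ler_peMl //.
  by rewrite ler1n.
have up : forall x y, x0 <= x -> x <= y -> F k x - A / x ^+ k <= F k y - A / y ^+ k.
  apply: (@nondecreasing_of_derive R (fun x => F k x - A / x ^+ k)
     (fun x => F k.+1 x - (x * 0 - k%:R * A) / x ^+ k.+1)) => x x0x.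
    by apply: is_deriveB; [have [] := hx x x0x | exact: dA].
  have := bd x x0x; rewrite ler_norml => /andP[h _].
  rewrite mulr0 sub0r mulNr opprK; lra.
have dn : forall x y, x0 <= x -> x <= y -> F k y + A / y ^+ k <= F k x + A / x ^+ k.
  apply: (@nonincreasing_of_derive R (fun x => F k x + A / x ^+ k)
     (fun x => F k.+1 x + (x * 0 - k%:R * A) / x ^+ k.+1)) => x x0x.
    by apply: is_deriveD; [have [] := hx x x0x | exact: dA].
  have := bd x x0x; rewrite ler_norml => /andP[_ h].
  rewrite mulr0 sub0r mulNr; lra.
have Ap x : x0 <= x -> 0 <= A / x ^+ k.
  by move=> x0x; rewrite divr_ge0 // exprn_ge0 // ltW // pos.
have cross x y : x0 <= x -> x0 <= y -> F k x - A / x ^+ k <= F k y + A / y ^+ k.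
  move=> xx yy; pose z := Num.max x y.
  have xz : x <= z by rewrite le_max lexx.
  have yz : y <= z by rewrite le_max lexx orbT.
  have := up _ _ xx xz; have := dn _ _ yy yz; have := Ap z (le_trans xx xz); lra.
pose E := [set F k x - A / x ^+ k | x in [set x | x0 <= x]].
have supE : has_sup E.
  split; first by exists (F k x0 - A / x0 ^+ k); exists x0 => //=.
  by exists (F k x0 + A / x0 ^+ k) => _ [x /= xx <-]; exact: cross.
have lo x : x0 <= x -> F k x - A / x ^+ k <= sup E.
  move=> xx; apply: (sup_upper_bound supE); by exists x.
have hi x : x0 <= x -> sup E <= F k x + A / x ^+ k.
  move=> xx; apply: ge_sup; first by case: supE.
  by move=> _ [y /= yy <-]; exact: cross.
exists (sup E); last first.
  exists x0 => x xx; have := lo x xx; have := hi x xx; rewrite ler_norml => h1 h2.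
  by apply/andP; split; lra.
(* Here A / x ^ k is at most c0 / 2, so the limit is at least c0 / 2. *)
pose x := Num.max x0 (2 * A / c0).
have x0x : x0 <= x by rewrite le_max lexx.
have xA : 2 * A / c0 <= x by rewrite le_max lexx orbT.
have x1 : 1 <= x by exact: le_trans x01 x0x.
have [_ [_ h]] := hx x x0x.
apply: lt_le_trans (lo x x0x).
have : A / x ^+ k <= c0 / 2.
  rewrite ler_pdivrMr ?exprn_gt0 ?pos //.
  have xk : x <= x ^+ k by rewrite k1 exprS ler_peMr ?exprn_ege1 // ltW // pos.
  have : 2 * A / c0 <= x ^+ k by exact: le_trans xA xk.
  by rewrite ler_pdivrMr //; lra.
lra.
Qed.

Lemma weyl_sum_opp (f : R -> R) (s : bool) (ka : R) N :
  cabs (weyl_sum (fun x => (-1) ^+ s * f x) ka N) = cabs (weyl_sum f ka N).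
Proof.
case: s; last first.
  by congr cabs; apply: eq_bigr => n _; rewrite expr0 mul1r.
rewrite -cabs_expsumN; congr cabs; apply: eq_bigr => n _.
by rewrite expr1 mulN1r mulrN opprK.
Qed.

Lemma uniform_weyl k (eps K : R) : (0 < k)%N -> to0 (F k.+1) ->
  (exists2 c : R, 0 < c & ev (fun x => c <= F k x)) -> 0 < eps -> 0 < K ->
  exists (B : R) (N0 : nat), forall (N : nat) (ka : R), (N0 <= N)%N -> 0 < ka -> ka <= K ->
    B <= ka * alpha N%:R -> cabs (weyl_sum alpha ka N) <= eps * N%:R.
Proof.
move=> k0 ht hcx eps0 K0.
have [p [xr hreg]] := degree_deriv_regular ht hcx.
have [xm hm] := hardy_mono hH (deriv_iter_hardy k).
have hle := le_degree_deriv hcx.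
have hfam := deriv_iter_family k.+1.
have [[A A0 hA]|[s [us hs]]] := top_deriv_dichotomy k.
  have [c c0 hc] := limit_of_decay k0 A0 hA hcx.
  have [xn hn] := alpha_nondecreasing.
  have [x0 x01 hx] := ev_from 1 (evI (ev_ge xr) (evI (ev_ge xm) (evI (ev_ge xn) (evI hle (evI hfam hc))))).
  pose A2 := 2 ^+ k * (c + A).
  apply: (@uniform_weyl_limit R F k p x0 c A A2) => //.
  - by move=> i x ik x0x; have [_ [_ [_ [_ [h _]]]]] := hx x x0x; apply: h; exact: ltnW.
  - have [_ [h _]] := hx x0 (lexx _).
    by case: hm => hm; [left|right] => x y xx; apply: hm; exact: le_trans h xx.
  - by move=> x x0x; have [_ [_ [_ [_ [_ h]]]]] := hx x x0x.
  - move=> x x0x; have [_ [_ [_ [h1 [_ h2]]]]] := hx x x0x.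
    have x1 := le_trans x01 x0x.
    rewrite /= gtr0_norm; last exact: alpha_gt0.
    apply: (le_trans h1); rewrite /A2 mulrAC.
    have xp : 0 < x ^+ k by rewrite exprn_gt0 // (lt_le_trans _ x1).
    have w : 0 < 2 ^+ k :> R by rewrite exprn_gt0.
    rewrite ler_pM2r // ler_pM2l //.
    have : A / x ^+ k <= A by rewrite ler_pdivrMr // ler_peMr // exprn_ege1.
    by move: h2; rewrite ler_norml => /andP[_ h2] h3; lra.
  - have [_ [_ [h _]]] := hx x0 (lexx _).
    by move=> x y xx; apply: hn; exact: le_trans h xx.
  - by apply: poly_regular_le hreg; have [] := hx x0 (lexx _).
  - move=> ks e ks0 e0; have := ud_weyl (alpha_ud ks0) e0; exact.
pose F' i x := (-1) ^+ s * F i x.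
have regu : exists x1, poly_regular (F' k.+1) k.+2 x1.
  apply: (hardy_poly_regular hH (hardy_signed s (deriv_iter_hardy k.+1)) us); last exact: hs.
  apply: evS (evI (ht 1 ltr01) (ev_ge 1)) => x [h1 x1].
  apply: le_trans (ler_norm _) _; rewrite normrM normrX normrN1 expr1n mul1r.
  by apply: le_trans (ltW h1) _; rewrite exprn_ege1.
have [xu hregu] := regu.
have [xv hmu] := hardy_mono hH (hardy_signed s (deriv_iter_hardy k.+1)).
have [x0 x01 hx] := ev_from 1 (evI (ev_ge xr) (evI (ev_ge xm) (evI (ev_ge xu) (evI (ev_ge xv) hfam)))).
have fam : derivative_family F k.+1 x0.
  by move=> i x ik x0x; have [_ [_ [_ [_ h]]]] := hx x x0x; exact: h.
have fam' : derivative_family F' k.+1 x0.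
  move=> i x ik x0x; have h := fam i x ik x0x; rewrite /F'.
  apply: is_derive_eq; rewrite /GRing.scale /=; ring.
have [h1 [h2 [h3 [h4 _]]]] := hx x0 (lexx x0).
have hm' : (forall x y, x0 <= x -> x <= y -> F k x <= F k y) \/
  (forall x y, x0 <= x -> x <= y -> F k y <= F k x).
  by case: hm => hm; [left|right] => x y xx; apply: hm; exact: le_trans h2 xx.
have hmu' : (forall x y, x0 <= x -> x <= y -> F' k.+1 x <= F' k.+1 y) \/
  (forall x y, x0 <= x -> x <= y -> F' k.+1 y <= F' k.+1 x).
  by case: hmu => hmu; [left|right] => x y xx; apply: hmu; exact: le_trans h4 xx.
have [d1 d10 [N1 b1]] := @block_test R F' k.+1 k.+2 x0 eps isT eps0 fam' (poly_regular_le h3 hregu) hmu'.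
have [d2 d20 [N2 b2]] := @block_test R F k p x0 eps k0 eps0 (derivative_familyW (leqnSn k) fam) (poly_regular_le h1 hreg) hm'.
have d12 : 0 < d1 * d2 by rewrite mulr_gt0.
have neg := degree_deriv_negligible k0 d12 hcx hs.
have dK : 0 < d1 / K by rewrite divr_gt0.
have [x3 hx3] := evI neg (evI (ht _ dK) (evI hle (evI us (ev_ge 1)))).
have [N3 h3'] := nat_ge_exists x3.
have w : 0 < 2 ^+ k :> R by rewrite exprn_gt0.
(* From alpha <= 2 ^ k x ^ k F k, this bound yields ka * F k N * N ^ k >= 1 / d2. *)
exists (2 ^+ k / d2), (maxn (maxn N1 N2) N3) => N ka; rewrite !geq_max => /andP[/andP[n1 n2] n3] ka0 kaK hB.
have [g1 [g2 [g3 [g4 N1']]]] := hx3 N%:R (h3' N n3).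
have Np : 0 < N%:R :> R by exact: lt_le_trans N1'.
set u := (-1) ^+ s * F k.+1 N%:R in g1 g4.
have uK : ka * u <= d1.
  have : u <= d1 / K.
    apply: le_trans (ler_norm _) _; rewrite normrM normrX normrN1 expr1n mul1r; exact: ltW.
  rewrite ler_pdivlMr // => h; apply: le_trans h; rewrite mulrC; by rewrite ler_pM2l.
(* The two orders cover every ka: if order k + 1 is too small for its test, then F k <= d1 * d2 * u
   * N ^ (k + 1) gives ka * F k N <= d2, the smallness which the test of order k requires. *)
have [big|small] := leP d1^-1 (ka * u * N%:R ^+ k.+1).
  by rewrite -(weyl_sum_opp alpha s); apply: (b1 N ka).
apply: b2 => //.
  apply: (@le_trans _ _ (ka * (d1 * d2 * (u * N%:R ^+ k.+1)))); first by rewrite ler_pM2l.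
  have -> : ka * (d1 * d2 * (u * N%:R ^+ k.+1)) = d1 * d2 * (ka * u * N%:R ^+ k.+1) by ring.
  apply: (@le_trans _ _ (d1 * d2 * d1^-1)); first by rewrite ler_pM2l // ltW.
  by rewrite mulrAC mulfV ?gt_eqF // mul1r.
have : 2 ^+ k / d2 <= ka * (2 ^+ k * N%:R ^+ k * F k N%:R).
  by apply: (le_trans hB); rewrite ler_pM2l.
have -> : ka * (2 ^+ k * N%:R ^+ k * F k N%:R) = 2 ^+ k * (ka * F k N%:R * N%:R ^+ k) by ring.
by rewrite ler_pM2l.
Qed.

End Structure.

(** * Fejer kernel *)

Section Fejer.
Context {R : realType}.
Implicit Types (Q r Y : nat) (y th : R).

(** The Fejer kernel of order [Q] centred at r / Q, normalised so that the [Q] kernels sum to 1.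
    Written as the square of a discrete transform, it falls under Parseval's identity. *)
Definition fejer Q r y : R := (Q%:R ^+ 2)^-1 * cabs (dft Q Q (fun j => cis (- (j%:R * y))) r) ^+ 2.

Lemma fejer_ge0 Q r y : 0 <= fejer Q r y.
Proof. by rewrite /fejer mulr_ge0 ?invr_ge0 ?exprn_ge0 // cabs_ge0. Qed.

Lemma fejer_sum1 Q y : (0 < Q)%N -> \sum_(0 <= r < Q) fejer Q r y = 1.
Proof.
move=> Q0; rewrite -mulr_sumr parseval //.
under eq_bigr do rewrite cabs_cis expr1n.
rewrite big_const_nat iter_addr_0 subn0; field.
by rewrite pnatr_eq0 -lt0n.
Qed.

Lemma dft_cis_frac Q r y :
  dft Q Q (fun j => cis (- (j%:R * y))) r = \sum_(0 <= j < Q) cis (j%:R * (r%:R / Q%:R - frac_part y)).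
Proof.
apply: eq_bigr => j _; rewrite -cisD.
have -> : j%:R * (r%:R / Q%:R - frac_part y) =
   - (j%:R * y) + r%:R * (j%:R / Q%:R) - (- (j%:Z * Num.floor y))%:~R.
  by rewrite /frac_part rmorphN rmorphM /= -pmulrn; ring.
by rewrite cisBint.
Qed.

Lemma fejer_far Q r y d : (0 < Q)%N -> 0 < d -> d <= `|r%:R / Q%:R - frac_part y| ->
  `|r%:R / Q%:R - frac_part y| <= 1 - d -> fejer Q r y <= (Q%:R ^+ 2)^-1 * (d ^+ 2)^-1.
Proof.
move=> Q0 d0; rewrite /fejer dft_cis_frac; set x := _ - _ => dx xd.
have low := cis_subr1_ge' (ltW d0) dx xd.
rewrite ler_wpM2l ?invr_ge0 ?exprn_ge0 // -exprVn.
rewrite lerXn2r ?nnegrE ?cabs_ge0 ?invr_ge0 ?(ltW d0) //.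
have E := congr1 cabs (cis_geo x Q); rewrite cabsM in E.
have : cabs (cis (Q%:R * x) - 1) <= 2 by apply: le_trans (cabsB _ _) _; rewrite cabs_cis cabs1.
rewrite -E => h; rewrite -[leRHS]mul1r ler_pdivlMr //.
have := le_trans (ler_wpM2r (cabs_ge0 _) low) h.
lra.
Qed.

Lemma frac_part_nat (n q i : nat) : (i < q)%N -> frac_part (n%:R + i%:R / q%:R : R) = i%:R / q%:R.
Proof.
move=> iq; have q0 : 0 < q%:R :> R by rewrite ltr0n (leq_ltn_trans _ iq).
have h0 : 0 <= i%:R / q%:R :> R by rewrite divr_ge0.
have h1 : i%:R / q%:R < 1 :> R by rewrite ltr_pdivrMr // mul1r ltr_nat.
rewrite /frac_part (_ : Num.floor _ = n) /=; first by rewrite addrAC subrr add0r.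
apply: floor_def; rewrite -pmulrn lerDl h0 /= rmorphD /= ltrD2l //.
Qed.

Lemma fejer_node Q r n i : (r < Q)%N -> (i < Q)%N -> fejer Q r (n%:R + i%:R / Q%:R) = (i == r)%:R.
Proof.
move=> rQ iQ; have Q0 : 0 < Q%:R :> R by rewrite ltr0n (leq_ltn_trans _ rQ).
rewrite /fejer dft_cis_frac frac_part_nat //.
have -> : \sum_(0 <= j < Q) cis (j%:R * (r%:R / Q%:R - i%:R / Q%:R)) = if r == i then Q%:R else 0 :> R[i].
  by rewrite -(cis_orthogonal rQ iQ); apply: eq_bigr => j _; rewrite mulrBl.
rewrite eq_sym; case: eqP => _; last by rewrite cabs0 expr0n mulr0.
rewrite -(rmorph_nat (real_complex R)) cabs_real ger0_norm // mulVf //.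
by rewrite expf_neq0 // gt_eqF.
Qed.

(** Multiplication by the kernel only shifts the frequency by integers below [Q] in absolute value;
    a comparison of exponential sums can thus be localised near r / Q. *)
Lemma cis_fejer th Q r y : (0 < Q)%N ->
  cis (th * y) * (fejer Q r y)%:C%C =
  ((Q%:R ^+ 2)^-1 : R)%:C%C * \sum_(0 <= j < Q) \sum_(0 <= j' < Q)
     cis (r%:R * (j%:R / Q%:R) - r%:R * (j'%:R / Q%:R)) * cis ((th + j'%:R - j%:R) * y).
Proof.
move=> Q0; set D := fun j => cis (- (j%:R * y)).
have -> : (fejer Q r y)%:C%C = ((Q%:R ^+ 2)^-1 : R)%:C%C * (dft Q Q D r * conjc (dft Q Q D r)).
  by rewrite -cabs_sqrC -rmorphM.
rewrite mulrCA; congr (_ * _).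
rewrite /dft (raddf_sum conjc) mulr_suml mulr_sumr; apply: eq_bigr => j _.
rewrite mulr_sumr mulr_sumr; apply: eq_bigr => j' _.
rewrite (_ : GRing.Additive.sort _ _ = conjc (D j') * conjc (cis (r%:R * (j'%:R / Q%:R)))); last exact: conjcM.
rewrite /D -!cisN -!cisD; congr cis; ring.
Qed.

(* The measures [\sum w_i delta_(y_i)] and Lebesgue measure on [0, Y], the latter discretised at
   step 1/Q, where the Fejer kernel vanishes at all nodes but one. *)
Section Comparison.
Variables (I : Type) (s : seq I) (w yy : I -> R) (Q Y : nat) (e' : R).
Hypotheses (Q0 : (0 < Q)%N) (w0 : forall i, 0 <= w i) (e0 : 0 <= e').
Hypothesis comp : forall ka : R, `|ka| <= Q%:R - 1 / 2 ->
  cabs (\sum_(i <- s) (w i)%:C%C * cis (ka * yy i) -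
        (Q%:R^-1 : R)%:C%C * \sum_(0 <= i < Q * Y) cis (ka * (i%:R / Q%:R))) <= e'.

Let QR : 0 < Q%:R :> R. Proof. by rewrite ltr0n. Qed.

Lemma fejer_comparison th r : `|th| <= 1 / 2 -> (r < Q)%N ->
  cabs (\sum_(i <- s) (w i)%:C%C * (cis (th * yy i) * (fejer Q r (yy i))%:C%C) -
        (Q%:R^-1 : R)%:C%C * \sum_(0 <= q < Y) cis (th * (q%:R + r%:R / Q%:R))) <= e'.
Proof.
move=> hth rQ.
have -> : \sum_(0 <= q < Y) cis (th * (q%:R + r%:R / Q%:R)) =
  \sum_(0 <= i < Q * Y) cis (th * (i%:R / Q%:R)) * (fejer Q r (i%:R / Q%:R))%:C%C.
  rewrite sum_residues.
  transitivity (\sum_(0 <= i < Q) if i == r then \sum_(0 <= q < Y) cis (th * (q%:R + i%:R / Q%:R)) else 0).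
    by rewrite -big_mkcond /= big_nat1_eq rQ.
  apply: eq_big_nat => i /andP[_ iQ].
  have nodeE q : (Q * q + i)%N%:R / Q%:R = q%:R + i%:R / Q%:R :> R.
    by rewrite natrD natrM; field; rewrite gt_eqF.
  have [ir|ne] := eqVneq i r.
    by apply: eq_bigr => q _; rewrite nodeE fejer_node // ir eqxx mulr1.
  symmetry; apply: big1 => q _; rewrite nodeE fejer_node //.
  by rewrite (negbTE ne) mulr0.
pose q2 : R[i] := ((Q%:R ^+ 2)^-1 : R)%:C%C.
pose ph j j' : R[i] := cis (r%:R * (j%:R / Q%:R) - r%:R * (j'%:R / Q%:R)).
pose D j j' : R[i] := \sum_(i <- s) (w i)%:C%C * cis ((th + j'%:R - j%:R) * yy i) -
        (Q%:R^-1 : R)%:C%C * \sum_(0 <= i < Q * Y) cis ((th + j'%:R - j%:R) * (i%:R / Q%:R)).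
have -> : \sum_(i <- s) (w i)%:C%C * (cis (th * yy i) * (fejer Q r (yy i))%:C%C) -
   (Q%:R^-1 : R)%:C%C * (\sum_(0 <= i < Q * Y) cis (th * (i%:R / Q%:R)) * (fejer Q r (i%:R / Q%:R))%:C%C) =
   q2 * \sum_(0 <= j < Q) \sum_(0 <= j' < Q) ph j j' * D j j'.
  have E1 : \sum_(i <- s) (w i)%:C%C * (cis (th * yy i) * (fejer Q r (yy i))%:C%C) =
    q2 * \sum_(0 <= j < Q) \sum_(0 <= j' < Q) ph j j' *
       \sum_(i <- s) (w i)%:C%C * cis ((th + j'%:R - j%:R) * yy i).
    transitivity (\sum_(i <- s) \sum_(0 <= j < Q) \sum_(0 <= j' < Q)
        q2 * (ph j j' * ((w i)%:C%C * cis ((th + j'%:R - j%:R) * yy i)))).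
      apply: eq_bigr => i _; rewrite cis_fejer // mulrCA mulr_sumr mulr_sumr; apply: eq_bigr => j _.
      by rewrite mulr_sumr mulr_sumr; apply: eq_bigr => j' _; rewrite /ph; ring.
    rewrite exchange_big mulr_sumr; apply: eq_bigr => j _.
    rewrite exchange_big mulr_sumr; apply: eq_bigr => j' _.
    by rewrite !mulr_sumr.
  have E2 : \sum_(0 <= i < Q * Y) cis (th * (i%:R / Q%:R)) * (fejer Q r (i%:R / Q%:R))%:C%C =
    q2 * \sum_(0 <= j < Q) \sum_(0 <= j' < Q) ph j j' *
       \sum_(0 <= i < Q * Y) cis ((th + j'%:R - j%:R) * (i%:R / Q%:R)).
    transitivity (\sum_(0 <= i < Q * Y) \sum_(0 <= j < Q) \sum_(0 <= j' < Q)
        q2 * (ph j j' * (cis ((th + j'%:R - j%:R) * (i%:R / Q%:R))))).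
      apply: eq_bigr => i _; rewrite cis_fejer // mulr_sumr; apply: eq_bigr => j _.
      by rewrite mulr_sumr; apply: eq_bigr => j' _.
    rewrite exchange_big mulr_sumr; apply: eq_bigr => j _.
    rewrite exchange_big mulr_sumr; apply: eq_bigr => j' _.
    by rewrite !mulr_sumr.
  rewrite E1 E2 mulrCA -mulrBr; congr (_ * _).
  rewrite mulr_sumr -sumrB; apply: eq_bigr => j _.
  rewrite mulr_sumr -sumrB; apply: eq_bigr => j' _.
  by rewrite /D; ring.
rewrite cabsM /q2 cabs_real ger0_norm ?invr_ge0 ?exprn_ge0 //.
rewrite ler_pdivrMl ?exprn_gt0 //.
apply: le_trans (cabs_sum _ _ _) _.
apply: (@le_trans _ _ (\sum_(0 <= j < Q) Q%:R * e')); last first.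
  by rewrite big_const_nat iter_addr_0 subn0 -[leLHS]mulr_natl mulrA -expr2.
rewrite !big_nat; apply: ler_sum => j /andP[_ jQ].
apply: le_trans (cabs_sum _ _ _) _.
apply: (@le_trans _ _ (\sum_(0 <= j' < Q) e')); last first.
  by rewrite big_const_nat iter_addr_0 subn0 -[leLHS]mulr_natl.
rewrite !big_nat; apply: ler_sum => j' /andP[_ j'Q].
rewrite cabsM cabs_cis mul1r; apply: comp.
(* The shifted frequencies stay within Q - 1/2, which explains the range in [comp]. *)
have j1 : j%:R <= Q%:R - 1 :> R by rewrite lerBrDr natr1 ler_nat.
have j2 : j'%:R <= Q%:R - 1 :> R by rewrite lerBrDr natr1 ler_nat.
have j3 : 0 <= j%:R :> R by [].
have j4 : 0 <= j'%:R :> R by [].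
by move: hth; rewrite !ler_norml => /andP[h1 h2]; apply/andP; split; lra.
Qed.

(** The case th = 0. It bounds the mass of the weights near r / Q modulo 1, in particular near the
    integers. *)
Lemma fejer_mass r : (r < Q)%N -> \sum_(i <- s) w i * fejer Q r (yy i) <= Y%:R / Q%:R + e'.
Proof.
move=> rQ; have h0 : `|0 : R| <= 1 / 2 by rewrite normr0.
have := fejer_comparison h0 rQ.
have -> : \sum_(0 <= q < Y) cis (0 * (q%:R + r%:R / Q%:R)) = Y%:R :> R[i].
  by under eq_bigr do rewrite mul0r cis0; rewrite big_const_nat iter_addr_0 subn0.
have -> : \sum_(i <- s) (w i)%:C%C * (cis (0 * yy i) * (fejer Q r (yy i))%:C%C) =
   (\sum_(i <- s) w i * fejer Q r (yy i))%:C%C.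
  by rewrite rmorph_sum; apply: eq_bigr => i _; rewrite mul0r cis0 mul1r -rmorphM.
rewrite -(rmorph_nat (real_complex R)) -rmorphM -rmorphB cabs_real ler_norml => /andP[_].
by rewrite lerBlDl mulrC addrC.
Qed.

(** If the fractional part of y is within 2 d of an integer, every node outside this set is at
    distance at least [d] from it modulo 1. *)
Definition near_integer d r := (r%:R / Q%:R < 3 * d) || (1 - 3 * d < r%:R / Q%:R :> R).

Lemma sum_fejer_far d y (P : pred nat) : 0 < d ->
  (forall r, (r < Q)%N -> P r -> d <= `|r%:R / Q%:R - frac_part y| <= 1 - d) ->
  \sum_(0 <= r < Q | P r) fejer Q r y <= (Q%:R * d ^+ 2)^-1.
Proof.
move=> d0 hP; apply: (@le_trans _ _ (\sum_(0 <= r < Q) (Q%:R ^+ 2)^-1 * (d ^+ 2)^-1)); last first.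
  rewrite big_const_nat iter_addr_0 subn0 -mulr_natl le_eqVlt; apply/orP; left; apply/eqP.
  by field; rewrite !gt_eqF.
rewrite big_mkcond !big_nat; apply: ler_sum => r /andP[_ rQ].
case: ifP => [/(hP r rQ)/andP[h1 h2]|_]; first exact: fejer_far.
by rewrite mulr_ge0 // invr_ge0 exprn_ge0 // ltW.
Qed.

(** Away from the integers e(- th * frac y) is Lipschitz and the kernels concentrate near y. Within
    2 d of an integer, where the fractional part jumps, the error is only bounded by 2, and this is
    charged to the kernels at nodes near integers. *)
Lemma approx_pointwise th d y : `|th| <= 1 / 2 -> 0 < d -> d <= 1 / 4 ->
  cabs (cis (- (th * frac_part y)) - \sum_(0 <= r < Q) cis (- (th * (r%:R / Q%:R))) * (fejer Q r y)%:C%C) <=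
  8 * d + 2 * (Q%:R * d ^+ 2)^-1 + 2 * \sum_(0 <= r < Q | near_integer d r) fejer Q r y.
Proof.
move=> hth d0 d4; set t := frac_part y.
have /andP[t0 t1] := frac_partP y; rewrite -/t in t0 t1.
have rb r : (r < Q)%N -> 0 <= r%:R / Q%:R :> R /\ r%:R / Q%:R < 1 :> R.
  by move=> rQ; rewrite divr_ge0 // ltr_pdivrMr // mul1r ltr_nat rQ.
have mn0 : 0 <= \sum_(0 <= r < Q | near_integer d r) fejer Q r y.
  by apply: sumr_ge0 => r _; exact: fejer_ge0.
have step : cabs (cis (- (th * t)) - \sum_(0 <= r < Q) cis (- (th * (r%:R / Q%:R))) * (fejer Q r y)%:C%C) <=
   \sum_(0 <= r < Q) cabs (cis (- (th * t)) - cis (- (th * (r%:R / Q%:R)))) * fejer Q r y.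
  have -> : cis (- (th * t)) - \sum_(0 <= r < Q) cis (- (th * (r%:R / Q%:R))) * (fejer Q r y)%:C%C =
    \sum_(0 <= r < Q) (cis (- (th * t)) - cis (- (th * (r%:R / Q%:R)))) * (fejer Q r y)%:C%C.
    under [RHS]eq_bigr do rewrite mulrBl.
    rewrite sumrB -mulr_sumr -(raddf_sum (real_complex R)) fejer_sum1 //= mulr1 //.
  apply: le_trans (cabs_sum _ _ _) _; apply: ler_sum => r _.
  by rewrite cabsM cabs_real ger0_norm // fejer_ge0.
apply: le_trans step _.
have c2 r : cabs (cis (- (th * t)) - cis (- (th * (r%:R / Q%:R)))) <= 2.
  by apply: le_trans (cabsB _ _) _; rewrite !cabs_cis.
have iQd : 0 <= (Q%:R * d ^+ 2)^-1 by rewrite invr_ge0 mulr_ge0 // exprn_ge0 // ltW.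
have [/andP[g1 g2]|bad] := boolP ((2 * d <= t) && (t <= 1 - 2 * d)).
  apply: (@le_trans _ _ (\sum_(0 <= r < Q) (8 * d * fejer Q r y +
      2 * (if d <= `|r%:R / Q%:R - t| then fejer Q r y else 0)))).
    rewrite !big_nat; apply: ler_sum => r /andP[_ rQ]; have f0 := fejer_ge0 Q r y.
    case: ifP => [_|/negbT].
      have := ler_wpM2r f0 (c2 r); have : 0 <= 8 * d * fejer Q r y by apply: mulr_ge0 => //; apply: mulr_ge0 => //; exact: ltW.
      lra.
    rewrite -ltNge mulr0 addr0 => near; apply: ler_wpM2r => //.
    apply: le_trans (cis_lip _ _) _.
    have -> : - (th * t) - - (th * (r%:R / Q%:R)) = th * (r%:R / Q%:R - t) by ring.
    rewrite normrM.
    have : `|th| * `|r%:R / Q%:R - t| <= 1 / 2 * d by apply: ler_pM => //; exact: ltW.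
    lra.
  rewrite big_split /=.
  have -> : \sum_(0 <= r < Q) 8 * d * fejer Q r y = 8 * d by rewrite -mulr_sumr fejer_sum1 // mulr1.
  have -> : \sum_(0 <= r < Q) 2 * (if d <= `|r%:R / Q%:R - t| then fejer Q r y else 0) =
      2 * \sum_(0 <= r < Q | d <= `|r%:R / Q%:R - t|) fejer Q r y.
    by rewrite -mulr_sumr -big_mkcond.
  have := @sum_fejer_far d y (fun r => d <= `|r%:R / Q%:R - t|) d0.
  rewrite -/t => H; have {}H := H _.
  have /H : forall r : nat, (r < Q)%N -> d <= `|r%:R / Q%:R - t| -> d <= `|r%:R / Q%:R - t| <= 1 - d.
    move=> r rQ ->; have [r0 r1] := rb r rQ; rewrite /= ler_norml; apply/andP; split; lra.
  lra.
have H := @sum_fejer_far d y (fun r => ~~ near_integer d r) d0.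
have {}H : \sum_(0 <= r < Q | ~~ near_integer d r) fejer Q r y <= (Q%:R * d ^+ 2)^-1.
  apply: H => r rQ; rewrite /near_integer negb_or -!leNgt -/t => /andP[n1 n2].
  have [r0 r1] := rb r rQ.
  move: bad; rewrite negb_and -!ltNge => /orP[b|b].
    by rewrite ger0_norm; [apply/andP; split|]; lra.
  by rewrite ler0_norm; [apply/andP; split|]; lra.
(* All kernel mass at a bad y, except the small far part, sits at nodes near integers, so twice
   these two masses pays for the trivial error 2. *)
have tot : \sum_(0 <= r < Q | near_integer d r) fejer Q r y + \sum_(0 <= r < Q | ~~ near_integer d r) fejer Q r y = 1.
  by rewrite -(fejer_sum1 y Q0) [RHS](bigID (near_integer d)).
apply: (@le_trans _ _ 2).
  apply: (@le_trans _ _ (\sum_(0 <= r < Q) 2 * fejer Q r y)).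
    by apply: ler_sum => r _; rewrite ler_wpM2r // fejer_ge0.
  by rewrite -mulr_sumr fejer_sum1 // mulr1.
lra.
Qed.

Lemma card_near_integer d : 0 < d -> d <= 1 / 6 ->
  \sum_(0 <= r < Q | near_integer d r) (1 : R) <= 6 * d * Q%:R + 2.
Proof.
move=> d0 d6.
pose m := (Num.truncn (3 * d * Q%:R)).+1.
have dQ : 0 <= 3 * d * Q%:R by rewrite !mulr_ge0 // ltW.
have m1 : 3 * d * Q%:R < m%:R by exact: truncnS_gt.
have m2 : m%:R <= 3 * d * Q%:R + 1 by rewrite /m -natr1 lerD2r truncn_le.
clearbody m.
apply: (@le_trans _ _ (\sum_(0 <= r < Q) (((r < m)%N)%:R + ((Q - m < r)%N)%:R))).
  rewrite big_mkcond !big_nat; apply: ler_sum => r /andP[_ rQ].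
  case: ifP => [|_]; last by rewrite addr_ge0.
  rewrite /near_integer => /orP[h|h].
    have -> : (r < m)%N by rewrite -(ltr_nat R); move: h; rewrite ltr_pdivrMr //; lra.
    by rewrite lerDl.
  have -> : (Q - m < r)%N.
    rewrite -(ltr_nat R); have [mQ|Qm] := leqP m Q.
      by rewrite natrB //; move: h; rewrite ltr_pdivlMr //; lra.
    have -> : (Q - m = 0)%N by apply/eqP; rewrite subn_eq0 ltnW.
    have : 0 < r%:R / Q%:R :> R by lra.
    by rewrite pmulr_lgt0 ?invr_gt0.
  by rewrite lerDr.
rewrite big_split /= -!natr_sum.
have c1 : (\sum_(0 <= r < Q) (r < m)%N <= m)%N.
  have -> : (\sum_(0 <= r < Q) (r < m)%N = count (fun r => r < m)%N (iota 0 Q))%N.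
    by rewrite -sum1_count [RHS]big_mkcond /= /index_iota subn0; apply: eq_bigr => i _; case: ifP.
  rewrite -size_filter -{2}(size_iota 0 m); apply: uniq_leq_size; first by rewrite filter_uniq // iota_uniq.
  by move=> x; rewrite mem_filter !mem_iota; lia.
have c2 : (\sum_(0 <= r < Q) (Q - m < r)%N <= m)%N.
  have -> : (\sum_(0 <= r < Q) (Q - m < r)%N = count (fun r => Q - m < r)%N (iota 0 Q))%N.
    by rewrite -sum1_count [RHS]big_mkcond /= /index_iota subn0; apply: eq_bigr => i _; case: ifP.
  rewrite -size_filter -{2}(size_iota (Q - m) m); apply: uniq_leq_size; first by rewrite filter_uniq // iota_uniq.
  by move=> x; rewrite mem_filter !mem_iota; lia.
rewrite -natrD; apply: (@le_trans _ _ (m + m)%:R); first by rewrite ler_nat leq_add.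
rewrite natrD; lra.
Qed.

(** The twist e(- th * frac y), expanded over the kernels, turns e(th * y) into e(th * floor y). On
    the Lebesgue side it is exact: at q + r / Q the twist by e(- th * r / Q) gives e(th * q), for
    each of the [Q] nodes. *)
Lemma floor_comparison th d : `|th| <= 1 / 2 -> 0 < d -> d <= 1 / 6 ->
  cabs (\sum_(i <- s) (w i)%:C%C * cis (th * (Num.floor (yy i))%:~R) - \sum_(0 <= q < Y) cis (th * q%:R)) <=
  (8 * d + 2 * (Q%:R * d ^+ 2)^-1) * (\sum_(i <- s) w i) +
  2 * (6 * d * Q%:R + 2) * (Y%:R / Q%:R + e') + Q%:R * e'.
Proof.
move=> hth d0 d6; have d4 : d <= 1 / 4 by lra.
pose sg y : R[i] := \sum_(0 <= r < Q) cis (- (th * (r%:R / Q%:R))) * (fejer Q r y)%:C%C.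
pose mid := \sum_(i <- s) (w i)%:C%C * (cis (th * yy i) * sg (yy i)).
have h1 : cabs (\sum_(i <- s) (w i)%:C%C * cis (th * (Num.floor (yy i))%:~R) - mid) <=
   (8 * d + 2 * (Q%:R * d ^+ 2)^-1) * (\sum_(i <- s) w i) + 2 * (6 * d * Q%:R + 2) * (Y%:R / Q%:R + e').
  rewrite /mid -sumrB; apply: le_trans (cabs_sum _ _ _) _.
  apply: (@le_trans _ _ (\sum_(i <- s) w i * (8 * d + 2 * (Q%:R * d ^+ 2)^-1 +
       2 * \sum_(0 <= r < Q | near_integer d r) fejer Q r (yy i)))).
    apply: ler_sum => i _; rewrite -mulrBr cabsM cabs_real ger0_norm // ler_wpM2l //.
    have -> : cis (th * (Num.floor (yy i))%:~R) = cis (th * yy i) * cis (- (th * frac_part (yy i))).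
      by rewrite -cisD /frac_part; congr cis; ring.
    by rewrite -mulrBr cabsM cabs_cis mul1r; exact: approx_pointwise.
  under eq_bigr do rewrite mulrDr.
  rewrite big_split /= -mulr_suml mulrC lerD2l.
  have -> : \sum_(i <- s) w i * (2 * \sum_(0 <= r < Q | near_integer d r) fejer Q r (yy i)) =
    2 * \sum_(0 <= r < Q | near_integer d r) \sum_(i <- s) w i * fejer Q r (yy i).
    rewrite exchange_big mulr_sumr; apply: eq_bigr => i _; rewrite mulrCA; congr (_ * _).
    by rewrite mulr_sumr.
  rewrite -mulrA ler_pM2l //.
  apply: (@le_trans _ _ (\sum_(0 <= r < Q | near_integer d r) 1 * (Y%:R / Q%:R + e'))).
    rewrite big_nat_cond [leRHS]big_nat_cond; apply: ler_sum => r /andP[/andP[_ rQ] _].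
    by rewrite mul1r; exact: fejer_mass.
  rewrite -mulr_suml ler_wpM2r ?addr_ge0 ?divr_ge0 //; exact: card_near_integer.
have h2 : cabs (mid - \sum_(0 <= q < Y) cis (th * q%:R)) <= Q%:R * e'.
  have -> : mid = \sum_(0 <= r < Q) cis (- (th * (r%:R / Q%:R))) *
     \sum_(i <- s) (w i)%:C%C * (cis (th * yy i) * (fejer Q r (yy i))%:C%C).
    rewrite /mid /sg; under eq_bigr do rewrite mulr_sumr mulr_sumr.
    rewrite exchange_big; apply: eq_bigr => r _; rewrite mulr_sumr; apply: eq_bigr => i _; ring.
  have -> : \sum_(0 <= q < Y) cis (th * q%:R) = \sum_(0 <= r < Q) cis (- (th * (r%:R / Q%:R))) *
     ((Q%:R^-1 : R)%:C%C * \sum_(0 <= q < Y) cis (th * (q%:R + r%:R / Q%:R))).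
    transitivity (\sum_(0 <= r < Q) (Q%:R^-1 : R)%:C%C * \sum_(0 <= q < Y) cis (th * q%:R)).
      have E1 : (Q%:R^-1 : R)%:C%C *+ Q = 1.
        by rewrite -rmorphMn -[_ *+ Q]mulr_natl mulfV ?gt_eqF // rmorph1.
      by rewrite big_const_nat iter_addr_0 subn0 -mulrnAl E1 mul1r.
    apply: eq_bigr => r _; rewrite mulrCA; congr (_ * _); rewrite mulr_sumr; apply: eq_bigr => q _.
    by rewrite -cisD; congr cis; ring.
  rewrite -sumrB; apply: le_trans (cabs_sum _ _ _) _.
  apply: (@le_trans _ _ (\sum_(0 <= r < Q) e')); last first.
    by rewrite big_const_nat iter_addr_0 subn0 -[leLHS]mulr_natl.
  rewrite !big_nat; apply: ler_sum => r /andP[_ rQ].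
  by rewrite -mulrBr cabsM cabs_cis mul1r; exact: fejer_comparison.
set X := \sum_(i <- s) _ in h1 *; set Z := \sum_(0 <= q < Y) _ in h2 *.
have -> : X - Z = (X - mid) + (mid - Z) by ring.
by apply: le_trans (cabsD _ _) _; apply: lerD.
Qed.
End Comparison.
End Fejer.

(** * From exponential sums to integer parts *)

Section Transfer.
Context {R : realType}.

(** To first order e(ka * y (n + 1)) - e(ka * y n) is 2 pi i ka times the increment times e(ka * y
    n). The quadratic error is at most 128 ka ^ 2 m times the increment, and increments
    telescope. *)
Lemma telescope_cis (y : nat -> R) (ka m : R) a b : (a <= b)%N ->
  (forall n, (a <= n < b)%N -> 0 <= y n.+1 - y n <= m) ->
  cabs ((0 +i* (2 * pi * ka))%C * (\sum_(a <= n < b) (y n.+1 - y n)%:C%C * cis (ka * y n)) -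
    (cis (ka * y b) - cis (ka * y a))) <= 128 * ka ^+ 2 * m * (y b - y a).
Proof.
move=> ab hm; rewrite -(@telescope_sumr _ a b (fun n => cis (ka * y n))) // mulr_sumr -sumrB.
rewrite -(@telescope_sumr _ a b y) // mulr_sumr.
apply: le_trans (cabs_sum _ _ _) _; rewrite !big_nat; apply: ler_sum => n /hm/andP[v0 vm].
set v := y n.+1 - y n in v0 vm *.
have -> : ka * y n.+1 = ka * y n + ka * v by rewrite /v; ring.
have -> : (0 +i* (2 * pi * ka))%C * (v%:C%C * cis (ka * y n)) - (cis (ka * y n + ka * v) - cis (ka * y n)) =
   - (cis (ka * y n) * (cis (ka * v) - 1 - (0 +i* (2 * pi * (ka * v)))%C)).
  have -> : (0 +i* (2 * pi * (ka * v)))%C = (0 +i* (2 * pi * ka))%C * v%:C%C by simpc; congr (_ +i* _)%C; ring.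
  rewrite cisD; ring.
rewrite cabsN cabsM cabs_cis mul1r; apply: le_trans (cis_taylor _) _.
rewrite (_ : 128 * (ka * v) ^+ 2 = 128 * ka ^+ 2 * (v * v)); last by ring.
rewrite -[leRHS]mulrA; apply: ler_wpM2l; first by rewrite mulr_ge0 // sqr_ge0.
exact: ler_wpM2r.
Qed.

(** The Riemann sum with step 1 / Q of the integral of e(ka * t) over [0, Y]. *)
Definition lebesgue_sum Q Y (ka : R) : R[i] := (Q%:R^-1 : R)%:C%C * \sum_(0 <= i < Q * Y) cis (ka * (i%:R / Q%:R)).

Lemma lebesgue_sumN Q Y ka : lebesgue_sum Q Y (- ka) = conjc (lebesgue_sum Q Y ka).
Proof.
rewrite /lebesgue_sum conjcM (raddf_sum conjc); congr (_ * _); first by rewrite /= oppr0.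
by apply: eq_bigr => i _; rewrite mulNr cisN.
Qed.

Lemma lebesgue_sumE Q Y ka : lebesgue_sum Q Y ka =
  \sum_(0 <= i < Q * Y) (i.+1%:R / Q%:R - i%:R / Q%:R : R)%:C%C * cis (ka * (i%:R / Q%:R)).
Proof.
rewrite /lebesgue_sum mulr_sumr; apply: eq_bigr => i _; congr (_%:C%C * _).
by rewrite -mulrBl -natr1 addrC addKr mul1r.
Qed.

(** A geometric sum with ratio e(ka / Q). The upper limit on [ka] keeps ka / Q away from 1, which
    accounts for the summand 2. *)
Lemma lebesgue_sum_le Q Y (ka : R) : (0 < Q)%N -> 0 < ka -> ka <= Q%:R - 1 / 2 ->
  cabs (lebesgue_sum Q Y ka) <= ka^-1 + 2.
Proof.
move=> Q0 k0 kQ; have QR : 0 < Q%:R :> R by rewrite ltr0n.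
pose m := Num.min ka (1 / 2); have m0 : 0 < m by rewrite lt_min k0 /=; lra.
have mk : m <= ka by rewrite ge_min lexx.
have m2 : m <= 1 / 2 by rewrite ge_min lexx orbT.
have mV : m^-1 <= ka^-1 + 2.
  have kV : 0 < ka^-1 by rewrite invr_gt0.
  have [h|h] := leP ka (1 / 2); first by rewrite /m min_l //; lra.
  rewrite /m min_r ?(ltW h) // (_ : (1 / 2)^-1 = 2); last by rewrite div1r invrK.
  lra.
clearbody m.
have h1 : m / Q%:R <= `|ka / Q%:R|.
  by rewrite ger0_norm ?divr_ge0 ?(ltW k0) // ler_pM2r // invr_gt0.
have h2 : `|ka / Q%:R| <= 1 - m / Q%:R.
  rewrite ger0_norm ?divr_ge0 ?(ltW k0) // ler_pdivrMr // mulrBl mul1r divfK ?gt_eqF //; lra.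
have h0 : 0 <= m / Q%:R by rewrite divr_ge0 // ltW.
have low := cis_subr1_ge' h0 h1 h2.
rewrite /lebesgue_sum cabsM cabs_real ger0_norm ?invr_ge0 //.
have E := congr1 cabs (cis_geo (ka / Q%:R) (Q * Y)); rewrite cabsM in E.
have le2 : cabs (cis ((Q * Y)%:R * (ka / Q%:R)) - 1) <= 2.
  by apply: le_trans (cabsB _ _) _; rewrite cabs_cis cabs1.
have SE : \sum_(0 <= i < Q * Y) cis (ka * (i%:R / Q%:R)) = \sum_(0 <= j < Q * Y) cis (j%:R * (ka / Q%:R)).
  by apply: eq_bigr => i _; congr cis; ring.
rewrite -E -SE in le2; set S := cabs (\sum_(0 <= i < _) _) in le2 *.
have S0 : 0 <= S := cabs_ge0 _.
have := le_trans (ler_wpM2r S0 low) le2.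
rewrite (_ : 2 * (m / Q%:R) * S = 2 * (m * (Q%:R^-1 * S))); last by ring.
rewrite -[X in _ <= X]mulr1 ler_pM2l // mulrC -ler_pdivlMr // div1r => h.
exact: le_trans mV.
Qed.

Lemma cabs_im (x : R) : cabs (0 +i* x)%C = `|x|.
Proof. by rewrite /cabs /= expr0n /= add0r sqrtr_sqr. Qed.

Lemma cis_periodic (th : R) (k m : int) : cis ((th - k%:~R) * m%:~R) = cis (th * m%:~R).
Proof. by rewrite mulrBl -rmorphM /= cisBint. Qed.

Variables (al : nat -> R) (n0 : nat).
Local Notation v n := (al n.+1 - al n).
Hypothesis al_gt0 : forall n, (n0 <= n)%N -> 0 < al n.
Hypothesis al_mono : forall m n, (n0 <= m)%N -> (m <= n)%N -> al m <= al n.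
Hypothesis al_infty : forall B : R, exists N0 : nat, forall N, (N0 <= N)%N -> B <= al N.
Hypothesis al_step : forall eps : R, 0 < eps -> exists N0 : nat, forall N, (N0 <= N)%N ->
  forall n, (n0 <= n < N)%N -> v n <= eps * al N.

Definition increment_sum N (ka : R) : R[i] := \sum_(n0 <= n < N) (v n)%:C%C * cis (ka * al n).

Hypothesis increment_weyl : forall eps K : R, 0 < eps -> 0 < K ->
  exists (B : R) (N0 : nat), forall N (ka : R), (N0 <= N)%N -> 0 < ka -> ka <= K ->
    B <= ka * al N -> cabs (increment_sum N ka) <= eps * al N.

Lemma increment_sumN N ka : increment_sum N (- ka) = conjc (increment_sum N ka).
Proof.
rewrite /increment_sum (raddf_sum conjc); apply: eq_bigr => n _.
rewrite -[RHS]/(conjc (_ * _)).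
by rewrite mulNr cisN conjcM /= oppr0.
Qed.

Lemma sum_increments N : (n0 <= N)%N -> \sum_(n0 <= n < N) v n = al N - al n0.
Proof. by move=> nN; rewrite telescope_sumr. Qed.

(** Both sums, times 2 pi i ka, nearly telescope to the values of e(ka * t) at the ends of their
    ranges; these ends differ by less than 1 at the top and by al n0 at the bottom. At ka = 0, where
    division is impossible, both sums are lengths. *)
Lemma increment_lebesgue_low N Q (ka m : R) (Y := Num.truncn (al N)) : (n0 <= N)%N -> (0 < Q)%N -> 0 <= ka ->
  0 <= m ->
  (forall n, (n0 <= n < N)%N -> v n <= m) ->
  cabs (increment_sum N ka - lebesgue_sum Q Y ka) <= 32 * (ka * al N) * (m + 1) + 4 * (1 + al n0).
Proof.
move=> nN Q0 k0 m0 hm; have QR : 0 < Q%:R :> R by rewrite ltr0n.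
have aN := al_gt0 nN; have a0 := al_gt0 (leqnn n0); have an := al_mono (leqnn n0) nN.
have Y1 : Y%:R <= al N by rewrite truncn_le // ltW.
have Y2 : al N < Y%:R + 1 by rewrite natr1; exact: truncnS_gt.
have v0 n : (n0 <= n < N)%N -> 0 <= v n by move=> /andP[n1 _]; rewrite subr_ge0; exact: al_mono.
have [kz|kz] := eqVneq ka 0.
  have -> : increment_sum N ka = (al N - al n0)%:C%C.
    rewrite -sum_increments // (raddf_sum (real_complex R)); apply: eq_bigr => n _.
    by rewrite kz mul0r cis0 mulr1.
  have -> : lebesgue_sum Q Y ka = (Y%:R : R)%:C%C.
    rewrite lebesgue_sumE.
    transitivity (\sum_(0 <= i < Q * Y) (i.+1%:R / Q%:R - i%:R / Q%:R : R)%:C%C).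
      by apply: eq_bigr => i _; rewrite kz mul0r cis0 mulr1.
    rewrite -(raddf_sum (real_complex R)) (telescope_sumr (fun i : nat => i%:R / Q%:R : R)) //.
    by rewrite mul0r subr0 natrM mulrC mulKf // gt_eqF.
  rewrite -rmorphB cabs_real kz mul0r mulr0 mul0r add0r ler_norml; apply/andP; split; lra.
have {kz}k0 : 0 < ka by rewrite lt_neqAle eq_sym kz.
have h1 := @telescope_cis al ka m n0 N nN.
have {}h1 := h1 _.
have /h1 {}h1 : forall n, (n0 <= n < N)%N -> 0 <= v n <= m.
  by move=> n hn; rewrite v0 // hm.
have h2 := @telescope_cis (fun i => i%:R / Q%:R) ka Q%:R^-1 0 (Q * Y)%N (leq0n _).
have st : forall n, (0 <= n < Q * Y)%N -> (0 <= n.+1%:R / Q%:R - n%:R / Q%:R :> R) && (n.+1%:R / Q%:R - n%:R / Q%:R <= Q%:R^-1 :> R).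
  by move=> n _; rewrite -mulrBl -natr1 (addrC n%:R) addrK mul1r lexx invr_ge0 ltW.
have {}h2 := h2 st.
rewrite -lebesgue_sumE mul0r mulr0 cis0 subr0 in h2.
have yE : (Q * Y)%:R / Q%:R = Y%:R :> R by rewrite natrM mulrC mulKf // gt_eqF.
rewrite yE in h2.
have pi1 : 2 <= pi :> R by exact: pi_ge2.
set c := (0 +i* (2 * pi * ka))%C in h1 h2.
have ca : cabs c = 2 * pi * ka by rewrite cabs_im ger0_norm // !mulr_ge0 //; lra.
set nu := increment_sum N ka; set la := lebesgue_sum Q Y ka.
rewrite -/(increment_sum N ka) -/nu in h1; rewrite -/la in h2.
have l1 := cis_lip (ka * al N) (ka * Y%:R); have l2 := cis_lip (ka * al n0) 0.
rewrite cis0 subr0 in l2.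
have n1 : `|ka * al N - ka * Y%:R| <= ka * 1.
  by rewrite -mulrBr normrM gtr0_norm // ler_pM2l // ger0_norm; lra.
have n2 : `|ka * al n0| = ka * al n0 by rewrite ger0_norm // mulr_ge0 // ltW.
have tri : cabs (c * (nu - la)) <= 128 * ka ^+ 2 * m * (al N - al n0) + 128 * ka ^+ 2 / Q%:R * Y%:R +
    16 * (ka * 1) + 16 * (ka * al n0).
  have -> : c * (nu - la) = (c * nu - (cis (ka * al N) - cis (ka * al n0))) -
     (c * la - (cis (ka * Y%:R) - 1)) + (cis (ka * al N) - cis (ka * Y%:R)) - (cis (ka * al n0) - 1).
    ring.
  apply: le_trans (cabsB _ _) _; apply: lerD; last by apply: le_trans l2 _; rewrite n2.
  apply: le_trans (cabsD _ _) _; apply: lerD; last by apply: le_trans l1 _; rewrite ler_pM2l.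
  by apply: le_trans (cabsB _ _) _; apply: lerD.
rewrite cabsM ca in tri.
have D0 := cabs_ge0 (nu - la).
have Q1 : Q%:R^-1 <= 1 :> R by rewrite invf_le1 // ler1n.
have s1 : ka ^+ 2 * m * (al N - al n0) <= ka ^+ 2 * m * al N.
  by apply: ler_wpM2l; [rewrite mulr_ge0 // sqr_ge0 | lra].
have s2 : ka ^+ 2 / Q%:R * Y%:R <= ka ^+ 2 * al N.
  rewrite -mulrA; apply: ler_wpM2l; first exact: sqr_ge0.
  by apply: le_trans Y1; rewrite ler_piMl.
have s3 : 4 * (ka * cabs (nu - la)) <= 2 * pi * ka * cabs (nu - la).
  by rewrite -[2 * pi * ka * _]mulrA; apply: ler_wpM2r; [apply: mulr_ge0 => //; exact: ltW | lra].
rewrite -(ler_pM2l k0).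
have -> : ka * (32 * (ka * al N) * (m + 1) + 4 * (1 + al n0)) =
   32 * (ka ^+ 2 * m * al N) + 32 * (ka ^+ 2 * al N) + 4 * (ka * 1) + 4 * (ka * al n0) by ring.
lra.
Qed.

Lemma increment_lebesgue Q (eps : R) : (0 < Q)%N -> 0 < eps ->
  exists N0 : nat, forall N (ka : R), (N0 <= N)%N -> `|ka| <= Q%:R - 1 / 2 ->
    cabs (increment_sum N ka - lebesgue_sum Q (Num.truncn (al N)) ka) <= eps * al N.
Proof.
move=> Q0 eps0; have QR : 0 < Q%:R :> R by rewrite ltr0n.
suff [N0 h] : exists N0 : nat, forall N (ka : R), (N0 <= N)%N -> 0 <= ka -> ka <= Q%:R - 1 / 2 ->
    cabs (increment_sum N ka - lebesgue_sum Q (Num.truncn (al N)) ka) <= eps * al N.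
  exists N0 => N ka NN hka; have [k0|k0] := leP 0 ka; first by apply: h => //; rewrite -[ka]ger0_norm.
  have cjB (x y : R[i]) : conjc (x - y) = conjc x - conjc y by exact: raddfB.
  rewrite -cabs_conj cjB -increment_sumN -lebesgue_sumN; apply: h => //.
    by rewrite oppr_ge0 ltW.
  by rewrite -[- ka]ger0_norm ?normrN // oppr_ge0 ltW.
have e4 : 0 < eps / 4 by rewrite divr_gt0.
have [B0 [N1 h1]] := increment_weyl e4 QR.
(* Above [B] the two sums are small separately, the second entry giving 1 / ka <= eps / 4 * al N;
   below it the low frequency comparison applies. *)
pose B := Num.max B0 (4 / eps).
have B1 : B0 <= B by rewrite le_max lexx.
have B2 : 4 / eps <= B by rewrite le_max lexx orbT.
have Bp : 0 < B by apply: lt_le_trans B2; rewrite divr_gt0.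
clearbody B.
have eta0 : 0 < eps / (128 * B) by rewrite divr_gt0 // mulr_gt0.
have [N2 h2] := al_step eta0.
have [N3 h3] := al_infty (8 / eps).
have [N4 h4] := al_infty ((32 * B + 4 * (1 + al n0)) * (4 / eps)).
exists (maxn (maxn N1 N2) (maxn (maxn N3 N4) n0)) => N ka; rewrite !geq_max.
move=> /andP[/andP[g1 g2] /andP[/andP[g3 g4] g0]] k0 kQ.
have aN := al_gt0 g0.
have {}h3 := h3 _ g3; have {}h4 := h4 _ g4.
rewrite ler_pdivrMr // in h3; rewrite mulrA ler_pdivrMr // in h4.
have [big|small] := leP B (ka * al N).
  have kp : 0 < ka.
    rewrite lt_neqAle eq_sym k0 andbT; apply/negP => /eqP kz.
    by move: big; rewrite kz mul0r leNgt Bp.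
  have n1 := h1 N ka g1 kp; have {}n1 : cabs (increment_sum N ka) <= eps / 4 * al N.
    by apply: n1; [lra | exact: le_trans big].
  have n2 := lebesgue_sum_le (Num.truncn (al N)) Q0 kp kQ.
  have n3 : ka^-1 <= eps / 4 * al N.
    rewrite -div1r ler_pdivrMr //.
    have : eps / 4 * (4 / eps) <= eps / 4 * (ka * al N) by rewrite ler_pM2l //; lra.
    by rewrite (_ : eps / 4 * (4 / eps) = 1); [lra | field; rewrite gt_eqF].
  apply: le_trans (cabsB _ _) _; lra.
have hm : forall n, (n0 <= n < N)%N -> v n <= eps / (128 * B) * al N by exact: h2.
have m0 : 0 <= eps / (128 * B) * al N by apply: mulr_ge0; exact: ltW.
have := increment_lebesgue_low g0 Q0 k0 m0 hm.
have s1 : ka * al N * (eps / (128 * B) * al N + 1) <= B * (eps / (128 * B) * al N + 1).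
  by rewrite ler_wpM2r ?ltW //; lra.
have s2 : B * (eps / (128 * B) * al N + 1) = eps / 128 * al N + B by field; rewrite gt_eqF.
rewrite s2 in s1; move: s1; rewrite -(mulrA 32); lra.
Qed.

Lemma increment_floor (eps : R) : 0 < eps ->
  exists N0 : nat, forall N (th : R), (N0 <= N)%N ->
    cabs (\sum_(n0 <= n < N) (v n)%:C%C * cis (th * (Num.truncn (al n))%:R) -
          \sum_(0 <= q < Num.truncn (al N)) cis (th * q%:R)) <= eps * al N.
Proof.
move=> eps0.
(* With Q >= 2 / de ^ 3 and error de / Q, the three terms of [floor_comparison] are at most 9 de, 28
   de and de times al N. *)
pose de := Num.min (1 / 6) (eps / 100).
have de0 : 0 < de by rewrite lt_min divr_gt0 //=; lra.
have de6 : de <= 1 / 6 by rewrite ge_min lexx.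
have dee : de <= eps / 100 by rewrite ge_min lexx orbT.
clearbody de.
have [Q' hQ'] := nat_ge_exists (2 / de ^+ 3).
pose Q := Q'.+1; have {hQ'}hQ : 2 / de ^+ 3 <= Q%:R by apply: hQ'.
have Q0 : (0 < Q)%N by []; clearbody Q.
have QR : 0 < Q%:R :> R by rewrite ltr0n.
have d3 : 0 < de ^+ 3 by rewrite exprn_gt0.
have q1 : 2 <= de ^+ 3 * Q%:R by rewrite mulrC -ler_pdivrMr.
have q2 : 2 * (Q%:R * de ^+ 2)^-1 <= de.
  by rewrite ler_pdivrMr ?mulr_gt0 ?exprn_gt0 //; lra.
have q3 : 2 <= de * Q%:R.
  apply: le_trans q1 _; rewrite ler_pM2r // exprS; apply: ler_piMr; first exact: ltW.
  by apply: exprn_ile1; [exact: ltW | lra].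
have e'0 : 0 < de / Q%:R by rewrite divr_gt0.
have [N1 h1] := increment_lebesgue Q0 e'0.
exists (maxn N1 n0) => N th; rewrite geq_max => /andP[g1 g0].
have aN := al_gt0 g0; have a0 := al_gt0 (leqnn n0); have an := al_mono (leqnn n0) g0.
set Y := Num.truncn (al N).
have Y1 : Y%:R <= al N by rewrite truncn_le // ltW.
(* Only integers are multiplied by [th], so it may be reduced modulo 1. *)
pose k := Num.floor (th + 1 / 2); pose t := th - k%:~R.
have ht : `|t| <= 1 / 2.
  have /andP[] : k%:~R <= th + 1 / 2 < (k + 1)%:~R by rewrite /k ge_floor // floorD1_gt.
  by rewrite rmorphD /= ler_norml /t => *; apply/andP; split; lra.
have shift (V : nmodType) (G : nat -> V) : \sum_(n0 <= n < N) G n = \sum_(0 <= i < N - n0) G (i + n0)%N.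
  by rewrite -{1}(add0n n0) big_addn.
have comp (ka : R) : `|ka| <= Q%:R - 1 / 2 ->
  cabs (\sum_(i <- index_iota 0 (N - n0)) (v (i + n0)%N)%:C%C * cis (ka * al (i + n0)%N) -
        (Q%:R^-1 : R)%:C%C * \sum_(0 <= i < Q * Y) cis (ka * (i%:R / Q%:R))) <= de / Q%:R * al N.
  move=> hka; have := h1 N ka g1 hka; by rewrite /increment_sum shift.
have v0 (i : nat) : 0 <= v (i + n0)%N.
  by rewrite subr_ge0 al_mono // leq_addl.
have e0 : 0 <= de / Q%:R * al N by apply: mulr_ge0; exact: ltW.
have := floor_comparison Q0 v0 e0 comp ht de0 de6.
have -> : \sum_(i <- index_iota 0 (N - n0)) v (i + n0)%N = al N - al n0.
  by rewrite -sum_increments // shift.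
have -> : \sum_(i <- index_iota 0 (N - n0)) (v (i + n0)%N)%:C%C * cis (t * (Num.floor (al (i + n0)%N))%:~R) =
   \sum_(n0 <= n < N) (v n)%:C%C * cis (th * (Num.truncn (al n))%:R).
  rewrite shift; apply: eq_bigr => i _; congr (_ * _).
  have ai : 0 <= al (i + n0)%N by apply/ltW/al_gt0; rewrite leq_addl.
  by rewrite /t cis_periodic truncn_floor ai natr_absz ger0_norm // floor_ge0.
have -> : \sum_(0 <= q < Y) cis (t * q%:R) = \sum_(0 <= q < Y) cis (th * q%:R).
  by apply: eq_bigr => q _; rewrite /t [q%:R]pmulrn cis_periodic.
move=> h; apply: le_trans h _.
have r1 : (8 * de + 2 * (Q%:R * de ^+ 2)^-1) * (al N - al n0) <= 9 * de * al N.
  have i0 : 0 <= 2 * (Q%:R * de ^+ 2)^-1 by rewrite mulr_ge0 // invr_ge0 mulr_ge0 // sqr_ge0.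
  by apply: ler_pM; lra.
have r2 : Q%:R * (de / Q%:R * al N) = de * al N by field; rewrite gt_eqF.
have r3 : 2 * (6 * de * Q%:R + 2) * (Y%:R / Q%:R + de / Q%:R * al N) <= 28 * de * al N.
  have -> : Y%:R / Q%:R + de / Q%:R * al N = (Y%:R + de * al N) / Q%:R by field; rewrite gt_eqF.
  rewrite mulrA ler_pdivrMr //.
  have -> : 28 * de * al N * Q%:R = (14 * (de * Q%:R)) * (2 * al N) by ring.
  have d1 : de * al N <= 1 * al N by rewrite ler_pM2r //; lra.
  have dd : 0 <= de * al N by apply: mulr_ge0; exact: ltW.
  have dQ : 0 <= de * Q%:R by apply: mulr_ge0; exact: ltW.
  have YR : 0 <= Y%:R :> R by [].
  clear r1 r2 q1 q2 e0 e'0 hQ.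
  by apply: ler_pM; lra.
rewrite r2.
have r4 : de * al N <= eps / 100 * al N by rewrite ler_pM2r.
have r5 : 0 <= eps * al N by apply: mulr_ge0; exact: ltW.
apply: (le_trans (lerD (lerD r1 r3) (lexx _))); clear r1 r2 r3.
lra.
Qed.

Variable d : nat -> R.
Hypothesis al_deriv : forall eps : R, 0 < eps -> exists N0 : nat, forall N, (N0 <= N)%N ->
  \sum_(n0 <= n < N) `|d n - v n| + `|d N| <= eps * al N.
Hypothesis n00 : (0 < n0)%N.

Lemma derivative_floor (eps : R) : 0 < eps ->
  exists N0 : nat, forall N (th : R), (N0 <= N)%N ->
    cabs (\sum_(1 <= n < N.+1) (d n)%:C%C * cis (th * (Num.truncn (al n))%:R) -
          \sum_(1 <= m < (Num.truncn (al N)).+1) cis (th * m%:R)) <= eps * al N.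
Proof.
move=> eps0; have e3 : 0 < eps / 3 by rewrite divr_gt0.
have [N1 h1] := increment_floor e3.
have [N2 h2] := al_deriv e3.
have [N3 h3] := al_infty ((\sum_(1 <= n < n0) `|d n| + 2) * (3 / eps)).
exists (maxn (maxn N1 N2) (maxn N3 n0)) => N th; rewrite !geq_max.
move=> /andP[/andP[/h1 {}h1 /h2 {}h2] /andP[/h3 {}h3 g0]]; move: (h1 th) => {}h1.
rewrite mulrA ler_pdivrMr // in h3.
set Y := Num.truncn (al N) in h1 *.
pose z n := cis (th * (Num.truncn (al n))%:R).
rewrite big_nat_recr ?(leq_trans n00) //= (@big_cat_nat _ _ _ n0) //=.
(* The comparison runs over 0 <= q < Y, the average over 1 <= m <= Y; the shift costs one term at
   each end. *)
have E : \sum_(1 <= m < Y.+1) cis (th * m%:R) = \sum_(0 <= q < Y) cis (th * q%:R) + (cis (th * Y%:R) - 1).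
  apply: (@addrI _ (cis (th * 0))); rewrite [LHS](_ : _ = \sum_(0 <= m < Y.+1) cis (th * m%:R)).
    by rewrite big_nat_recr //= mulr0 cis0; ring.
  by rewrite [RHS]big_ltn.
rewrite E; set S0 := \sum_(1 <= i < n0) _; set S1 := \sum_(n0 <= i < N) _.
set S2 := \sum_(n0 <= i < N) _ in h1 *; set S3 := \sum_(0 <= q < Y) _ in h1 *.
have -> : S0 + S1 + (d N)%:C%C * z N - (S3 + (cis (th * Y%:R) - 1)) =
   S0 + (S1 - S2) + (S2 - S3) + (d N)%:C%C * z N - (cis (th * Y%:R) - 1) by ring.
have b0 : cabs S0 <= \sum_(1 <= n < n0) `|d n|.
  apply: le_trans (cabs_sum _ _ _) _; apply: ler_sum => n _.
  by rewrite cabsM cabs_cis mulr1 cabs_real.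
have b1 : cabs (S1 - S2) <= \sum_(n0 <= n < N) `|d n - v n|.
  rewrite /S1 /S2 -sumrB; apply: le_trans (cabs_sum _ _ _) _; apply: ler_sum => n _.
  by rewrite -mulrBl -rmorphB cabsM cabs_cis mulr1 cabs_real.
have b2 : cabs ((d N)%:C%C * z N) = `|d N| by rewrite cabsM cabs_cis mulr1 cabs_real.
have b3 : cabs (cis (th * Y%:R) - 1) <= 2.
  by apply: le_trans (cabsB _ _) _; rewrite cabs_cis cabs1.
apply: le_trans (cabsB _ _) _.
apply: (@le_trans _ _ (cabs S0 + cabs (S1 - S2) + cabs (S2 - S3) + `|d N| + 2)); last by lra.
apply: lerD => //; rewrite -b2; apply: le_trans (cabsD _ _) _; rewrite lerD2r.
apply: le_trans (cabsD _ _) _; rewrite lerD2r; exact: cabsD.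
Qed.
End Transfer.

(** * Increments of alpha against its derivative *)

Section IncrementConditions.
Context {R : realType}.
Variables (al D : nat -> R) (n0 : nat) (M : R).
Local Notation v n := (al n.+1 - al n).
Hypothesis al_gt0 : forall n, (n0 <= n)%N -> 0 < al n.
Hypothesis al_mono : forall m n, (n0 <= m)%N -> (m <= n)%N -> al m <= al n.
Hypothesis al_infty : forall B : R, exists N0 : nat, forall N, (N0 <= N)%N -> B <= al N.
Hypothesis D_ge0 : forall n, (n0 <= n)%N -> 0 <= D n.
Hypothesis D_euler : forall n, (n0 <= n)%N -> n%:R * D n <= M * al n.
Hypothesis D_between : (forall n, (n0 <= n)%N -> D n <= v n <= D n.+1) \/
  (forall n, (n0 <= n)%N -> D n.+1 <= v n <= D n).

Lemma le_from_step (f : nat -> R) : (forall n, (n0 <= n)%N -> f n <= f n.+1) ->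
  forall m n, (n0 <= m)%N -> (m <= n)%N -> f m <= f n.
Proof.
move=> h m n n0m /subnK <-; elim: (n - m)%N => [//|i IH].
by apply: le_trans IH (h _ _); rewrite (leq_trans n0m) // leq_addl.
Qed.

Lemma D_mono : (forall m n, (n0 <= m)%N -> (m <= n)%N -> D m <= D n) \/
  (forall m n, (n0 <= m)%N -> (m <= n)%N -> D n <= D m).
Proof.
case: D_between => h; [left|right] => m n n0m mn.
  by apply: (@le_from_step D) => // i /h/andP[]; exact: le_trans.
rewrite -lerN2; apply: (@le_from_step (fun i => - D i)) => // i /h/andP[h1 h2].
by rewrite lerN2; exact: le_trans h2.
Qed.

Lemma increment_mono : (forall m n, (n0 <= m)%N -> (m <= n)%N -> v m <= v n) \/
  (forall m n, (n0 <= m)%N -> (m <= n)%N -> v n <= v m).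
Proof.
case: D_between => h; [left|right] => m n n0m mn.
  apply: (@le_from_step (fun i => v i)) => // i ni.
  by have /andP[_ h1] := h _ ni; have /andP[h2 _] := h _ (leqW ni); exact: le_trans h2.
rewrite -lerN2; apply: (@le_from_step (fun i => - v i)) => // i ni; rewrite lerN2.
by have /andP[h1 _] := h _ ni; have /andP[_ h2] := h _ (leqW ni); exact: le_trans h1.
Qed.

Lemma D_le n N : (n0 <= n <= N)%N -> D n <= D n0 + D N.
Proof.
move=> /andP[n0n nN]; have p0 := D_ge0 (leqnn n0); have pN := D_ge0 (leq_trans n0n nN).
case: D_mono => h; first by have := h _ _ n0n nN; lra.
have := h _ _ (leqnn n0) n0n; lra.
Qed.

Lemma increment_le n N : (n0 <= n < N)%N -> v n <= D n0 + D N.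
Proof.
move=> /andP[n0n nN].
have d1 : D n <= D n0 + D N by apply: D_le; rewrite n0n ltnW.
have d2 : D n.+1 <= D n0 + D N by apply: D_le; rewrite nN leqW.
by case: D_between => h; have /andP[] := h _ n0n; lra.
Qed.

(** By the Euler bound D N is at most M * al N / N, and the constant D n0 is absorbed because al
    tends to infinity. *)
Lemma D_negligible (eps : R) : 0 < eps ->
  exists N0 : nat, forall N, (N0 <= N)%N -> D n0 + 2 * D N <= eps * al N.
Proof.
move=> eps0; have [N1 h1] := al_infty (D n0 * (2 / eps)).
have [N2 h2] := nat_ge_exists (4 * M / eps).
exists (maxn (maxn N1 N2) n0.+1) => N; rewrite !geq_max => /andP[/andP[/h1 {}h1 /h2 {}h2] g0].
have aN := al_gt0 (ltnW g0); have eu := D_euler (ltnW g0).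
have N0 : 0 < N%:R :> R by rewrite ltr0n (leq_ltn_trans _ g0).
rewrite mulrA ler_pdivrMr // in h1; rewrite ler_pdivrMr // in h2.
have : N%:R * (2 * D N) <= N%:R * (eps / 2 * al N).
  have : 4 * M * al N <= N%:R * eps * al N by rewrite ler_pM2r.
  lra.
rewrite ler_pM2l //; lra.
Qed.

Lemma increment_negligible (eps : R) : 0 < eps -> exists N0 : nat, forall N, (N0 <= N)%N ->
  forall n, (n0 <= n < N)%N -> v n <= eps * al N.
Proof.
move=> /D_negligible[N0 h]; exists N0 => N /h {}h n hn; apply: le_trans (increment_le hn) _.
have /andP[h1 h2] := hn; have := D_ge0 (leq_trans h1 (ltnW h2)); lra.
Qed.

(** An increment lies between two consecutive values of the monotone [D], so the errors are
    dominated by a telescoping sum. *)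
Lemma derivative_increment (eps : R) : 0 < eps -> exists N0 : nat, forall N, (N0 <= N)%N ->
  \sum_(n0 <= n < N) `|D n - v n| + `|D N| <= eps * al N.
Proof.
move=> /D_negligible[N0 h]; exists (maxn N0 n0) => N; rewrite geq_max => /andP[/h {}h g0].
have dN := D_ge0 g0; have d0 := D_ge0 (leqnn n0).
rewrite (ger0_norm dN).
suff : \sum_(n0 <= n < N) `|D n - v n| <= D n0 + D N by lra.
case: D_between => hb.
  apply: (@le_trans _ _ (\sum_(n0 <= n < N) (D n.+1 - D n))).
    rewrite !big_nat; apply: ler_sum => n /andP[/hb/andP[h1 h2] _].
    by rewrite ler0_norm; lra.
  rewrite telescope_sumr //; lra.
apply: (@le_trans _ _ (- \sum_(n0 <= n < N) (D n.+1 - D n))).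
  rewrite -sumrN !big_nat; apply: ler_sum => n /andP[/hb/andP[h1 h2] _].
  by rewrite ger0_norm; lra.
rewrite telescope_sumr //; lra.
Qed.

Lemma cabs_increment_sum a b (ka : R) : (n0 <= a <= b)%N ->
  cabs (\sum_(a <= n < b) (v n)%:C%C * cis (ka * al n)) <= al b - al a.
Proof.
move=> /andP[n0a ab]; rewrite -(@telescope_sumr _ a b al) //.
apply: le_trans (cabs_sum _ _ _) _; rewrite !big_nat; apply: ler_sum => n /andP[an _].
rewrite cabsM cabs_cis mulr1 cabs_real ger0_norm // subr_ge0 al_mono //; exact: leq_trans an.
Qed.

Lemma increment_sum_slow (eps K : R) :
  (forall e : R, 0 < e -> exists N0 : nat, forall n, (N0 <= n)%N -> D n <= e) -> 0 < eps -> 0 < K ->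
  exists (B : R) (N0 : nat), forall N (ka : R), (N0 <= N)%N -> 0 < ka -> ka <= K ->
    B <= ka * al N -> cabs (increment_sum al n0 N ka) <= eps * al N.
Proof.
move=> D0 eps0 K0.
(* With increments at most this constant, the error 128 ka ^ 2 m al N of the telescoping is at most
   eps * ka * al N for ka <= K. *)
have del0 : 0 < eps / (128 * K) by rewrite divr_gt0 // mulr_gt0.
have [N1 h1] := D0 _ del0.
pose n1 := maxn N1 n0.
have [N2 h2] := al_infty (al n1 * (4 / eps)).
exists (4 / eps), (maxn N2 n1) => N ka; rewrite geq_max => /andP[/h2 {}h2 g1] k0 kK hB.
have n01 : (n0 <= n1)%N by rewrite leq_maxr.
have aN := al_gt0 (leq_trans n01 g1); have a1 := al_gt0 n01; have a0 := al_gt0 (leqnn n0).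
rewrite mulrA ler_pdivrMr // in h2.
rewrite /increment_sum (@big_cat_nat _ _ _ n1) //=.
have p1 := @cabs_increment_sum n0 n1 ka; rewrite leqnn n01 in p1; have {}p1 := p1 isT.
set m := eps / (128 * K) in h1 del0.
have st : forall n, (n1 <= n < N)%N -> 0 <= v n <= m.
  move=> n /andP[n1n _]; have nn : (n0 <= n)%N by exact: leq_trans n1n.
  have NN : (N1 <= n)%N by apply: leq_trans n1n; rewrite leq_maxl.
  rewrite subr_ge0 al_mono //=.
  have := h1 n NN; have := h1 n.+1 (leqW NN).
  by case: D_between => h; have /andP[] := h n nn; lra.
have tl := telescope_cis ka g1 st.
set S := \sum_(n1 <= n < N) _ in tl *.
have pi1 : 2 <= pi :> R by exact: pi_ge2.
set c := (0 +i* (2 * pi * ka))%C in tl.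
have ca : cabs c = 2 * pi * ka by rewrite cabs_im ger0_norm // !mulr_ge0 //; lra.
have S0 := cabs_ge0 S.
have cS : cabs (c * S) <= 128 * ka ^+ 2 * m * (al N - al n1) + 2.
  have -> : c * S = (c * S - (cis (ka * al N) - cis (ka * al n1))) + (cis (ka * al N) - cis (ka * al n1)) by ring.
  apply: le_trans (cabsD _ _) _; apply: lerD => //.
  by apply: le_trans (cabsB _ _) _; rewrite !cabs_cis.
rewrite cabsM ca in cS.
have s3 : 4 * (ka * cabs S) <= 2 * pi * ka * cabs S.
  by rewrite -[2 * pi * ka * _]mulrA; apply: ler_wpM2r; [apply: mulr_ge0 => //; exact: ltW | lra].
have s1 : ka * (ka * m * (al N - al n1)) <= ka * (K * m * al N).
  have g : 0 <= m * (al N - al n1) by rewrite mulr_ge0 ?(ltW del0) // subr_ge0 al_mono.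
  rewrite ler_pM2l // -(mulrA ka) -(mulrA K); apply: ler_pM => //; first exact: ltW.
  by rewrite ler_pM2l //; lra.
have Km : K * m = eps / 128 by rewrite /m; field; rewrite gt_eqF.
rewrite Km in s1.
have s2 : 4 <= ka * (eps * al N).
  by move: hB; rewrite ler_pdivrMr //; lra.
have sS : cabs S <= eps / 2 * al N by rewrite -(ler_pM2l k0); lra.
apply: le_trans (cabsD _ _) _; lra.
Qed.

Variables (p : nat) (c : R).
Hypothesis al_regular : forall L N, (n0 <= L)%N -> (L <= N)%N -> al N * L%:R ^+ p <= al L * N%:R ^+ p.

(** Summation by parts from unweighted to weighted sums: the increments are monotone and at most C *
    al N / N, so their variation is of that order too. *)
Lemma increment_sum_fast (eps K : R) : (0 < n0)%N -> 0 < c ->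
  (forall n, (n0 <= n)%N -> c * n%:R <= al n) ->
  (forall eps K : R, 0 < eps -> 0 < K ->
    exists (B : R) (N0 : nat), forall N (ka : R), (N0 <= N)%N -> 0 < ka -> ka <= K ->
    B <= ka * al N -> cabs (expsum (fun n => ka * al n) N) <= eps * N%:R) -> 0 < eps -> 0 < K ->
  exists (B : R) (N0 : nat), forall N (ka : R), (N0 <= N)%N -> 0 < ka -> ka <= K ->
    B <= ka * al N -> cabs (increment_sum al n0 N ka) <= eps * al N.
Proof.
move=> n00 c0 hc hW eps0 K0.
have dn0 := D_ge0 (leqnn n0).
have M0 : 0 <= M.
  have := D_euler (leqnn n0); have : 0 <= n0%:R * D n0 by rewrite mulr_ge0.
  move=> h1 /(le_trans h1); rewrite pmulr_lge0 //; exact: al_gt0.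
(* N * v n is at most N * D n0 + N * D N. Linear growth of [al] absorbs the first term, the Euler
   bound the second, and 1 makes [C] positive. *)
pose C := D n0 / c + M + 1.
have C0 : 0 < C by rewrite ltr_wpDl // addr_ge0 // divr_ge0 // ltW.
have vC n N : (n0 <= n < N)%N -> N%:R * v n <= C * al N.
  move=> hn; have /andP[h1 h2] := hn; have h3 := leq_trans h1 (ltnW h2).
  have NR : 0 < N%:R :> R by rewrite ltr0n (leq_ltn_trans _ h2).
  have s1 : N%:R * v n <= N%:R * (D n0 + D N) by rewrite ler_pM2l // increment_le.
  have s2 := D_euler h3.
  have s3 : D n0 / c * (c * N%:R) <= D n0 / c * al N by rewrite ler_wpM2l ?hc // divr_ge0 // ltW.
  have s4 : D n0 / c * (c * N%:R) = D n0 * N%:R by field; rewrite gt_eqF.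
  have aN := al_gt0 h3; rewrite /C; lra.
clearbody C.
have e10 : 0 < eps / (8 * C) by rewrite divr_gt0 // mulr_gt0.
have [B1 [N1 h1]] := hW _ K e10 K0.
pose eta := Num.min (1 / 4) (eps / (8 * C)).
have eta0 : 0 < eta by rewrite lt_min e10 andbT; lra.
have eta4 : eta <= 1 / 4 by rewrite ge_min lexx.
have etae : eta <= eps / (8 * C) by rewrite ge_min lexx orbT.
clearbody eta.
have [N2 h2] := nat_ge_exists ((N1 + n0)%N%:R / eta + eta^-1).
(* Regularity gives al L >= eta ^ p * al N for L >= eta N, so this bound at N yields [B1] at every
   length from L to N. The terms below L are few, each at most C * al N / N. *)
exists (`|B1| / eta ^+ p), (maxn N2 (maxn n0 2)) => N ka; rewrite !geq_max.
move=> /andP[/h2 {}h2 /andP[g0 g2]] k0 kK hB.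
have NR : 0 < N%:R :> R by rewrite ltr0n (leq_trans n00).
have aN := al_gt0 g0.
pose L := (Num.truncn (eta * N%:R)).+1.
have L1 : eta * N%:R <= L%:R by apply/ltW; exact: truncnS_gt.
have L2 : L%:R <= eta * N%:R + 1.
  by rewrite /L -natr1 lerD2r truncn_le // mulr_ge0 // ltW.
clearbody L.
have etaN : (N1 + n0)%N%:R + 1 <= eta * N%:R.
  have := h2; rewrite -(ler_pM2l eta0).
  rewrite (_ : eta * ((N1 + n0)%:R / eta + eta^-1) = (N1 + n0)%:R + 1) //.
  by field; rewrite gt_eqF.
have LN1 : (N1 + n0 <= L)%N by rewrite -(ler_nat R); lra.
have NL1 : (N1 <= L)%N by apply: leq_trans LN1; rewrite leq_addr.
have NL0 : (n0 <= L)%N by apply: leq_trans LN1; rewrite leq_addl.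
have N2R : 2 <= N%:R :> R by rewrite (ler_nat R 2).
have LN : (L < N)%N.
  rewrite -(ltr_nat R); have : eta * N%:R <= 1 / 4 * N%:R by rewrite ler_pM2r.
  lra.
have BL : B1 <= ka * al L.
  have s1 : B1 <= ka * al N * eta ^+ p.
    apply: le_trans (ler_norm _) _; rewrite -ler_pdivrMr //; exact: exprn_gt0.
  apply: le_trans s1 _; rewrite -mulrA ler_pM2l //.
  have := al_regular NL0 (ltnW LN).
  have s2 : (eta * N%:R) ^+ p <= L%:R ^+ p.
    by rewrite lerXn2r // nnegrE // mulr_ge0 // ltW.
  have : al N * (eta * N%:R) ^+ p <= al N * L%:R ^+ p by rewrite ler_pM2l.
  rewrite exprMn mulrA => s3 s4.
  have := le_trans s3 s4; rewrite ler_pM2r //; exact: exprn_gt0.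
have W n : (L <= n)%N -> (n <= N)%N -> cabs (expsum (fun n => ka * al n) n) <= eps / (8 * C) * N%:R.
  move=> Ln nN; have := h1 n ka (leq_trans NL1 Ln) k0 kK.
  have bb : B1 <= ka * al n by apply: le_trans BL _; rewrite ler_pM2l // al_mono.
  by move=> /(_ bb) hh; apply: le_trans hh _; rewrite ler_pM2l // ler_nat.
rewrite /increment_sum (@big_cat_nat _ _ _ L) //=; last exact: ltnW.
have p1 : cabs (\sum_(n0 <= n < L) (v n)%:C%C * cis (ka * al n)) <= 2 * eta * C * al N.
  apply: (le_trans (cabs_sum _ _ _)).
  have Ln : L%:R <= 2 * eta * N%:R by have : 0 <= (N1 + n0)%:R :> R by []; lra.
  apply: (@le_trans _ _ (\sum_(n0 <= n < L) (C * al N / N%:R))).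
    rewrite !big_nat; apply: ler_sum => n /andP[nn nL].
    rewrite cabsM cabs_cis mulr1 cabs_real ger0_norm ?subr_ge0 ?al_mono //.
    by rewrite ler_pdivlMr // mulrC vC // nn (ltn_trans nL).
  rewrite big_const_nat iter_addr_0 -[leLHS]mulr_natl.
  apply: (@le_trans _ _ (L%:R * (C * al N / N%:R))).
    rewrite ler_wpM2r // ?ler_nat ?leq_subr // divr_ge0 // mulr_ge0 // ltW //.
  rewrite mulrA ler_pdivrMr //.
  have : L%:R * (C * al N) <= 2 * eta * N%:R * (C * al N) by rewrite ler_wpM2r // mulr_ge0 // ltW.
  lra.
have p2 : cabs (\sum_(L <= n < N) (v n)%:C%C * cis (ka * al n)) <= eps / (4 * C) * N%:R * (2 * (C * al N / N%:R)).
  rewrite -{1}(add0n L) big_addn.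
  have [T NT] : exists T, (N - L = T.+1)%N by exists (N - L).-1; rewrite prednK // subn_gt0.
  have TN : (T + L < N)%N by clear -NT LN; lia.
  rewrite NT.
  have ab := @abel_bound R (fun i => (v (i + L)%N)%:C%C) (fun i => cis (ka * al (i + L)%N)) T (eps / (4 * C) * N%:R).
  apply: le_trans (ab _) _ => [n nT|].
    have -> : \sum_(0 <= i < n) cis (ka * al (i + L)%N) =
       expsum (fun n => ka * al n) (n + L) - expsum (fun n => ka * al n) L.
      have split : expsum (fun n => ka * al n) (n + L) = expsum (fun n => ka * al n) L +
          \sum_(L <= i < n + L) cis (ka * al i) by apply: big_cat_nat; rewrite // leq_addl.
      by rewrite split addrC addrA addNr add0r -{2}(add0n L) big_addn addnK.
    apply: le_trans (cabsB _ _) _.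
    have w1 : cabs (expsum (fun n => ka * al n) (n + L)) <= eps / (8 * C) * N%:R.
      by apply: W; [rewrite leq_addl | clear -nT NT; lia].
    have w2 := W L (leqnn L) (ltnW LN).
    apply: le_trans (lerD w1 w2) _; rewrite le_eqVlt; apply/orP; left; apply/eqP.
    by field; rewrite gt_eqF.
  have b0 : 0 <= eps / (4 * C) * N%:R by rewrite mulr_ge0 // divr_ge0 ?(ltW eps0) // mulr_ge0 // ltW.
  apply: ler_wpM2l => //.
  have vv i : (i <= T)%N -> 0 <= v (i + L)%N <= C * al N / N%:R.
    move=> iT; have nn : (n0 <= i + L)%N by rewrite (leq_trans NL0) // leq_addl.
    rewrite subr_ge0 al_mono //= ler_pdivlMr // mulrC vC // nn /=; clear -iT TN; lia.
  have -> : \sum_(0 <= n < T) cabs ((v (n.+1 + L)%N)%:C%C - (v (n + L)%N)%:C%C) = `|v (T + L)%N - v (0 + L)%N|.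
    rewrite -(@sum_norm_mono R (fun i => v (i + L)%N) T); first by apply: eq_bigr => n _; rewrite -rmorphB cabs_real.
    by case: increment_mono => h; [left|right] => m n /andP[mn _]; apply: h;
      rewrite ?leq_add2r // (leq_trans NL0) // leq_addl.
  have /andP[a1 a2] := vv T (leqnn T); have /andP[a3 a4] := vv 0%N (leq0n T).
  rewrite cabs_real (ger0_norm a1).
  have : `|v (T + L)%N - v (0 + L)%N| <= C * al N / N%:R by rewrite ler_norml; apply/andP; split; lra.
  lra.
have q1 : 2 * eta * C * al N <= eps / 4 * al N.
  rewrite ler_pM2r //; have : eta * C <= eps / (8 * C) * C by rewrite ler_pM2r.
  rewrite (_ : eps / (8 * C) * C = eps / 8); [lra | by field; rewrite gt_eqF].
have q2 : eps / (4 * C) * N%:R * (2 * (C * al N / N%:R)) = eps / 2 * al N.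
  by field; rewrite !gt_eqF.
rewrite q2 in p2.
apply: le_trans (cabsD _ _) _; have : 0 <= eps * al N by rewrite mulr_ge0 // ltW.
lra.
Qed.
End IncrementConditions.

(** * Exponential discrepancy of a sub-polynomial *)

Section Equidistribution.
Context {R : realType}.
Variables (H : set (R -> R)) (alpha : R -> R).
Hypotheses (hH : hardy_field H) (Ha : H alpha).
Hypothesis alpha_gt0 : forall x : R, 1 <= x -> 0 < alpha x.
Hypothesis alpha_ud : forall kappa : R, 0 < kappa ->
  uniformly_distributed_mod1 (fun n : nat => kappa * alpha n%:R).
Hypothesis alpha_subpoly : exists2 l : R, 0 < l & alpha x / x `^ l @[x --> +oo] --> (0 : R).
Local Notation al n := (alpha n%:R).
Local Notation D n := (derive1 alpha n%:R).

Lemma derive_eventually_ge0 : ev (fun x => 0 <= derive1 alpha x).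
Proof.
have [//|h] := hardy_wsign hH (hardy_derive hH Ha); exfalso.
have [x0 hx] := evI (hardy_is_derive hH Ha) h.
have mono : forall x y, x0 <= x -> x <= y -> alpha y <= alpha x.
  by apply: (@nonincreasing_of_derive R alpha (derive1 alpha)) => x /hx[].
have [x1 x01 h1] := ev_from x0 (alpha_infty hH Ha alpha_gt0 alpha_ud (alpha x0 + 1)).
have := h1 x1 (lexx _); have := mono x0 x1 (lexx _) x01; lra.
Qed.

(** If alpha <= x ^ q eventually, the Euler bound and the regularity hold with q + 1; the mean value
    theorem puts each increment between consecutive values of the monotone alpha'. *)
Lemma regular_tail : exists (n0 : nat) (M : R) (p : nat), [/\ (0 < n0)%N,
  forall n, (n0 <= n)%N -> 0 <= D n,
  forall n, (n0 <= n)%N -> n%:R * D n <= M * al n,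
  (forall n, (n0 <= n)%N -> D n <= al n.+1 - al n <= D n.+1) \/
  (forall n, (n0 <= n)%N -> D n.+1 <= al n.+1 - al n <= D n)
  & forall L N, (n0 <= L)%N -> (L <= N)%N -> al N * L%:R ^+ p <= al L * N%:R ^+ p].
Proof.
have [q hq] := alpha_le_poly alpha_subpoly.
have pos : ev (fun x => 0 < alpha x) by exists 1.
have ge1 : ev (fun x => 1 <= alpha x * x ^+ q).
  apply: evS (evI (alpha_infty hH Ha alpha_gt0 alpha_ud 1) (ev_ge 1)) => x [h1 h2].
  by rewrite -[X in X <= _]mulr1 ler_pM // exprn_ege1.
have [xr hr] := hardy_poly_regular hH Ha pos hq ge1.
have eu := hardy_euler_le hH Ha pos hq.
have [xm hm] := hardy_mono hH (hardy_derive hH Ha).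
have [x1 x1r hx] := ev_from (Num.max xr xm) (evI (evI (hardy_is_derive hH Ha) eu) derive_eventually_ge0).
have [n1 hn1] := nat_ge_exists x1.
have big n : (n1.+1 <= n)%N -> x1 <= n%:R by move=> h; apply: hn1; exact: ltnW.
have x1r' : xr <= x1 by apply: le_trans x1r; rewrite le_max lexx.
have x1m : xm <= x1 by apply: le_trans x1r; rewrite le_max lexx orbT.
exists n1.+1, q.+1%:R, q.+1; split=> //.
- by move=> n /big/hx[].
- by move=> n /big/hx[[_ h] _].
- have mvt n : (n1.+1 <= n)%N -> exists2 x, n%:R <= x <= n.+1%:R & al n.+1 - al n = derive1 alpha x.
    move=> /big h; have nn : n%:R <= n.+1%:R :> R by rewrite ler_nat.
    have [|x xn E] := @mean_value R alpha (derive1 alpha) n%:R n.+1%:R nn.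
      by move=> x /andP[h1 _]; have [[]] := hx x (le_trans h h1).
    by exists x => //; rewrite E -natr1 (addrC n%:R) addrK mulr1.
  case: hm => hm; [left|right] => n nn; have [x /andP[xn nx] ->] := mvt n nn;
    have h := le_trans x1m (big n nn); have h' := le_trans h xn; by rewrite !hm.
- move=> L N hL LN; have [_ h] := hr.
  have xL : xr <= L%:R by exact: le_trans x1r' (big L hL).
  have LNR : L%:R <= N%:R :> R by rewrite ler_nat.
  by have [] := h _ _ xL LNR.
Qed.

Lemma exponential_discrepancy (eps : R) : 0 < eps ->
  exists N0 : nat, forall N (th : R), (N0 <= N)%N ->
    cabs (\sum_(1 <= n < N.+1) (D n)%:C%C * cis (th * (Num.truncn (al n))%:R) -
          \sum_(1 <= m < (Num.truncn (al N)).+1) cis (th * m%:R)) <= eps * al N.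
Proof.
move=> eps0.
have [n1 [M [p [n10 D0 Deu Dbt reg]]]] := regular_tail.
have [x1 mono] := alpha_nondecreasing hH Ha alpha_gt0 alpha_ud.
have [k [tk ntk [c c0 hc]]] := exists_degree hH Ha alpha_gt0 alpha_ud alpha_subpoly.
have hc0 : ev (fun x => c * x ^+ 0 <= deriv_iter alpha k x).
  by apply: evS hc => x; rewrite expr0 mulr1.
have [c' c'0 [x2 hx2]] := deriv_iter_growth hH Ha c0 hc0 (leq0n k).
have [n2 hn2] := nat_ge_exists (Num.max x1 x2).
pose n0 := maxn n1 n2.
have n01 n : (n0 <= n)%N -> (n1 <= n)%N by rewrite geq_max => /andP[].
have n02 n : (n0 <= n)%N -> x1 <= n%:R /\ x2 <= n%:R.
  by rewrite geq_max => /andP[_ /hn2]; rewrite ge_max => /andP[].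
have n00 : (0 < n0)%N by rewrite (leq_trans n10) // leq_maxl.
clearbody n0.
have al0 n : (n0 <= n)%N -> 0 < al n.
  by move=> h; apply: alpha_gt0; rewrite ler1n (leq_trans n00).
have almono m n : (n0 <= m)%N -> (m <= n)%N -> al m <= al n.
  by move=> /n02[h _] mn; apply: mono => //; rewrite ler_nat.
have alinf (B : R) : exists N0 : nat, forall N, (N0 <= N)%N -> B <= al N.
  have [x hx] := alpha_infty hH Ha alpha_gt0 alpha_ud B.
  by have [N0 h0] := nat_ge_exists x; exists N0 => N /h0/hx.
have {}D0 n : (n0 <= n)%N -> 0 <= D n by move=> /n01/D0.
have {}Deu n : (n0 <= n)%N -> n%:R * D n <= M * al n by move=> /n01/Deu.
have {}Dbt : (forall n, (n0 <= n)%N -> D n <= al n.+1 - al n <= D n.+1) \/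
  (forall n, (n0 <= n)%N -> D n.+1 <= al n.+1 - al n <= D n).
  by case: Dbt => h; [left|right] => n /n01/h.
have {}reg L N : (n0 <= L)%N -> (L <= N)%N -> al N * L%:R ^+ p <= al L * N%:R ^+ p by move=> /n01; exact: reg.
have weyl (e K : R) : 0 < e -> 0 < K -> exists (B : R) (N0 : nat), forall N (ka : R),
    (N0 <= N)%N -> 0 < ka -> ka <= K -> B <= ka * al N -> cabs (increment_sum (fun n => al n) n0 N ka) <= e * al N.
  (* k = 0 means that alpha' tends to 0. Otherwise alpha >= c' * x ^ k grows at least linearly, as
     the summation by parts requires. *)
  move=> e0 K0; have [k0|k0] := posnP k.
    apply: (increment_sum_slow al0 almono alinf Dbt) => // e' e'0.
    move: tk; rewrite k0 => /(_ e' e'0)[x hx]; have [N0 hN] := nat_ge_exists x.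
    by exists N0 => n /hN/hx /ltW; apply: le_trans; exact: ler_norm.
  apply: (increment_sum_fast al0 almono D0 Deu Dbt reg n00 c'0) => //.
    move=> n nn; have [_ h] := n02 n nn; have := hx2 _ h; apply: le_trans.
    rewrite subn0 addn0 ler_pM2l // -[leLHS]expr1 ler_weXn2l // ler1n; exact: leq_trans nn.
  move=> e' K' e'0 K'0.
  exact: (uniform_weyl hH Ha alpha_gt0 alpha_ud k0 tk (ex_intro2 _ _ c c0 hc) e'0 K'0).
apply: (@derivative_floor R (fun n => al n) n0 al0 almono alinf _ weyl (fun n => D n)) => //.
- exact: (increment_negligible al0 alinf D0 Deu Dbt).
- exact: (derivative_increment al0 alinf D0 Deu Dbt).
Qed.
End Equidistribution.

(** * Monotone majorants of null sequences *)

Section NonincreasingMajorant.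
Context {R : realType}.

(** The tail supremum is nonincreasing and tends to 0; a harmonic term makes it positive. *)
Lemma nonincreasing_majorant (e : nat -> R) : (forall n, 0 <= e n) -> e n @[n --> \oo] --> (0 : R) ->
  exists w : nat -> R, [/\ forall n, 0 < w n, forall m n, (m <= n)%N -> w n <= w m,
    w n @[n --> \oo] --> (0 : R) & forall n, e n <= w n].
Proof.
move=> e0 he.
have ub : has_ubound (range e).
  by apply/bounded_fun_has_ubound/cvg_seq_bounded; apply/cvg_ex; exists 0.
have le n : e n <= sups e n.
  apply: sup_ubound; last by exists n => /=.
  by apply: (subset_has_ubound _ ub) => _ [i _ <-]; exists i.
have hm (n : nat) : 0 < n.+1%:R^-1 :> R by rewrite invr_gt0.
exists (fun n => sups e n + n.+1%:R^-1); split.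
- by move=> n; apply: ltr_wpDl => //; apply: le_trans (le n).
- move=> m n mn; apply: lerD; first exact: nonincreasing_sups.
  by rewrite lef_pV2 ?posrE // ler_nat.
- rewrite -[X in _ --> X]addr0; apply: cvgD; first exact: cvg_sups he.
  exact: cvg_harmonic.
- by move=> n; apply: le_trans (le n) _; rewrite lerDl ltW.
Qed.
End NonincreasingMajorant.

(** * Comparison of the two averages *)

Section VonNeumannFamily.
Context {R : realType} {d : measure_display} {X : measurableType d}.
Variables (mu : probability X R) (T : X -> X).
Hypothesis mpT : measure_preserving_system mu T.

Lemma sum_by_values {I : eqType} (V : nmodType) (s : seq I) (m : I -> nat) (F : I -> nat -> V) M :
  {in s, forall i, (m i < M)%N} ->
  \sum_(i <- s) F i (m i) = \sum_(0 <= k < M) \sum_(i <- s | m i == k) F i k.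
Proof.
move=> hM; under [RHS]eq_bigr do rewrite big_mkcond.
rewrite exchange_big /=; apply: eq_big_seq => i si.
by rewrite -big_mkcond /= (eq_bigl (fun k => k == m i)) ?big_nat1_eq ?hM // => k; rewrite eq_sym.
Qed.

(** Distinct n can share the same floor of alpha n, so coefficients with a common exponent are added
    up before [von_neumann_inequality] is applied. *)
Lemma von_neumann_family {I : eqType} (s : seq I) (c : I -> R) (m : I -> nat) (bd : R) (A B : set X) :
  measurable A -> measurable B -> 0 <= bd ->
  (forall th : R, cabs (\sum_(i <- s) (c i)%:C%C * cis (th * (m i)%:R)) <= bd) ->
  `|\sum_(i <- s) c i * correlation mu T A B (m i)| <= bd * Num.sqrt (fine (mu A) * fine (mu B)).
Proof.
move=> mA mB bd0 hc; pose M := (\max_(i <- s) m i).+1.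
have hM : {in s, forall i, (m i < M)%N} by move=> i si; rewrite ltnS leq_bigmax_seq.
rewrite (@sum_by_values I R s m (fun i k => c i * correlation mu T A B k) M) //.
under eq_bigr do rewrite -mulr_suml.
apply: von_neumann_inequality => // th.
apply: le_trans (hc th); rewrite le_eqVlt; apply/orP; left; apply/eqP; congr cabs.
rewrite (@sum_by_values I R[i] s m (fun i k => (c i)%:C%C * cis (th * k%:R)) M) //.
apply: eq_bigr => k _; rewrite mulrC (raddf_sum (real_complex R)) mulr_sumr.
by apply: eq_bigr => i _; rewrite mulrC (mulrC th).
Qed.
End VonNeumannFamily.

(** The tag tells the two averages apart, so that their difference is one signed family of
    exponents. *)
Definition comparison_index N Y : seq (bool * nat) :=
  [seq (true, n) | n <- index_iota 1 N.+1] ++ [seq (false, m) | m <- index_iota 1 Y.+1].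

Lemma sum_comparison_index (V : nmodType) N Y (F : bool * nat -> V) :
  \sum_(i <- comparison_index N Y) F i =
  \sum_(1 <= n < N.+1) F (true, n) + \sum_(1 <= m < Y.+1) F (false, m).
Proof. by rewrite big_cat !big_map. Qed.

(* A function on [1, +oo) differentiable there (one-sidedly at 1) extends to a
   total function derivable at every x >= 1, with the same derivatives; alpha
   is such an extension.  Sequences indexed by {1, 2, ...} are functions on nat
   whose value at 0 is ignored.  As alpha is positive on [1, +oo),
   Num.truncn (alpha n%:R) is the floor of alpha n%:R. *)
Theorem corollary1p17 (R : realType) (alpha : R -> R)
    (alpha_subpoly : sub_polynomial alpha)
    (alpha_gt0 : forall x : R, 1 <= x -> 0 < alpha x)
    (alpha_derivable : forall x : R, 1 <= x -> derivable alpha x 1)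
    (alpha_ud : forall kappa : R, 0 < kappa ->
       uniformly_distributed_mod1 (fun n : nat => kappa * alpha n%:R)) :
  exists w : nat -> R,
    [/\ forall N : nat, (1 <= N)%N -> 0 < w N,
        forall M N : nat, (1 <= M)%N -> (M <= N)%N -> w N <= w M,
        w N @[N --> \oo] --> (0 : R)
      & forall (N : nat), (1 <= N)%N ->
        forall (d : measure_display) (X : measurableType d)
          (mu : probability X R) (T : X -> X),
          measure_preserving_system mu T ->
        forall A B : set X, measurable A -> measurable B ->
          `| (alpha N%:R)^-1 *
               (\sum_(1 <= n < N.+1)
                  derive1 alpha n%:R *
                  correlation mu T A B (Num.truncn (alpha n%:R)))
             - (alpha N%:R)^-1 *
               (\sum_(1 <= m < (Num.truncn (alpha N%:R)).+1)
                  correlation mu T A B m) |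
          <= w N * Num.sqrt (fine (mu A) * fine (mu B))].
Proof.
have [[H hH Ha] hl] := alpha_subpoly.
pose P N (th : R) := \sum_(1 <= n < N.+1) (derive1 alpha n%:R)%:C%C * cis (th * (Num.truncn (alpha n%:R))%:R) -
          \sum_(1 <= m < (Num.truncn (alpha N%:R)).+1) cis (th * m%:R).
pose S N := [set cabs (P N th) | th in [set: R]].
have S0 N : S N !=set0 by exists (cabs (P N 0)), 0.
have ubS N : has_ubound (S N).
  exists (\sum_(1 <= n < N.+1) `|derive1 alpha n%:R| + \sum_(1 <= m < (Num.truncn (alpha N%:R)).+1) 1).
  move=> _ [th _ <-]; apply: le_trans (cabsB _ _) _; apply: lerD.
    apply: le_trans (cabs_sum _ _ _) _; apply: ler_sum => n _.
    by rewrite cabsM cabs_cis mulr1 cabs_real.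
  by apply: le_trans (cabs_sum _ _ _) _; apply: ler_sum => n _; rewrite cabs_cis.
(* The normalised supremum over all frequencies, which does not involve the system. At N = 0, where
   alpha is unconstrained, it is set to 0. *)
pose e N := if (0 < N)%N then sup (S N) / alpha N%:R else 0.
have a0 N : (0 < N)%N -> 0 < alpha N%:R by move=> N0; apply: alpha_gt0; rewrite ler1n.
have P_le N th : (0 < N)%N -> cabs (P N th) <= e N * alpha N%:R.
  move=> N0; rewrite /e N0 divfK ?gt_eqF ?a0 //; apply: sup_ubound => //; by exists th.
have e0 N : 0 <= e N.
  rewrite /e; case: ifP => // N0; rewrite divr_ge0 ?(ltW (a0 _ N0)) //.
  by apply: le_trans (cabs_ge0 (P N 0)) _; apply: sup_ubound => //; exists 0.
have he : e n @[n --> \oo] --> (0 : R).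
  apply/cvgrPdist_le => eps eps0.
  have [N0 h] := exponential_discrepancy hH Ha alpha_gt0 alpha_ud hl eps0.
  exists (maxn N0 1) => // N /=; rewrite geq_max => /andP[NN N1].
  rewrite sub0r normrN ger0_norm // /e N1 ler_pdivrMr ?a0 //.
  by apply: sup_le_ub => // _ [th _ <-]; exact: h.
have [w [w0 wm wc we]] := nonincreasing_majorant e0 he.
exists w; split => //; first by move=> M N _; exact: wm.
move=> N N1 d X mu T mpT A B mA mB.
have aN := a0 N N1; set Y := Num.truncn (alpha N%:R).
pose c i := (alpha N%:R)^-1 * (if i.1 : bool then derive1 alpha i.2%:R else - 1).
pose m i := if i.1 : bool then Num.truncn (alpha i.2%:R) else i.2.
have := von_neumann_family mpT (s := comparison_index N Y) (c := c) (m := m) mA mB (ltW (w0 N)).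
rewrite sum_comparison_index /c /m /=.
have -> : (alpha N%:R)^-1 * (\sum_(1 <= n < N.+1) derive1 alpha n%:R * correlation mu T A B (Num.truncn (alpha n%:R))) =
  \sum_(1 <= n < N.+1) (alpha N%:R)^-1 * derive1 alpha n%:R * correlation mu T A B (Num.truncn (alpha n%:R)).
  by rewrite mulr_sumr; apply: eq_bigr => n _; rewrite mulrA.
have -> : (alpha N%:R)^-1 * (\sum_(1 <= m < Y.+1) correlation mu T A B m) =
  - \sum_(1 <= m < Y.+1) (alpha N%:R)^-1 * -1 * correlation mu T A B m.
  by rewrite mulr_sumr -sumrN; apply: eq_bigr => n _; rewrite mulrN1 mulNr opprK.
rewrite opprK; apply => th.
rewrite sum_comparison_index /=.
have -> : \sum_(1 <= n < N.+1) ((alpha N%:R)^-1 * derive1 alpha n%:R)%:C%C * cis (th * (Num.truncn (alpha n%:R))%:R) +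
   \sum_(1 <= m < Y.+1) ((alpha N%:R)^-1 * -1)%:C%C * cis (th * m%:R) = ((alpha N%:R)^-1)%:C%C * P N th.
  rewrite /P mulrBr !mulr_sumr -sumrN; congr (_ + _); apply: eq_bigr => n _.
    by rewrite rmorphM mulrA.
  by rewrite mulrN1 rmorphN mulNr.
rewrite cabsM cabs_real ger0_norm ?invr_ge0 ?(ltW aN) // ler_pdivrMl //.
by apply: le_trans (P_le N th N1) _; rewrite mulrC ler_pM2l.
Qed.
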